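(* There is a universal constant $C$ such that: for every unconditional log-concave random vector $X$ in $\mathbb{R}^d$, every $p\geq 1$, $A>0$, and every $T\subset\mathbb{R}^d$ with $|T|\geq e^{p^2}$ and $\|\langle t-s,X\rangle\|_p\geq A$ for all distinct $t,s\in T$, \[ \mathbb{E}\sup_{t,s\in T}\langle t-s,X\rangle=2\,\mathbb{E}\sup_{t\in T}\langle t,X\rangle\geq\frac{1}{C}A. \]
   Context: $\|Y\|_p:=(\mathbb{E}|Y|^p)^{1/p}$. A random vector is log-concave if its law $\mu$ satisfies $\mu(\lambda K+(1-\lambda)L)\geq\mu(K)^\lambda\mu(L)^{1-\lambda}$ for all nonempty compact $K,L$ and $\lambda\in[0,1]$. $X=(X_1,\dots,X_d)$ is unconditional if $(\eta_1X_1,\dots,\eta_dX_d)$ has the same law as $X$ for every choice of signs $\eta_i\in\{-1,1\}$. *)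

(* Defs.v *)
From HB Require Import structures.
From mathcomp Require Import all_boot all_order all_algebra.
From mathcomp Require Import all_classical all_reals all_analysis.
Set Implicit Arguments. Unset Strict Implicit. Unset Printing Implicit Defensive.
Import Order.TTheory GRing.Theory Num.Theory.
Import numFieldNormedType.Exports.
Local Open Scope classical_set_scope.
Local Open Scope ring_scope.

Section Defs.
Context {R : realType} {d0 : measure_display} {Omega : measurableType d0}.
Context (P : probability Omega R).

Definition rvec (d : nat) (X : 'I_d -> {RV P >-> R}) (w : Omega) : 'rV[R]_d :=
  \row_i X i w.

Definition dotv (d : nat) (t x : 'rV[R]_d) : R := \sum_(i < d) t 0 i * x 0 i.

Definition borel_rV (d : nat) : set (set 'rV[R]_d) := <<s [set U | open U] >>.

Definition lawX (d : nat) (X : 'I_d -> {RV P >-> R}) (B : set 'rV[R]_d) : \bar R :=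
  P (rvec X @^-1` B).

Definition mink (d : nat) (l : R) (K L : set 'rV[R]_d) : set 'rV[R]_d :=
  [set l *: k + (1 - l) *: m | k in K & m in L].

Definition log_concave_vec (d : nat) (X : 'I_d -> {RV P >-> R}) : Prop :=
  forall (K L : set 'rV[R]_d) (l : R),
    compact K -> K !=set0 -> compact L -> L !=set0 -> 0 <= l <= 1 ->
    (fine (lawX X K)) `^ l * (fine (lawX X L)) `^ (1 - l)
      <= fine (lawX X (mink l K L)).

Definition unconditional_vec (d : nat) (X : 'I_d -> {RV P >-> R}) : Prop :=
  forall eta : 'I_d -> R, (forall i, eta i = 1 \/ eta i = -1) ->
  forall B : set 'rV[R]_d, borel_rV B ->
    P (rvec X @^-1` B) = P ((fun w => \row_i (eta i * X i w)) @^-1` B).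

(* E sup_{i in T} Y_i, with the standard convention
   sup { E sup_{i in F} Y_i : F finite subset of T } *)
Definition Esup (I : Type) (T : set I) (Y : I -> Omega -> R) : \bar R :=
  ereal_sup [set (\int[P]_w ereal_sup [set (Y i w)%:E | i in F])%E
            | F in [set F : set I | F `<=` T /\ finite_set F]].

End Defs.

(* Main.v *)
(* Suppose that E max_{t in T} <t - s, X> <= m for all s in a family T of
   e^(p^2) points, m being a small multiple of A. By log-concavity the moment
   hypothesis becomes a tail bound: |<t - s, X>| exceeds a multiple of A with
   probability at least e^(-p/64). Put b_k = E|X_k|. Jensen's inequality and the
   contraction principle bound the Rademacher process of the vectors (t_k b_k),
   and Sudakov's argument for it puts e^(c p^2) points of T near a common s, in
   the sense that the sum over k of min(b_k^2 (t_k - s_k)^2, (m/p)^2) is at most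
   64 m^2/p. Truncating b_k (t - s)_k at height m/p splits t - s into a spread
   part, negligible by an exponential moment bound that uses only the joint tails
   of the coordinates, and an excess carried by at most 64 p coordinates.
   Quantizing the excess and extracting a sunflower leaves more than 41 e^p points
   whose excesses nearly agree on a kernel, whose contribution is again
   negligible, and have disjoint supports off it. By unconditionality the
   variables Y_t given by these disjoint parts are jointly sign-symmetric, and
   Prekopa-Leindler shows that the sum over t of P(|Y_t| >= 160 m) is at most 5
   once max |Y_t| <= 4 m with probability at least 1/2. But all the Y_t except
   one have P(|Y_t| >= 160 m) >= e^(-p)/8. *)
Require Import Defs.
From HB Require Import structures.
From mathcomp Require Import all_boot all_order all_algebra.
From mathcomp Require Import all_classical all_reals all_analysis.
From mathcomp Require Import measurable_realfun.
From mathcomp Require Import zify ring lra.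
Set Implicit Arguments.
Unset Strict Implicit.
Unset Printing Implicit Defensive.
Import Order.TTheory GRing.Theory Num.Theory.
Import numFieldNormedType.Exports.
Local Open Scope classical_set_scope.
Local Open Scope ring_scope.

(** The coordinates of [X] are dependent, so no comparison with a product measure is available.
    Everything rests on two facts about polyhedra: coordinate flips preserve their probability, and
    for fixed normals it is log-concave in the levels. The exponent [p ^+ 2] is spent in two places:
    the density of the tilted signs costs [expR (3 * p ^+ 2)], and the sunflower, with sets of at
    most [64 * p] coordinates and at most [expR (36 * p)] choices per step, costs
    [expR (2304 * p ^+ 2)]. To afford this, the moment order is first divided by 64, which turns
    [expR (p ^+ 2)] into [expR (4096 * p ^+ 2)]; for orders below 64 a single pair of points
    suffices. With [p] the divided order, each discarded piece of a difference may use up only a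
    fraction of its tail probability [expR (- p)], and the final count is a contradiction because
    [41 / 8 > 5]. Prekopa-Leindler must hold with an error factor independent of the number of
    variables [Y_t]: it is proved for sums over integers and applied on geometric grids whose mesh
    shrinks with that number, so that no multidimensional integral occurs. *)

Section DiscretePrekopa.

(** * Prekopa-Leindler inequality for sums over integers *)

Context {R : rcfType}.

Lemma seq_max_mem (s : seq R) : s != [::] ->
  exists2 x, x \in s & forall y, y \in s -> y <= x.
Proof.
elim: s => // a s IH _; have [->|sN] := eqVneq s [::].
  by exists a; rewrite ?mem_head // => y; rewrite inE => /eqP ->.
have [x xs xm] := IH sN; have [ax|/ltW xa] := lerP a x.
  exists x; first by rewrite inE xs orbT.
  by move=> y; rewrite inE => /orP[/eqP -> //|/xm].
exists a; first exact: mem_head.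
by move=> y; rewrite inE => /orP[/eqP -> //|/xm yx]; exact: le_trans yx xa.
Qed.

(** A layer-cake comparison without integrals. At the threshold [c = max s] the hypothesis gives
    [max s <= max t], and deleting both maxima preserves it, since above [max s] nothing of [s] is
    counted. *)
Lemma sum_le_of_count (s t : seq R) : (forall y, y \in t -> 0 <= y) ->
  (forall c, 0 < c -> (count (fun x => (c <= x)%R) s <= count (fun x => (c <= x)%R) t)%N) ->
  \sum_(x <- s) x <= \sum_(x <- t) x.
Proof.
elim: {s}(size s) {-2}s (leqnn (size s)) t => [|n IH] s sn t t0 ct.
  by move: sn; rewrite leqn0 size_eq0 => /eqP ->; rewrite big_nil big_seq; exact: sumr_ge0.
have [->|sN] := eqVneq s [::]; first by rewrite big_nil big_seq; exact: sumr_ge0.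
have [x xs xm] := seq_max_mem sN.
have [x0|x0] := lerP x 0.
  apply: (@le_trans _ _ 0); last by rewrite big_seq; exact: sumr_ge0.
  by rewrite big_seq; apply: sumr_le0 => y /xm /le_trans; apply.
have tN : t != [::].
  apply/eqP => tE; have := ct _ x0; rewrite tE /= leqn0 eqn0Ngt -has_count => /hasP; apply.
  by exists x.
have [y yt ym] := seq_max_mem tN.
have xy : x <= y.
  have : (0 < count (fun z => (x <= z)%R) t)%N.
    by apply: leq_trans (ct _ x0); rewrite -has_count; apply/hasP; exists x.
  by rewrite -has_count => /hasP[z zt xz]; exact: le_trans xz (ym _ zt).
rewrite (big_rem x xs) (big_rem y yt) /=; apply: (lerD xy); apply: IH.
- by rewrite size_rem //; case: (s) sN sn.
- by move=> z /mem_rem; exact: t0.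
- move=> c c0; rewrite !count_rem xs yt /=.
  have [cx|xc] := lerP c x; first by rewrite (le_trans cx xy) leq_sub2r ?ct.
  suff -> : count (fun z => c <= z) s = 0%N by [].
  apply/eqP; rewrite eqn0Ngt -has_count; apply/hasP => -[z zs cz].
  by have := lt_le_trans xc (le_trans cz (xm _ zs)); rewrite ltxx.
Qed.

(** Take [A + min B] together with [max A + B + 1]. The first part stays at or below [max A + min B]
    and the second lies strictly above, so no element is lost to overlap. *)
Lemma sumset_size (A B : seq nat) : uniq A -> uniq B -> A != [::] -> B != [::] ->
  exists C : seq nat, [/\ uniq C, size C = (size A + size B)%N &
    forall l, l \in C -> exists i j, [/\ i \in A, j \in B & (l = i + j \/ l = (i + j).+1)%N]].
Proof.
move=> uA uB nA nB.
have exB : exists j, j \in B by case: (B) nB => // b B' _; exists b; exact: mem_head.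
have exA : exists i, i \in A by case: (A) nA => // a A' _; exists a; exact: mem_head.
have bA : forall i, i \in A -> (i <= \sum_(k <- A) k)%N.
  by move=> i iA; rewrite (big_rem i iA) /= leq_addr.
case: (ex_minnP exB) => b bB bmin.
case: (ex_maxnP exA bA) => a aA amax.
exists ([seq i + b | i <- A] ++ [seq (a + j).+1 | j <- B])%N; split.
- rewrite cat_uniq !map_inj_uniq ?uA ?uB /= ?andbT; [|by move=> i j; lia..].
  apply/hasPn => l /mapP[j jB ->]; apply/mapP => -[i iA].
  by have := amax _ iA; have := bmin _ jB; lia.
- by rewrite size_cat !size_map.
- move=> l; rewrite mem_cat => /orP[/mapP[i iA ->]|/mapP[j jB ->]].
    by exists i, b; split => //; left.
  by exists a, j; split => //; right.
Qed.

Lemma max_nat_attained (p : nat -> R) K : (0 < K)%N ->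
  exists2 i, (i < K)%N & forall j, (j < K)%N -> p j <= p i.
Proof.
move=> K0; have /seq_max_mem[x /mapP[i]] : [seq p i | i <- iota 0 K] != [::].
  by case: (K) K0.
rewrite mem_iota /= add0n => iK -> h; exists i => // j jK; apply: h.
by apply: map_f; rewrite mem_iota.
Qed.

(* The two conditions on [r] make its superlevel sets contain [A + B] and
   [A + B + 1] for superlevel sets [A] of [p] and [B] of [q]: on the integers,
   [A + B] alone has only [#A + #B - 1] elements in general. *)
Lemma discrete_prekopa_leindler (K : nat) (p q r : nat -> R) :
  (forall i, 0 <= p i) -> (forall i, 0 <= q i) -> (forall i, 0 <= r i) ->
  (forall i j, (i < K)%N -> (j < K)%N ->
     p i * q j <= r (i + j)%N ^+ 2 /\ p i * q j <= r (i + j).+1 ^+ 2) ->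
  4 * ((\sum_(i <- iota 0 K) p i) * (\sum_(i <- iota 0 K) q i)) <=
    (\sum_(i <- iota 0 (K + K)) r i) ^+ 2.
Proof.
move=> p0 q0 r0 pqr.
have [->|Kpos] := posnP K; first by rewrite !big_nil mul0r mulr0 sqr_ge0.
have [i0 i0K pm] := max_nat_attained p Kpos.
have [j0 j0K qm] := max_nat_attained q Kpos.
have [pi0|] := lerP (p i0) 0.
  have -> : \sum_(i <- iota 0 K) p i = 0.
    rewrite big_seq big1 // => i; rewrite mem_iota /= add0n => iK.
    by apply/le_anti; rewrite p0 (le_trans (pm _ iK)).
  by rewrite mul0r mulr0 sqr_ge0.
set a := p i0 => a0.
have [qj0|] := lerP (q j0) 0.
  have -> : \sum_(i <- iota 0 K) q i = 0.
    rewrite big_seq big1 // => i; rewrite mem_iota /= add0n => iK.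
    by apply/le_anti; rewrite q0 (le_trans (qm _ iK)).
  by rewrite mulr0 mulr0 sqr_ge0.
set b := q j0 => b0.
set c : R := Num.sqrt (a * b).
have c0 : 0 < c by rewrite sqrtr_gt0 mulr_gt0.
have c2 : c ^+ 2 = a * b by rewrite sqr_sqrtr // ltW // mulr_gt0.
(* Both functions are normalised to have maximum 1. For thresholds above 1 the left count is then 0;
   up to 1 both superlevel sets are nonempty, as [sumset_size] requires. AM-GM turns the resulting
   sum into the product. *)
have key : (\sum_(i <- iota 0 K) p i) / a + (\sum_(i <- iota 0 K) q i) / b <=
    (\sum_(i <- iota 0 (K + K)) r i) / c.
  have -> : (\sum_(i <- iota 0 K) p i) / a + (\sum_(i <- iota 0 K) q i) / b =
     \sum_(x <- [seq p i / a | i <- iota 0 K] ++ [seq q i / b | i <- iota 0 K]) x.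
    by rewrite big_cat !big_map !mulr_suml.
  have -> : (\sum_(i <- iota 0 (K + K)) r i) / c =
     \sum_(x <- [seq r i / c | i <- iota 0 (K + K)]) x by rewrite big_map mulr_suml.
  apply: sum_le_of_count => [y /mapP[i _ ->]|t t0]; first by rewrite divr_ge0 // ltW.
  rewrite count_cat !count_map.
  have [t1|t1] := lerP t 1; last first.
    have z (f : nat -> R) (m : R) : 0 < m -> (forall j, (j < K)%N -> f j <= m) ->
        count (preim (fun i => f i / m) (fun x => t <= x)) (iota 0 K) = 0%N.
      move=> m0 fm; apply/eqP; rewrite eqn0Ngt -has_count; apply/hasP => -[i].
      rewrite mem_iota /= add0n => /fm fi; rewrite ler_pdivlMr // => ti.
      have : m < t * m by rewrite ltr_pMl.
      by move=> /(le_lt_trans fi); rewrite ltNge ti.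
    by rewrite (z p a) // (z q b).
  rewrite -!size_filter.
  set A := [seq x <- iota 0 K | _]; set B := [seq x <- iota 0 K | _].
  have memA i : i \in A -> (i < K)%N /\ t * a <= p i.
    by rewrite mem_filter mem_iota /= add0n => /andP[]; rewrite ler_pdivlMr.
  have memB i : i \in B -> (i < K)%N /\ t * b <= q i.
    by rewrite mem_filter mem_iota /= add0n => /andP[]; rewrite ler_pdivlMr.
  have nA : A != [::].
    have : i0 \in A by rewrite mem_filter mem_iota /= add0n i0K divff ?gt_eqF // t1.
    by case: (A).
  have nB : B != [::].
    have : j0 \in B by rewrite mem_filter mem_iota /= add0n j0K divff ?gt_eqF // t1.
    by case: (B).
  have uA : uniq A by rewrite filter_uniq // iota_uniq.
  have uB : uniq B by rewrite filter_uniq // iota_uniq.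
  have [C [uC sC CAB]] := sumset_size uA uB nA nB.
  rewrite -sC; apply: uniq_leq_size => // l /CAB[i [j [/memA[iK ti] /memB[jK tj] lE]]].
  have h : t * c <= r l.
    rewrite -(@ler_pXn2r _ 2) ?nnegrE // ?(mulr_ge0 (ltW t0) (ltW c0)) // exprMn c2.
    have pq : t ^+ 2 * (a * b) <= p i * q j.
      have -> : t ^+ 2 * (a * b) = (t * a) * (t * b) by ring.
      by apply: ler_pM => //; rewrite mulr_ge0 // ltW.
    by have [h1 h2] := pqr i j iK jK; case: lE => ->; apply: le_trans pq _.
  have lK : (l < K + K)%N by case: lE => ->; [apply: ltnW|]; rewrite -addSn -addnS leq_add.
  by rewrite mem_filter mem_iota add0n lK leq0n andbT /= ler_pdivlMr // h.
set u := (\sum_(i <- iota 0 K) p i) in key *; set v := (\sum_(i <- iota 0 K) q i) in key *.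
set w := (\sum_(i <- iota 0 (K + K)) r i) in key *.
have u0 : 0 <= u by apply: sumr_ge0.
have v0 : 0 <= v by apply: sumr_ge0.
have uv : 0 <= u / a + v / b by rewrite addr_ge0 // divr_ge0 // ltW.
have : (u / a + v / b) ^+ 2 <= (w / c) ^+ 2.
  by rewrite ler_pXn2r ?nnegrE ?(le_trans uv).
rewrite [X in _ <= X]exprMn exprVn c2 ler_pdivlMr ?mulr_gt0 //.
apply: le_trans.
have -> : u * v = (u / a) * (v / b) * (a * b) by field; rewrite !gt_eqF.
rewrite mulrA ler_pM2r ?mulr_gt0 //.
by have := sqr_ge0 (u / a - v / b); nra.
Qed.

Fixpoint msum (N K : nat) (F : seq nat -> R) : R :=
  if N is N'.+1 then \sum_(i <- iota 0 K) msum N' K (fun s => F (i :: s)) else F [::].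

Lemma msum_ge0 N K F : (forall s, 0 <= F s) -> 0 <= msum N K F.
Proof. by elim: N F => //= N IH F F0; apply: sumr_ge0 => i _; exact: IH. Qed.

Lemma msum_prod N K (f : nat -> nat -> R) :
  msum N K (fun s => \prod_(k < N) f k (nth 0%N s k)) = \prod_(k < N) \sum_(i <- iota 0 K) f k i.
Proof.
elim: N f => [|N IH] f /=; first by rewrite !big_ord0.
rewrite big_ord_recl mulr_suml; apply: eq_bigr => i _.
rewrite -(IH (fun k => f k.+1)).
have : forall (c : R) F, msum N K (fun s => c * F s) = c * msum N K F.
  move=> c; elim: (N) => [//|N' IH'] F /=; rewrite mulr_sumr.
  by apply: eq_bigr => j _; exact: IH'.
move=> <-; congr msum; apply: funext => s.
by rewrite big_ord_recl.
Qed.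

(** The successor is allowed independently in every coordinate; this is what lets the
    one-dimensional inequality tensorize. *)
Fixpoint half_sum_rel (s t u : seq nat) : Prop :=
  match s, t, u with
  | i :: s', j :: t', l :: u' => (l = i + j \/ l = (i + j).+1)%N /\ half_sum_rel s' t' u'
  | [::], [::], [::] => True
  | _, _, _ => False
  end.

(** Tensorization: by induction the partial sums with fixed first index satisfy the one-dimensional
    hypothesis, once the factor [4 ^+ N] is shared as [2 ^+ N] between [p] and [q]. *)
Lemma msum_prekopa_leindler N K (F G H : seq nat -> R) :
  (forall s, 0 <= F s) -> (forall s, 0 <= G s) -> (forall s, 0 <= H s) ->
  (forall s t u, size s = N -> half_sum_rel s t u -> F s * G t <= H u ^+ 2) ->
  4 ^+ N * (msum N K F * msum N K G) <= msum N (K + K) H ^+ 2.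
Proof.
elim: N F G H => [|N IH] F G H F0 G0 H0 FGH /=; first by rewrite expr0 mul1r; exact: FGH.
set p := fun i => msum N K (fun s => F (i :: s)).
set q := fun i => msum N K (fun s => G (i :: s)).
set r := fun i => msum N (K + K) (fun s => H (i :: s)).
have n2 : 0 <= (2 : R) ^+ N by rewrite exprn_ge0.
have := @discrete_prekopa_leindler K (fun i => 2 ^+ N * p i) (fun i => 2 ^+ N * q i) r.
rewrite -!mulr_sumr => pl.
have -> : 4 ^+ N.+1 * ((\sum_(i <- iota 0 K) p i) * (\sum_(i <- iota 0 K) q i)) =
  4 * ((2 ^+ N * \sum_(i <- iota 0 K) p i) * (2 ^+ N * \sum_(i <- iota 0 K) q i)).
  by rewrite exprS (_ : 4 = 2 * 2 :> R); [rewrite exprMn; ring|ring].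
apply: pl.
- by move=> i; apply: mulr_ge0 => //; exact: msum_ge0.
- by move=> i; apply: mulr_ge0 => //; exact: msum_ge0.
- by move=> i; exact: msum_ge0.
- move=> i j _ _.
  have -> : 2 ^+ N * p i * (2 ^+ N * q j) = 4 ^+ N * (p i * q j).
    by rewrite (_ : 4 = 2 * 2 :> R); [rewrite exprMn; ring|ring].
  split; apply: IH => // s t u sN stu; apply: FGH; rewrite /= ?sN //.
    by split => //; left.
  by split => //; right.
Qed.

End DiscretePrekopa.

(** * A sunflower lemma with coloured kernel *)

Module Sunflower.
Import mathcomp.boot.fintype mathcomp.boot.finset.
Local Close Scope classical_set_scope.

(** Induction on [q]. A maximal disjoint subfamily with [N0] members is a sunflower with empty
    kernel. Otherwise its union is small and meets all other sets, so many sets share an element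
    with one colour; that element joins the kernel and is deleted. The colours will be quantized
    coefficients, so that the chosen vectors nearly agree on [J]. *)
Lemma sunflower (I K : finType) (c N0 M q : nat) (S : I -> {set K})
    (col : I -> K -> 'I_c) (T : {set I}) :
  (N0 * q * c < M)%N -> (forall i, i \in T -> #|S i| <= q)%N ->
  (M ^ q * N0 <= #|T|)%N ->
  exists (J : {set K}) (T' : {set I}), [/\ T' \subset T, (N0 <= #|T'|)%N, (#|J| <= q)%N,
    forall i j, i \in T' -> j \in T' -> i != j -> [disjoint S i :\: J & S j :\: J] &
    forall i j k, i \in T' -> j \in T' -> k \in J -> col i k = col j k].
Proof.
elim: q S T => [|q IH] S T Mq Sq Tn.
  exists set0, T; split; rewrite ?cards0 //; first by move: Tn; rewrite expn0 mul1n.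
    move=> i j /Sq + _ _; rewrite leqn0 cards_eq0 => /eqP ->.
    by rewrite set0D disjoints_subset sub0set.
  by move=> i j k _ _; rewrite inE.
pose dis (U : {set I}) := (U \subset T) &&
  [forall i in U, forall j in U, (i != j) ==> [disjoint S i & S j]].
have dis0 : dis set0 by rewrite /dis sub0set; apply/forall_inP => i; rewrite inE.
have [U /maxsetP[/andP[UT /forall_inP disU] maxU] _] := maxset_exists dis0.
have [NU|UN] := leqP N0 #|U|.
  exists set0, U; split; rewrite ?cards0 //; last by move=> i j k _ _; rewrite inE.
  move=> i j iU jU ij; rewrite !setD0.
  exact: (implyP (forall_inP (disU i iU) j jU)).
set V := \bigcup_(i in U) S i.
have Vle : (#|V| <= N0 * q.+1)%N.
  apply: (@leq_trans (\sum_(i in U) q.+1)%N); last first.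
    by rewrite sum_nat_const leq_mul2r (ltnW UN) orbT.
  rewrite /V; elim/big_rec2: _ => [|i a B iU]; first by rewrite cards0.
  move=> Ba; rewrite (leq_trans (leq_card_setU _ _)) // leq_add //.
  exact/Sq/(subsetP UT).
set B := (M ^ q * N0)%N.
pose fib k x := [set i in T | (k \in S i) && (col i k == x)].
(* By maximality of [U], each set outside [U] meets [V] and so lies in one of at most
   [N0 * q.+1 * c] fibres. If all fibres had fewer than [B] elements, [T] would have fewer than
   [M * B]. *)
have [k [x [kV fibB]]] : exists k x, k \in V /\ (B <= #|fib k x|)%N.
  apply: contrapT => nex.
  have fB k x : k \in V -> (#|fib k x| <= B)%N.
    by move=> kV; rewrite leqNgt; apply/negP => /ltnW h; apply: nex; exists k, x.
  have cov : T :\: U \subset \bigcup_(k in V) \bigcup_(x : 'I_c) fib k x.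
    apply/subsetP => i; rewrite inE => /andP[iU iT].
    have [k kS kV] : exists2 k, k \in S i & k \in V.
      apply: contrapT => nk; have dV : [disjoint S i & V].
        rewrite disjoints_subset; apply/subsetP => k kS; rewrite inE.
        by apply/negP => kV; apply: nk; exists k.
      have disiU : dis (i |: U).
        rewrite /dis subUset sub1set iT UT /=; apply/forall_inP => j.
        have diU l : l \in U -> [disjoint S i & S l].
          by move=> lU; apply: disjointWr dV; exact: bigcup_sup.
        rewrite !inE => /orP[/eqP ->|jU]; apply/forall_inP => l.
          rewrite !inE => /orP[/eqP ->|lU]; first by rewrite eqxx.
          by apply/implyP => _; exact: diU.
        rewrite !inE => /orP[/eqP ->|lU].
          by apply/implyP => _; rewrite disjoint_sym diU.
        exact: (forall_inP (disU j jU) l lU).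
      by have := maxU _ disiU (subsetUr _ _) => UE; move: iU; rewrite -UE setU11.
    apply/bigcupP; exists k => //; apply/bigcupP; exists (col i k) => //.
    by rewrite inE iT kS eqxx.
  have : (#|T :\: U| <= N0 * q.+1 * c * B)%N.
    apply: leq_trans (subset_leq_card cov) _.
    apply: (@leq_trans (\sum_(k in V) (c * B))%N); last first.
      by rewrite sum_nat_const -mulnA leq_mul2r Vle orbT.
    elim/big_rec2: _ => [|k a A kV Aa]; first by rewrite cards0.
    rewrite (leq_trans (leq_card_setU _ _)) // leq_add //.
    apply: (@leq_trans (\sum_(x : 'I_c) B)%N); last by rewrite sum_nat_const card_ord.
    elim/big_rec2: _ => [|x a' A' _ Aa']; first by rewrite cards0.
    by rewrite (leq_trans (leq_card_setU _ _)) // leq_add ?fB.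
  have TU : (#|T| = #|U| + #|T :\: U|)%N by rewrite -(cardsID U T) (setIidPr UT).
  have NB : (N0 <= B)%N by rewrite leq_pmull // expn_gt0 (leq_ltn_trans _ Mq).
  have MB : (M * B <= #|T|)%N by rewrite mulnA -expnS.
  have : ((N0 * q.+1 * c).+1 * B <= M * B)%N by rewrite leq_mul2r Mq orbT.
  rewrite mulSn; move: MB NB UN; rewrite TU; move: (#|T :\: U|) (#|U|) => x y.
  by move: (N0 * q.+1 * c * B)%N (M * B)%N => z w; lia.
have [||//|J [T' [T'f NT Jq dT' cT']]] := IH (fun i => S i :\ k) (fib k x).
- by apply: leq_ltn_trans Mq; rewrite leq_mul2r leq_mul2l leqnSn !orbT.
- move=> i; rewrite inE => /and3P[iT kS _].
  by have := Sq i iT; rewrite (cardsD1 k) kS.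
exists (k |: J), T'; split => //.
- by apply: subset_trans T'f _; apply/subsetP => i; rewrite inE => /andP[].
- by rewrite (leq_trans (leq_card_setU _ _)) // cards1 add1n.
- by move=> i j iT jT ij; rewrite -!setDDl; exact: dT'.
- move=> i j l iT jT; rewrite !inE => /orP[/eqP ->|lJ]; last exact: cT'.
  have := subsetP T'f _ iT; have := subsetP T'f _ jT.
  by rewrite !inE => /and3P[_ _ /eqP ->] /and3P[_ _ /eqP ->].
Qed.

End Sunflower.

(** * Rademacher averages: contraction, tilted signs, Khinchine *)

Section Rademacher.
Context {R : realType}.
Implicit Types (I : finType) (e : seq R) (N : nat).

(** Seeding the big operator with a value of [f] keeps it a genuine maximum over a nonempty index
    type; the result does not depend on [i0]. *)
Definition mx I (i0 : I) (f : I -> R) : R := \big[Num.max/f i0]_i f i.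

Lemma le_mx I i0 (f : I -> R) i : f i <= mx i0 f.
Proof. exact: le_bigmax. Qed.

Lemma mx_leP I (i0 : I) (f : I -> R) c : mx i0 f <= c <-> forall i, f i <= c.
Proof.
split=> [h i|h]; first exact: le_trans (le_mx i0 f i) h.
by apply: bigmax_le => // i _.
Qed.

Lemma mx_attained I (i0 : I) (f : I -> R) : exists i, mx i0 f = f i.
Proof.
rewrite /mx; elim/big_ind: _ => [|x y [i ->] [j ->]|i _]; [by exists i0| |by exists i].
by rewrite /Num.max; case: ifP => _; [exists j|exists i].
Qed.

Lemma le_mx_mx I (i0 j0 : I) (f g : I -> R) : (forall i, f i <= g i) -> mx i0 f <= mx j0 g.
Proof. by move=> fg; apply/mx_leP => i; exact: le_trans (fg i) (le_mx _ _ _). Qed.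

(** The expectation of [F] at a list of [N] independent uniform signs. *)
Fixpoint ravg N (F : seq R -> R) : R :=
  if N is N'.+1 then
    (ravg N' (fun e => F (1 :: e)) + ravg N' (fun e => F (- 1 :: e))) / 2
  else F [::].

Fixpoint rdot e (x : nat -> R) : R :=
  if e is a :: e' then a * x 0%N + rdot e' (fun k => x k.+1) else 0.

Lemma eq_ravg N F G : (forall e, F e = G e) -> ravg N F = ravg N G.
Proof. by move=> FG; congr ravg; apply: funext. Qed.

Lemma le_ravg N F G : (forall e, size e = N -> F e <= G e) -> ravg N F <= ravg N G.
Proof.
elim: N F G => [|N IH] F G FG /=; first exact: FG.
by rewrite ler_pM2r ?invr_gt0 // lerD // IH // => e eN; apply: FG; rewrite /= eN.
Qed.

Lemma ravgD N F G : ravg N (fun e => F e + G e) = ravg N F + ravg N G.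
Proof. by elim: N F G => //= N IH F G; rewrite !IH; ring. Qed.

Lemma ravgZ N c F : ravg N (fun e => c * F e) = c * ravg N F.
Proof. by elim: N F => //= N IH F; rewrite !IH; ring. Qed.

Lemma ravg_cst N c : ravg N (fun=> c) = c.
Proof. by elim: N => //= N ->; field. Qed.

Lemma ravg_sum N I (F : I -> seq R -> R) :
  ravg N (fun e => \sum_i F i e) = \sum_i ravg N (F i).
Proof.
elim: N F => //= N IH F; rewrite (IH (fun i e => F i (1 :: e))) (IH (fun i e => F i (- 1 :: e))).
by rewrite -big_split mulr_suml.
Qed.

Lemma ravg_cat Q N F :
  ravg (Q + N) F = ravg Q (fun e1 => ravg N (fun e2 => F (e1 ++ e2))).
Proof. by elim: Q F => //= Q IH F; rewrite !IH. Qed.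

Lemma ravgC N Q (F : seq R -> seq R -> R) :
  ravg N (fun e1 => ravg Q (F e1)) = ravg Q (fun e2 => ravg N (fun e1 => F e1 e2)).
Proof.
elim: N F => //= N IH F; rewrite (IH (fun e => F (1 :: e))) (IH (fun e => F (- 1 :: e))).
by rewrite -ravgD mulrC -ravgZ; apply: eq_ravg => e; rewrite mulrC.
Qed.

Lemma ravg_opp N F : ravg N (fun e => F (map -%R e)) = ravg N F.
Proof.
elim: N F => //= N IH F; rewrite opprK (IH (fun e => F (- 1 :: e))) (IH (fun e => F (1 :: e))).
by rewrite addrC.
Qed.

Lemma rdot_opp e x : rdot (map -%R e) x = - rdot e x.
Proof. by elim: e x => [|a e IH] x /=; rewrite ?oppr0 // IH opprD mulNr. Qed.

Lemma rdot_cat e1 e2 x : rdot (e1 ++ e2) x = rdot e1 x + rdot e2 (fun k => x (size e1 + k)%N).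
Proof.
elim: e1 x => [|a e IH] x /=; first by rewrite add0r.
by rewrite IH addrA; congr (_ + rdot _ _).
Qed.

Lemma rdotB e x y : rdot e (fun k => x k - y k) = rdot e x - rdot e y.
Proof. by elim: e x y => [|a e IH] x y /=; rewrite ?subrr // (IH (x \o S) (y \o S)) /=; ring. Qed.

Lemma eq_rdot e x y : (forall k, x k = y k) -> rdot e x = rdot e y.
Proof. by move=> xy; congr rdot; apply: funext. Qed.

(** Let [i] and [j] attain the two maxima on the left. The bound [y i - y j <= |x i - x j|] is
    matched on the right by testing the two maxima at [(i, j)] or at [(j, i)], according to the sign
    of [x i - x j]. *)
Lemma mx_contraction1 I (i0 : I) (a x y : I -> R) :
  (forall i j, `|y i - y j| <= `|x i - x j|) ->
  mx i0 (fun i => a i + y i) + mx i0 (fun i => a i - y i) <=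
  mx i0 (fun i => a i + x i) + mx i0 (fun i => a i - x i).
Proof.
move=> yx; have [i ->] := mx_attained i0 (fun i => a i + y i).
have [j ->] := mx_attained i0 (fun i => a i - y i).
have h1 := le_mx i0 (fun i => a i + x i) i; have h2 := le_mx i0 (fun i => a i - x i) i.
have h3 := le_mx i0 (fun i => a i + x i) j; have h4 := le_mx i0 (fun i => a i - x i) j.
move: h1 h2 h3 h4; set A := mx _ _; set B := mx _ _ => /= h1 h2 h3 h4.
have := le_trans (ler_norm _) (yx i j).
by case: ger0P => _ h; lra.
Qed.

Fixpoint signs N (e : seq R) : Prop :=
  match N, e with
  | 0%N, [::] => True
  | N'.+1, a :: e' => `|a| = 1 /\ signs N' e'
  | _, _ => False
  end.

Lemma signs_size N e : signs N e -> size e = N.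
Proof. by elim: N e => [|N IH] [|a e] //= [_ /IH ->]. Qed.

Lemma le_ravg_signs N F G : (forall e, signs N e -> F e <= G e) -> ravg N F <= ravg N G.
Proof.
elim: N F G => [|N IH] F G FG /=; first exact: FG.
by rewrite ler_pM2r ?invr_gt0 // lerD // IH // => e eN; apply: FG; rewrite /= ?normrN normr1.
Qed.

Lemma norm_rdot_le N e x : signs N e -> `|rdot e x| <= \sum_(k < N) `|x k|.
Proof.
elim: N e x => [|N IH] [|a e] x //=; first by rewrite big_ord0 normr0.
move=> [a1 eN]; rewrite big_ord_recl (le_trans (ler_normD _ _)) // normrM a1 mul1r lerD //.
exact: IH.
Qed.

(** One sign dominates a whole block of signs: averaging over [e] and [- e], the block sum
    [rdot e (z i)] acts as a single coefficient, whose variation is at most that of [x] by the l1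
    hypothesis. *)
Lemma ravg_block_contraction I (i0 : I) Q (a x : I -> R) (z : I -> nat -> R) :
  (forall i j, \sum_(k < Q) `|z i k - z j k| <= `|x i - x j|) ->
  ravg Q (fun e => mx i0 (fun i => a i + rdot e (z i))) <=
  (mx i0 (fun i => a i + x i) + mx i0 (fun i => a i - x i)) / 2.
Proof.
move=> zx; set F := fun e => mx i0 _.
have -> : ravg Q F = ravg Q (fun e => 2^-1 * (F e + F (map -%R e))).
  by rewrite ravgZ ravgD ravg_opp; field.
rewrite -[X in _ <= X](ravg_cst Q); apply: le_ravg_signs => e eQ.
rewrite mulrC ler_pM2r ?invr_gt0 //.
have -> : F (map -%R e) = mx i0 (fun i => a i - rdot e (z i)).
  by rewrite /F; congr mx; apply: funext => i; rewrite rdot_opp.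
apply: mx_contraction1 => i j; rewrite -rdotB.
exact: le_trans (norm_rdot_le _ eQ) (zx i j).
Qed.

(** Lets each coordinate be replaced by [Q] smaller ones without increasing the process; large
    coordinates can thus be cut to the height that the tilting argument tolerates. Blocks already
    treated are carried in the shift [a]. *)
Lemma ravg_chop_contraction I (i0 : I) N Q (a : I -> R) (x z : I -> nat -> R) :
  (forall k i j, \sum_(l < Q) `|z i (k * Q + l)%N - z j (k * Q + l)%N| <= `|x i k - x j k|) ->
  ravg (N * Q) (fun e => mx i0 (fun i => a i + rdot e (z i))) <=
  ravg N (fun e => mx i0 (fun i => a i + rdot e (x i))).
Proof.
elim: N a x z => [|N IH] a x z zx //=.
rewrite mulSn ravg_cat.
apply: (@le_trans _ _ (ravg Q (fun e1 => ravg N (fun e2 =>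
    mx i0 (fun i => a i + rdot e1 (z i) + rdot e2 (fun k => x i k.+1)))))).
  apply: le_ravg => e1 e1Q.
  have := IH (fun i => a i + rdot e1 (z i)) (fun i k => x i k.+1) (fun i k => z i (Q + k)%N).
  move=> h; apply: le_trans (h _) => [|k i j].
    apply: le_ravg => e2 _; apply: le_mx_mx => i.
    by rewrite rdot_cat addrA e1Q.
  apply: le_trans (zx k.+1 i j); rewrite le_eqVlt; apply/orP; left; apply/eqP.
  by apply: eq_bigr => l _; rewrite addnA mulSn.
rewrite ravgC -ravgD mulrC -ravgZ; apply: le_ravg => e _.
rewrite mulrC.
have := @ravg_block_contraction I i0 Q (fun i => a i + rdot e (fun k => x i k.+1))
  (fun i => x i 0%N) z (zx 0%N).
have -> : (fun i => a i + rdot e (fun k => x i k.+1) + x i 0%N) =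
   (fun i => a i + rdot (1 :: e) (x i)) by apply: funext => i /=; ring.
have -> : (fun i => a i + rdot e (fun k => x i k.+1) - x i 0%N) =
   (fun i => a i + rdot (- 1 :: e) (x i)) by apply: funext => i /=; ring.
apply: le_trans; apply: le_ravg => e1 _; apply: le_mx_mx => i.
by rewrite addrAC.
Qed.

Lemma ravg_contraction I (i0 : I) N (a : I -> R) (x z : I -> nat -> R) :
  (forall k i j, `|z i k - z j k| <= `|x i k - x j k|) ->
  ravg N (fun e => mx i0 (fun i => a i + rdot e (z i))) <=
  ravg N (fun e => mx i0 (fun i => a i + rdot e (x i))).
Proof.
move=> zx; rewrite -[in X in X <= _](muln1 N); apply: ravg_chop_contraction => k i j.
by rewrite big_ord1 /= muln1 addn0.
Qed.

(** Density, with respect to uniform signs, of the law making the signs independent with means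
    [psi k]. *)
Fixpoint rdens e (psi : nat -> R) : R :=
  if e is a :: e' then (1 + a * psi 0%N) * rdens e' (fun k => psi k.+1) else 1.

Definition tavg N psi F := ravg N (fun e => F e * rdens e psi).

Lemma tavgS N psi F : tavg N.+1 psi F =
  (1 + psi 0%N) / 2 * tavg N (fun k => psi k.+1) (fun e => F (1 :: e)) +
  (1 - psi 0%N) / 2 * tavg N (fun k => psi k.+1) (fun e => F (- 1 :: e)).
Proof.
rewrite /tavg /= mulrDl -!ravgZ ![ravg _ _ / 2]mulrC -!ravgZ.
by congr (_ + _); apply: eq_ravg => e; ring.
Qed.

Lemma rdens_ge0 N e psi : signs N e -> (forall k, `|psi k| <= 2^-1) -> 0 <= rdens e psi.
Proof.
elim: N e psi => [|N IH] [|a e] psi //= [a1 eN] psi1.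
apply: mulr_ge0; last exact: IH eN (fun k => psi1 k.+1).
have : `|a * psi 0%N| <= 2^-1 by rewrite normrM a1 mul1r.
by rewrite ler_norml => /andP[]; lra.
Qed.

Lemma le_tavg N psi F G : (forall k, `|psi k| <= 2^-1) ->
  (forall e, signs N e -> F e <= G e) -> tavg N psi F <= tavg N psi G.
Proof.
move=> psi1 FG; apply: le_ravg_signs => e eN.
by rewrite ler_wpM2r ?FG ?(rdens_ge0 eN).
Qed.

Lemma tavgD N psi F G : tavg N psi (fun e => F e + G e) = tavg N psi F + tavg N psi G.
Proof. by rewrite -ravgD; apply: eq_ravg => e; rewrite mulrDl. Qed.

Lemma tavgZ N psi c F : tavg N psi (fun e => c * F e) = c * tavg N psi F.
Proof. by rewrite -ravgZ; apply: eq_ravg => e; rewrite mulrA. Qed.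

Lemma tavg_cst N psi c : tavg N psi (fun=> c) = c.
Proof.
elim: N psi => [|N IH] psi; first by rewrite /tavg /= mulr1.
by rewrite tavgS IH; field.
Qed.

Lemma tavg_dens N psi : tavg N psi (fun e => rdens e psi) = \prod_(k < N) (1 + psi k ^+ 2).
Proof.
elim: N psi => [|N IH] psi; first by rewrite /tavg /= big_ord0 mulr1.
rewrite tavgS /= !tavgZ IH big_ord_recl /=.
have -> : \prod_(i < N) (1 + psi (bump 0 i) ^+ 2) = \prod_(k < N) (1 + psi k.+1 ^+ 2) by [].
by field.
Qed.

(* Under the tilted law the signs are independent with means [psi k], so each
   centred sign lies in [-3/2, 3/2] and is dominated in convex order by twice a
   symmetric sign. *)
Lemma tavg_convex_order I (i0 : I) N (psi : nat -> R) (a : I -> R) (x : I -> nat -> R) :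
  (forall k, `|psi k| <= 2^-1) ->
  tavg N psi (fun e => mx i0 (fun i => a i + rdot e (x i) - \sum_(k < N) psi k * x i k)) <=
  ravg N (fun e => mx i0 (fun i => a i + 2 * rdot e (x i))).
Proof.
elim: N a x psi => [|N IH] a x psi psi1.
  rewrite /tavg /= mulr1; apply: le_mx_mx => i; rewrite big_ord0; lra.
have := psi1 0%N; rewrite ler_norml => /andP[p1 p2].
set b := psi 0%N in p1 p2 *.
rewrite tavgS -/b.
have step (s : R) : tavg N (fun k => psi k.+1) (fun e => mx i0 (fun i =>
      a i + rdot (s :: e) (x i) - \sum_(k < N.+1) psi k * x i k)) <=
    ravg N (fun e => mx i0 (fun i => a i + (s - b) * x i 0%N + 2 * rdot e (fun k => x i k.+1))).
  have := IH (fun i => a i + (s - b) * x i 0%N) (fun i k => x i k.+1) (fun k => psi k.+1).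
  move=> h; apply: le_trans (h _) => [|k]; last exact: psi1.
  apply: le_tavg => [k|e _]; first exact: psi1.
  apply: le_mx_mx => i; rewrite big_ord_recl /= -/b.
  have -> : \sum_(i1 < N) psi (bump 0 i1) * x i (bump 0 i1) =
     \sum_(k < N) psi k.+1 * x i k.+1 by [].
  lra.
have w1 : 0 <= (1 + b) / 2 by lra.
have w2 : 0 <= (1 - b) / 2 by lra.
apply: le_trans (lerD (ler_wpM2l w1 (step 1)) (ler_wpM2l w2 (step (- 1)))) _.
rewrite -!ravgZ -ravgD /= -ravgD [X in _ <= X]mulrC -[X in _ <= X]ravgZ; apply: le_ravg => e _.
set A := mx i0 (fun i => a i + 2 * rdot (1 :: e) (x i)).
set B := mx i0 (fun i => a i + 2 * rdot (- 1 :: e) (x i)).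
(* Chord bound for a convex function of [v] on [[-2, 2]]. The weights [(1 + b) / 2] and
   [(1 - b) / 2] average [1 - b] and [-1 - b] to 0, so [A] and [B] come out with weight [1 / 2]
   each. *)
have cvx (v : R) : -2 <= v <= 2 ->
    mx i0 (fun i => a i + v * x i 0%N + 2 * rdot e (fun k => x i k.+1)) <=
    (2 + v) / 4 * A + (2 - v) / 4 * B.
  move=> /andP[v1 v2]; apply/mx_leP => i.
  have hA := le_mx i0 (fun i => a i + 2 * rdot (1 :: e) (x i)) i.
  have hB := le_mx i0 (fun i => a i + 2 * rdot (- 1 :: e) (x i)) i.
  have u1 : 0 <= (2 + v) / 4 by lra.
  have u2 : 0 <= (2 - v) / 4 by lra.
  have := lerD (ler_wpM2l u1 hA) (ler_wpM2l u2 hB); apply: le_trans => /=.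
  by rewrite le_eqVlt; apply/orP; left; apply/eqP; field.
have c1 : -2 <= 1 - b <= 2 by apply/andP; split; lra.
have c2 : -2 <= -1 - b <= 2 by apply/andP; split; lra.
apply: le_trans (lerD (ler_wpM2l w1 (cvx _ c1)) (ler_wpM2l w2 (cvx _ c2))) _.
by rewrite le_eqVlt; apply/orP; left; apply/eqP; field.
Qed.

Lemma tavg_markov N psi (F : seq R -> R) c : (forall k, `|psi k| <= 2^-1) ->
  (forall e, signs N e -> 0 <= F e) -> 0 < c ->
  tavg N psi (fun e => ((c < F e)%R)%:R) <= tavg N psi F / c.
Proof.
move=> psi1 F0 c0; rewrite ler_pdivlMr // mulrC -tavgZ; apply: le_tavg => // e eN.
case: ltP => [/ltW cF|_]; first by rewrite mulr1.
by rewrite mulr0 F0.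
Qed.

Lemma ravg_sqr N (x : nat -> R) : ravg N (fun e => rdot e x ^+ 2) = \sum_(k < N) x k ^+ 2.
Proof.
elim: N x => [|N IH] x; first by rewrite /= big_ord0 expr0n.
rewrite /= -ravgD big_ord_recl /= -(IH (fun k => x k.+1)).
rewrite mulrC -ravgZ -[X in _ = X + _](ravg_cst N) -ravgD.
by apply: eq_ravg => e; field.
Qed.

Lemma ravg_pow4 N (x : nat -> R) : ravg N (fun e => rdot e x ^+ 4) <= 3 * (\sum_(k < N) x k ^+ 2) ^+ 2.
Proof.
elim: N x => [|N IH] x; first by rewrite /= big_ord0 !expr0n /= mulr0.
rewrite /= -ravgD big_ord_recl /= -(ravg_sqr N (fun k => x k.+1)).
have := IH (fun k => x k.+1); rewrite -(ravg_sqr N (fun k => x k.+1)).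
set A := ravg N _; set B := ravg N _ => h.
have -> : ravg N (fun e => (1 * x 0%N + rdot e (fun k => x k.+1)) ^+ 4 +
   (- 1 * x 0%N + rdot e (fun k => x k.+1)) ^+ 4) =
   2 * A + 12 * x 0%N ^+ 2 * B + 2 * x 0%N ^+ 4.
  rewrite /A /B -!ravgZ -!ravgD -[X in _ = _ + X](ravg_cst N) -ravgD.
  by apply: eq_ravg => e; ring.
have := sqr_ge0 (x 0%N); move: h; set b := x 0%N; clear.
by have := sqr_ge0 (b ^+ 2); nra.
Qed.

(* [|s| >= s^2/r - (4/27) s^4/r^3] holds for every [r > 0]; with
   [r = sigma * 2/sqrt 3] and the fourth moment this is Khinchine's inequality. *)
Lemma khinchine N (x : nat -> R) : \sum_(k < N) x k ^+ 2 <= 3 * ravg N (fun e => `|rdot e x|) ^+ 2.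
Proof.
set s2 := \sum_(k < N) x k ^+ 2; set E1 := ravg N _.
have s20 : 0 <= s2 by apply: sumr_ge0 => k _; exact: sqr_ge0.
have E10 : 0 <= E1 by rewrite -[X in X <= _](ravg_cst N 0); apply: le_ravg => e _.
have [->|s2N] := eqVneq s2 0; first by rewrite mulr_ge0 // sqr_ge0.
pose sg := Num.sqrt s2.
have sg0 : 0 < sg by rewrite sqrtr_gt0 lt_neqAle eq_sym s2N.
have sg2 : sg ^+ 2 = s2 by rewrite sqr_sqrtr.
have key : forall s r : R, 0 < r -> s ^+ 2 * r ^+ 2 - 4 / 27 * s ^+ 4 <= `|s| * r ^+ 3.
  move=> s r r0; have [t0 st] : 0 <= `|s| /\ s ^+ 2 = `|s| ^+ 2 by rewrite normr_ge0 real_normK ?num_real.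
  have -> : s ^+ 4 = (s ^+ 2) ^+ 2 by ring.
  rewrite st; move: t0; move: (`|s|) => t t0.
  (* The difference of the two sides factors, with a double root at [t = 3 / 2 * r]. *)
  suff : 0 <= t * ((r + t / 3) * (r - 2 / 3 * t) ^+ 2) by nra.
  by rewrite mulr_ge0 // mulr_ge0 ?sqr_ge0 //; lra.
pose w := Num.sqrt (4 / 3 : R).
have w0 : 0 < w by rewrite sqrtr_gt0; lra.
have w2 : w ^+ 2 = 4 / 3 by rewrite sqr_sqrtr //; lra.
pose r := w * sg.
have r0 : 0 < r by rewrite mulr_gt0.
have r2 : r ^+ 2 = 4 / 3 * s2 by rewrite exprMn w2 sg2.
have h1 : s2 * r ^+ 2 - 4 / 27 * ravg N (fun e => rdot e x ^+ 4) <= E1 * r ^+ 3.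
  have : ravg N (fun e => r ^+ 2 * rdot e x ^+ 2 + (- (4 / 27)) * rdot e x ^+ 4) <=
      ravg N (fun e => r ^+ 3 * `|rdot e x|).
    by apply: le_ravg => e _; have := key (rdot e x) r r0; lra.
  by rewrite ravgD !ravgZ ravg_sqr -/s2 -/E1; lra.
have h2 := ravg_pow4 N x; rewrite -/s2 in h2.
have h3 : 8 / 9 * s2 ^+ 2 <= E1 * r ^+ 3 by rewrite r2 in h1; nra.
have h4 : 8 / 9 * s2 ^+ 2 <= E1 * r * (4 / 3 * s2) by rewrite -r2 (_ : E1 * r * r ^+ 2 = E1 * r ^+ 3) //; ring.
have s2p : 0 < s2 by rewrite lt_neqAle eq_sym s2N.
have h5 : 2 / 3 * s2 <= E1 * r by rewrite -(ler_pM2r s2p); nra.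
have h6 : (2 / 3 * s2) ^+ 2 <= E1 ^+ 2 * (4 / 3 * s2).
  rewrite -r2 -exprMn; apply: lerXn2r => //; rewrite nnegrE; first lra.
  by apply: mulr_ge0 => //; exact: ltW.
by rewrite -(ler_pM2r s2p); nra.
Qed.

End Rademacher.

(** * Sudakov minoration for Rademacher processes with bounded coordinates *)

Section RademacherSudakov.
Context {R : realType}.

Lemma prod_1D_le_expR N (u : nat -> R) : (forall k, 0 <= u k) ->
  \prod_(k < N) (1 + u k) <= expR (\sum_(k < N) u k).
Proof.
move=> u0; elim: N => [|N IH]; first by rewrite !big_ord0 expR0.
rewrite !big_ord_recr /= expRD; apply: ler_pM => //.
- by apply: prodr_ge0 => k _; rewrite addr_ge0.
- by rewrite addr_ge0.
- exact: expR_ge1Dx.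
Qed.

(** The recentred maximum [G] is nonnegative because [i0] contributes 0, so the absolute value of
    one increment is at most [G e + G (- e)]. Its mean is at most [2 * m], and Khinchine's factor 3
    makes this [12 * m ^+ 2]. *)
Lemma sum_sqr_le_rademacher (I : finType) (i0 : I) N (m : R) (x : I -> nat -> R) t :
  0 < m -> ravg N (fun e => mx i0 (fun i => rdot e (x i) - rdot e (x i0))) <= m ->
  \sum_(k < N) (x t k - x i0 k) ^+ 2 <= 12 * m ^+ 2.
Proof.
move=> m0 Hm; apply: le_trans (khinchine N (fun k => x t k - x i0 k)) _.
suff : ravg N (fun e => `|rdot e (fun k => x t k - x i0 k)|) <= 2 * m.
  move=> le2; have r0 : 0 <= ravg N (fun e => `|rdot e (fun k => x t k - x i0 k)|).
    by rewrite -[X in X <= _](ravg_cst N 0); apply: le_ravg => e _.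
  by nra.
pose G e := mx i0 (fun i => rdot e (x i) - rdot e (x i0)).
apply: (@le_trans _ _ (ravg N (fun e => G e + G (map -%R e)))).
  apply: le_ravg => e _.
  have g0 e' : 0 <= G e'.
    by apply: le_trans (le_mx i0 _ i0); rewrite subrr.
  have g1 e' : rdot e' (fun k => x t k - x i0 k) <= G e'.
    by rewrite rdotB; exact: (le_mx i0 (fun i => rdot e' (x i) - rdot e' (x i0))).
  have := g1 e; have := g1 (map -%R e); rewrite rdot_opp.
  have := g0 e; have := g0 (map -%R e).
  move: (G e) (G _) (rdot e _) => u v w b1 b2 b3 b4.
  by case: ger0P => _; lra.
by rewrite ravgD ravg_opp; move: Hm; rewrite -/G; lra.
Qed.

(* Tilt the signs towards [psi t = (x t - x i0) / (2 a)].  Under the tilted law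
   the supremum recentred at [t] is at most [8 m] with probability [3/4]; the
   corresponding events are disjoint for separated points, and the density of
   the tilt, at most [4 expR (3 p^2)] off a set of tilted measure [1/4], bounds
   their uniform probability from below. *)
Lemma sudakov_rademacher (I : finType) (i0 : I) N (m a p : R) (x : I -> nat -> R) :
  0 < m -> 0 < p -> a = m / p ->
  (forall s, ravg N (fun e => mx i0 (fun i => rdot e (x i) - rdot e (x s))) <= m) ->
  (forall i j k, `|x i k - x j k| <= a) ->
  (forall i j, i != j -> 32 * m * a < \sum_(k < N) (x i k - x j k) ^+ 2) ->
  #|I|%:R <= 8 * expR (3 * p ^+ 2).
Proof.
move=> m0 p0 aE Hm Hx Hs.
have a0 : 0 < a by rewrite aE divr_gt0.
pose h i k := x i k - x i0 k.
pose psi t k := h t k / (2 * a).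
have psi1 t k : `|psi t k| <= 2^-1.
  rewrite normrM normfV (ger0_norm (_ : 0 <= 2 * a)); last by rewrite mulr_ge0 // ltW.
  by rewrite ler_pdivrMr ?mulr_gt0 // mulKf //; exact: Hx.
pose V t e := mx i0 (fun s => rdot e (fun k => h s k - h t k)
                      - \sum_(k < N) psi t k * (h s k - h t k)).
pose K := 4 * expR (3 * p ^+ 2).
have K0 : 0 < K by rewrite mulr_gt0 ?expR_gt0.
have V0 t e : 0 <= V t e.
  apply: le_trans (le_mx i0 _ t); rewrite le_eqVlt; apply/orP; left; apply/eqP.
  rewrite big1; last by move=> k _; rewrite subrr mulr0.
  by rewrite rdotB !subrr.
have EV t : tavg N (psi t) (V t) <= 2 * m.
  have := @tavg_convex_order R I i0 N (psi t) (fun=> 0) (fun s k => h s k - h t k) (psi1 t).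
  have -> : tavg N (psi t) (V t) = tavg N (psi t) (fun e => mx i0 (fun i =>
     0 + rdot e (fun k => h i k - h t k) - \sum_(k < N) psi t k * (h i k - h t k))).
    by congr tavg; apply: funext => e; congr mx; apply: funext => i; rewrite add0r.
  move=> /le_trans; apply; apply: le_trans (ler_wpM2l _ (Hm t)) => //.
  rewrite -ravgZ; apply: le_ravg => e _; apply/mx_leP => i; rewrite add0r ler_pM2l //.
  have -> : rdot e (fun k => h i k - h t k) = rdot e (x i) - rdot e (x t).
    by rewrite -rdotB; apply: eq_rdot => k; rewrite /h; ring.
  exact: (le_mx i0 (fun i => rdot e (x i) - rdot e (x t))).
have PV t : tavg N (psi t) (fun e => ((8 * m < V t e)%R)%:R) <= 1 / 4.
  have := @tavg_markov R N (psi t) (V t) (8 * m) (psi1 t) (fun e _ => V0 t e).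
  move=> /(_ _)/le_trans; apply; first by rewrite mulr_gt0.
  by rewrite ler_pdivrMr ?mulr_gt0 // (le_trans (EV t)) //; lra.
have hsum t : \sum_(k < N) h t k ^+ 2 <= 12 * m ^+ 2 by exact: sum_sqr_le_rademacher.
(* The exponent comes from [12 * m ^+ 2 / (4 * a ^+ 2)] with [a = m / p]. *)
have psisum t : \sum_(k < N) psi t k ^+ 2 <= 3 * p ^+ 2.
  have -> : \sum_(k < N) psi t k ^+ 2 = (\sum_(k < N) h t k ^+ 2) / (4 * a ^+ 2).
    by rewrite mulr_suml; apply: eq_bigr => k _; rewrite /psi; field; rewrite gt_eqF.
  rewrite ler_pdivrMr; last by rewrite mulr_gt0 // exprn_gt0.
  apply: le_trans (hsum t) _; rewrite aE le_eqVlt; apply/orP; left; apply/eqP.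
  by field; rewrite gt_eqF.
have PD t : tavg N (psi t) (fun e => ((K < rdens e (psi t))%R)%:R) <= 1 / 4.
  have := @tavg_markov R N (psi t) (fun e => rdens e (psi t)) K (psi1 t)
     (fun e eN => rdens_ge0 eN (psi1 t)) K0.
  move=> /le_trans; apply; rewrite tavg_dens ler_pdivrMr //.
  apply: le_trans (@prod_1D_le_expR N (fun k => psi t k ^+ 2) (fun k => sqr_ge0 _)) _.
  by rewrite (_ : 1 / 4 * K = expR (3 * p ^+ 2)) ?ler_expR // /K; field.
pose A t e := (V t e <= 8 * m) && (rdens e (psi t) <= K).
(* On [A t] the density is at most [K], so [K] times the uniform probability dominates the tilted
   one, which is at least [1 - 1 / 4 - 1 / 4]. *)
have PA t : 1 / 2 <= K * ravg N (fun e => (A t e)%:R).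
  rewrite -ravgZ.
  apply: (@le_trans _ _ (tavg N (psi t) (fun e => 1 + (- 1 * ((8 * m < V t e)%R)%:R +
     - 1 * ((K < rdens e (psi t))%R)%:R)))).
    by rewrite !tavgD !tavgZ tavg_cst; have := PV t; have := PD t; lra.
  apply: le_ravg_signs => e eN; have := rdens_ge0 eN (psi1 t).
  rewrite /A; case: (leP (V t e)) => _; case: (leP (rdens e _)) => h1 h2 /=;
    rewrite ?mulr1n ?mulr0n; move: (rdens e _) h1 h2 => D h1 h2; nra.
(* Test the bound for [t] at [s] and the bound for [s] at [t], and add: the random terms cancel and
   the two drifts leave the squared distance over [2 * a], at most [16 * m], against the
   separation. *)
have disA e t s : A t e -> A s e -> t = s.
  move=> /andP[At _] /andP[As _]; apply/eqP; apply: contraT => ts.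
  have := Hs _ _ ts; rewrite ltNge => /negP; case.
  have := le_trans (le_mx i0 _ s) At; have := le_trans (le_mx i0 _ t) As.
  move=> /= h1 h2; rewrite rdotB in h1; rewrite rdotB in h2.
  have := lerD h1 h2.
  have -> : rdot e (h t) - rdot e (h s) - \sum_(k < N) psi s k * (h t k - h s k) +
    (rdot e (h s) - rdot e (h t) - \sum_(k < N) psi t k * (h s k - h t k)) =
    (\sum_(k < N) (x t k - x s k) ^+ 2) / (2 * a).
    transitivity (- (\sum_(k < N) psi s k * (h t k - h s k) +
                     \sum_(k < N) psi t k * (h s k - h t k))); first by ring.
    rewrite -big_split -sumrN mulr_suml; apply: eq_bigr => k _ /=.
    by rewrite /psi /h; field; rewrite gt_eqF.
  by rewrite ler_pdivrMr ?mulr_gt0 //; lra.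
have sumA : \sum_t ravg N (fun e => (A t e)%:R) <= 1.
  rewrite -ravg_sum -[X in _ <= X](ravg_cst N); apply: le_ravg => e _.
  have [/existsP[t At]|/existsPn nA] := boolP [exists t, A t e].
    rewrite (bigD1 t) //= At big1 ?addr0 // => s st.
    by case: (boolP (A s e)) => // As; rewrite (disA e s t As At) eqxx in st.
  by rewrite big1 // => t _; rewrite (negbTE (nA t)).
have : \sum_(t : I) (1 / 2) <= K * 1 :> R.
  apply: le_trans (ler_wpM2l (ltW K0) sumA); rewrite mulr_sumr.
  by apply: ler_sum => t _; exact: PA.
by rewrite sumr_const -mulr_natr /K; lra.
Qed.

End RademacherSudakov.

(** * Real-valued probabilities and expectations *)

Section RealExpectation.
Context {R : realType} {d0 : measure_display} {Omega : measurableType d0}.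
Context (P : probability Omega R).
Implicit Types (A B : set Omega) (f g : Omega -> R).

Definition pr A : R := fine (P A).
Lemma measurable_set_le f g : measurable_fun setT f -> measurable_fun setT g ->
  measurable [set w | f w <= g w].
Proof.
move=> mf mg; have := measurable_fun_ler mf mg measurableT (Y := [set true]) I.
by rewrite setTI; congr measurable; apply/seteqP; split => w.
Qed.

Lemma measurable_set_lt f g : measurable_fun setT f -> measurable_fun setT g ->
  measurable [set w | f w < g w].
Proof.
move=> mf mg; have := measurable_fun_ltr mf mg measurableT (Y := [set true]) I.
by rewrite setTI; congr measurable; apply/seteqP; split => w.
Qed.

Definition Ex f : R := \int[P]_w f w.
Definition itg f : Prop := P.-integrable [set: Omega] (EFin \o f).

Lemma prE A : measurable A -> P A = (pr A)%:E.
Proof. by move=> mA; rewrite fineK // fin_num_measure. Qed.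

Lemma pr_ge0 A : 0 <= pr A.
Proof. exact: fine_ge0. Qed.

Lemma prT : pr setT = 1.
Proof. by rewrite /pr probability_setT. Qed.

Lemma pr0 : pr set0 = 0.
Proof. by rewrite /pr measure0. Qed.

Lemma le_pr A B : measurable A -> measurable B -> A `<=` B -> pr A <= pr B.
Proof. by move=> mA mB AB; rewrite -lee_fin -!prE // le_measure ?inE. Qed.

Lemma pr_le1 A : measurable A -> pr A <= 1.
Proof. by move=> mA; rewrite -lee_fin -prE // probability_le1. Qed.

Lemma itg_meas f : itg f -> measurable_fun setT f.
Proof. by move=> /measurable_int /measurable_EFinP. Qed.

Lemma itgD f g : itg f -> itg g -> itg (fun w => f w + g w).
Proof.
move=> fi gi; have := integrableD measurableT fi gi; exact: eq_integrable.
Qed.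

Lemma itgZ (c : R) f : itg f -> itg (fun w => c * f w).
Proof.
move=> fi; have := integrableZl measurableT c fi; exact: eq_integrable.
Qed.

Lemma itg_cst (c : R) : itg (fun=> c).
Proof. exact: finite_measure_integrable_cst. Qed.

Lemma itg_sum (I : Type) (s : seq I) (f : I -> Omega -> R) :
  (forall i, itg (f i)) -> itg (fun w => \sum_(i <- s) f i w).
Proof.
move=> fi; elim: s => [|i s IH].
  by have := itg_cst 0; apply: eq_integrable => // w _ /=; rewrite big_nil.
have := itgD (fi i) IH; apply: eq_integrable => // w _ /=; by rewrite big_cons.
Qed.

Lemma itg_indic A : measurable A -> itg (\1_A).
Proof. by move=> mA; apply: integrable_indic => //; rewrite ?fin_num_measure. Qed.

Lemma itg_le f g : measurable_fun setT f -> (forall w, `|f w| <= g w) -> itg g -> itg f.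
Proof.
move=> mf fg; apply: le_integrable => // [|w _ /=]; first exact/measurable_EFinP.
by rewrite lee_fin (le_trans (fg w)) // ler_norm.
Qed.

Lemma itg_norm f : itg f -> itg (fun w => `|f w|).
Proof. by move=> fi; apply: integrable_norm. Qed.

Lemma ExD f g : itg f -> itg g -> Ex (fun w => f w + g w) = Ex f + Ex g.
Proof. by move=> fi gi; rewrite /Ex RintegralD. Qed.

Lemma ExZ (c : R) f : itg f -> Ex (fun w => c * f w) = c * Ex f.
Proof. by move=> fi; rewrite /Ex RintegralZl. Qed.

Lemma Ex_cst (c : R) : Ex (fun=> c) = c.
Proof. by rewrite /Ex Rintegral_cst // -/(pr setT) prT mulr1. Qed.

Lemma le_Ex f g : itg f -> itg g -> (forall w, f w <= g w) -> Ex f <= Ex g.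
Proof. by move=> fi gi fg; apply: le_Rintegral. Qed.

Lemma Ex_ge0 f : (forall w, 0 <= f w) -> 0 <= Ex f.
Proof. by move=> f0; apply: Rintegral_ge0 => w _. Qed.

Lemma eq_Ex f g : (forall w, f w = g w) -> Ex f = Ex g.
Proof. by move=> fg; congr Ex; apply: funext. Qed.

Lemma Ex_sum (I : Type) (s : seq I) (f : I -> Omega -> R) :
  (forall i, itg (f i)) -> Ex (fun w => \sum_(i <- s) f i w) = \sum_(i <- s) Ex (f i).
Proof.
move=> fi; elim: s => [|i s IH].
  by rewrite big_nil -[RHS](Ex_cst 0); apply: eq_Ex => w; rewrite big_nil.
rewrite big_cons -IH -ExD //; last exact: itg_sum.
by apply: eq_Ex => w; rewrite big_cons.
Qed.

Lemma Ex_indic A : measurable A -> Ex (\1_A) = pr A.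
Proof. by move=> mA; rewrite /Ex /Rintegral integral_indic // setIT. Qed.

Lemma indic_boolE (Q : Omega -> bool) (w : Omega) : \1_[set w | Q w] w = (Q w)%:R :> R.
Proof.
rewrite indicE; case: (boolP (Q w)) => Qw; first by rewrite mem_set.
by rewrite memNset //; exact/negP.
Qed.

Lemma indic_ge0 A w : 0 <= \1_A w :> R. Proof. by rewrite indicE. Qed.

Lemma indic_in A w : A w -> \1_A w = 1 :> R.
Proof. by move=> Aw; rewrite indicE mem_set. Qed.

Lemma indic_out A w : ~ A w -> \1_A w = 0 :> R.
Proof. by move=> Aw; rewrite indicE memNset. Qed.

Lemma prC A : measurable A -> pr (~` A) = 1 - pr A.
Proof. by move=> mA; apply: EFin_inj; rewrite -prE ?EFinB -?prE ?probability_setC //; exact: measurableC. Qed.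

Lemma pr_setU_le A B : measurable A -> measurable B -> pr (A `|` B) <= pr A + pr B.
Proof.
move=> mA mB; rewrite -!Ex_indic //; last exact: measurableU.
rewrite -ExD; [|exact: itg_indic..].
apply: le_Ex => [|| w].
- by apply: itg_indic; exact: measurableU.
- by apply: itgD; exact: itg_indic.
- have a0 := indic_ge0 A w; have b0 := indic_ge0 B w.
  have [[Aw|Bw]|nAB] := pselect ((A `|` B) w).
  + by rewrite (indic_in Aw) indic_in ?lerDl //; left.
  + by rewrite (indic_in Bw) indic_in ?lerDr //; right.
  + by rewrite indic_out // addr_ge0.
Qed.

Lemma pr_exists_le (I : finType) (A : I -> set Omega) : (forall i, measurable (A i)) ->
  pr [set w | exists i, A i w] <= \sum_i pr (A i).
Proof.
move=> mA; have mU : measurable [set w | exists i, A i w].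
  have -> : [set w | exists i, A i w] = \bigcup_(i in [set: I]) A i.
    by apply/seteqP; split => [w [i Aw]|w [i _ Aw]]; exists i.
  exact: fin_bigcup_measurable.
rewrite -Ex_indic // (eq_bigr (fun i => Ex (\1_(A i)))); last by move=> i _; rewrite Ex_indic.
rewrite -Ex_sum => [|i]; last exact: itg_indic.
apply: le_Ex => [||w]; [exact: itg_indic|by apply: itg_sum => i; exact: itg_indic|].
have [[i Aw]|nA] := pselect (exists i, A i w).
  rewrite indic_in; last by exists i.
  by rewrite (bigD1 i) //= (indic_in Aw) lerDl; apply: sumr_ge0 => j _; exact: indic_ge0.
by rewrite indic_out //; apply: sumr_ge0 => j _; exact: indic_ge0.
Qed.

Lemma pr_disjoint_sum_le (I : finType) (A : I -> set Omega) (B : set Omega) :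
  (forall i, measurable (A i)) -> measurable B -> (forall i, A i `<=` B) ->
  (forall i j w, A i w -> A j w -> i = j) -> \sum_i pr (A i) <= pr B.
Proof.
move=> mA mB AB dA; rewrite (eq_bigr (fun i => Ex (\1_(A i)))); last by move=> i _; rewrite Ex_indic.
rewrite -Ex_sum => [|i]; last exact: itg_indic.
rewrite -Ex_indic //; apply: le_Ex => [||w].
- by apply: itg_sum => i; exact: itg_indic.
- exact: itg_indic.
- have [[i Aw]|nA] := pselect (exists i, A i w).
    rewrite (indic_in (AB _ _ Aw)) (bigD1 i) //= (indic_in Aw) big1 ?addr0 // => j ji.
    by apply: indic_out => Ajw; move: ji; rewrite (dA _ _ _ Aw Ajw) eqxx.
  rewrite big1 ?indic_ge0 // => i _; apply: indic_out => Aw; apply: nA; by exists i.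
Qed.

Lemma markov_pr f (c : R) : itg f -> (forall w, 0 <= f w) -> 0 < c ->
  pr [set w | c <= f w] <= Ex f / c.
Proof.
move=> fi f0 c0; have mA : measurable [set w | c <= f w].
  by apply: measurable_set_le => //; exact: itg_meas.
rewrite ler_pdivlMr // mulrC -Ex_indic // -ExZ; last exact: itg_indic.
apply: le_Ex => // [|w]; first by apply: itgZ; exact: itg_indic.
have [h|h] := lerP c (f w); first by rewrite indic_in // mulr1.
by rewrite indic_out ?mulr0 //=; apply/negP; rewrite -ltNge.
Qed.

(** Continuity from above along sets with empty intersection. Every later truncation to a bounded
    region uses this. *)
Lemma pr_norm_gt_small f (eps : R) : measurable_fun setT f -> 0 < eps ->
  exists n : nat, pr [set w | n%:R < `|f w|] <= eps.
Proof.
move=> mf e0; pose F n := [set w | (n%:R : R) < `|f w|].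
have mF n : measurable (F n).
  apply: measurable_set_lt => //; exact: measurableT_comp.
have F0 : \bigcap_n F n = set0.
  apply/seteqP; split => // w Fw; have := Fw (Num.bound `|f w|) I.
  by rewrite /F /= ltNge => /negP; apply; apply: ltW; apply: archi_boundP.
have : P \o F @ \oo --> P (\bigcap_n F n).
  apply: nonincreasing_cvg_mu => //.
  - by rewrite (le_lt_trans (probability_le1 _ _)) ?ltry.
  - by rewrite F0; exact: measurable0.
  - move=> m n mn; apply/subsetPset => w; rewrite /F /=; apply: le_lt_trans.
    by rewrite ler_nat.
rewrite F0 measure0 => /fine_cvgP[_ /cvgrPdist_le /(_ _ e0)[n _ /(_ n (leqnn n))]].
rewrite /= sub0r normrN => h; exists n; exact: le_trans (ler_norm _) h.
Qed.

End RealExpectation.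

(** * Symmetry and log-concavity for polyhedral events *)

Section Polyhedra.
Context {R : realType} {d0 : measure_display} {Omega : measurableType d0}.
Context (P : probability Omega R) (d : nat) (X : 'I_d -> {RV P >-> R}).
Implicit Types (J : finType).

Lemma measurable_forall J (A : J -> set Omega) : (forall j, measurable (A j)) ->
  measurable [set w | forall j, A j w].
Proof.
move=> mA; have -> : [set w | forall j, A j w] = \bigcap_(j in [set: J]) A j.
  by apply/seteqP; split => [w Aw j _|w Aw j]; exact: Aw.
exact: fin_bigcap_measurable.
Qed.

Lemma rvecE w i : rvec X w 0 i = X i w.
Proof. by rewrite mxE. Qed.

Lemma dotv_rvecE (t : 'rV[R]_d) w : dotv t (rvec X w) = \sum_i t 0 i * X i w.
Proof. by apply: eq_bigr => i _; rewrite mxE. Qed.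

Lemma measurable_dotv (t : 'rV[R]_d) : measurable_fun setT (fun w => dotv t (rvec X w)).
Proof.
under eq_fun do rewrite dotv_rvecE.
apply: measurable_sum => i; apply: measurable_funM => //.
Qed.

Lemma dotvDl (s t x : 'rV[R]_d) : dotv (s + t) x = dotv s x + dotv t x.
Proof. by rewrite -big_split; apply: eq_bigr => i _; rewrite !mxE mulrDl. Qed.

Lemma dotvZl (c : R) (t x : 'rV[R]_d) : dotv (c *: t) x = c * dotv t x.
Proof. by rewrite mulr_sumr; apply: eq_bigr => i _; rewrite !mxE mulrA. Qed.

Lemma dotvNl (t x : 'rV[R]_d) : dotv (- t) x = - dotv t x.
Proof. by rewrite -scaleN1r dotvZl mulN1r. Qed.

Lemma dotvBl (s t x : 'rV[R]_d) : dotv (s - t) x = dotv s x - dotv t x.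
Proof. by rewrite dotvDl dotvNl. Qed.

Lemma dotvDr (t x y : 'rV[R]_d) : dotv t (x + y) = dotv t x + dotv t y.
Proof. by rewrite -big_split; apply: eq_bigr => i _; rewrite !mxE mulrDr. Qed.

Lemma dotvZr (c : R) (t x : 'rV[R]_d) : dotv t (c *: x) = c * dotv t x.
Proof. by rewrite mulr_sumr; apply: eq_bigr => i _; rewrite !mxE mulrCA. Qed.

Lemma dotv_continuous (t : 'rV[R]_d) : continuous (fun x : 'rV[R]_d => dotv t x).
Proof.
rewrite /dotv; elim: (index_enum _) => [|i s IH] x.
  by under eq_fun do [rewrite big_nil]; exact: cst_continuous.
under eq_fun do rewrite big_cons.
have h1 : {for x, continuous (fun y : 'rV[R]_d => t 0 i * y 0 i)}.
  by apply: (@continuousM _ _ (cst (t 0 i)) (fun y : 'rV[R]_d => y 0 i));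
    [exact: cst_continuous|exact: coord_continuous].
exact: (continuousD h1 (IH x)).
Qed.

(** Only the coordinates of [X] are known to be measurable; an open set is the union of the
    countably many cubes inside it with rational centre and radius [1 / n.+1]. *)
Lemma open_preimage_measurable (U : set 'rV[R]_d) : open U -> measurable (rvec X @^-1` U).
Proof.
move=> oU.
pose bx (q : 'rV[rat]_d * nat) := [set x : 'rV[R]_d | forall i, `|ratr (q.1 0 i) - x 0 i| < q.2.+1%:R^-1].
have -> : rvec X @^-1` U = \bigcup_(q : 'rV[rat]_d * nat)
    [set w | bx q `<=` U /\ bx q (rvec X w)].
  apply/seteqP; split => [w Uw|w [q _ [+ h]]]; last by apply.
  have /nbhs_ballP[e /= e0 eU] : nbhs (rvec X w) U by exact: open_nbhs_nbhs.
  pose n := Num.bound (2 / e).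
  have ne : n.+1%:R^-1 < e / 2.
    rewrite invf_plt ?posrE ?divr_gt0 // invf_div.
    have := archi_boundP (_ : 0 <= 2 / e); rewrite divr_ge0 // ?ltW // => /(_ isT) h.
    by rewrite (lt_le_trans h) // ler_nat.
  have hq i : {q : rat | `|ratr q - X i w| < n.+1%:R^-1}.
    apply: cid; have lt : X i w < X i w + n.+1%:R^-1 by rewrite ltrDl.
    have [q] := rat_in_itvoo lt.
    rewrite in_itv /= => /andP[q1 q2]; exists q.
    by rewrite ger0_norm ?subr_ge0 ?ltW // ltrBlDl.
  exists (\row_i sval (hq i), n) => //.
  have bq i : `|ratr (sval (hq i)) - X i w| < n.+1%:R^-1 := svalP (hq i).
  split => /=; last by move=> i; rewrite !mxE; exact: bq.
  move=> x bxx; apply: eU; split => // a i; rewrite (ord1 a).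
  have := bxx i; rewrite /= !mxE => b1; have b2 := bq i; rewrite distrC in b2.
  rewrite -ball_normE /=; apply: le_lt_trans (ler_distD (ratr (sval (hq i))) _ _) _.
  by apply: lt_le_trans (ltrD (lt_trans b2 ne) (lt_trans b1 ne)) _; rewrite -splitr.
apply: countable_bigcupT_measurable => [|q]; first exact: countableP.
have [h|h] := pselect (bx q `<=` U); last first.
  by rewrite (_ : [set w | _] = set0) //; apply/seteqP; split => // w [].
have -> : [set w | bx q `<=` U /\ bx q (rvec X w)] =
   [set w | forall i, [set w | `|ratr (q.1 0 i) - X i w| < q.2.+1%:R^-1] w].
  apply/seteqP; split => [w [_ b] i|w b]; first by have := b i; rewrite /= mxE.
  by split => // i; rewrite mxE; exact: b.
apply: measurable_forall => i; apply: measurable_set_lt => //.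
have mf : measurable_fun setT (fun w => ratr (q.1 0 i) - X i w) by exact: measurable_funB.
exact: measurableT_comp.
Qed.

Lemma closed_preimage_measurable (C : set 'rV[R]_d) : closed C -> measurable (rvec X @^-1` C).
Proof.
move=> cC; have := measurableC (open_preimage_measurable (closed_openC cC)).
by rewrite preimage_setC setCK.
Qed.

(** The class of events on which both hypotheses act simply: a flip of [X] moves to the normals [W],
    and a Minkowski combination of two polyhedra with equal normals lies in the polyhedron with
    combined levels. *)
Definition poly J (W : J -> 'rV[R]_d) (l : J -> R) : set Omega :=
  [set w | forall j, l j <= dotv (W j) (rvec X w)].

Definition polyV J (W : J -> 'rV[R]_d) (l : J -> R) : set 'rV[R]_d :=
  [set x | forall j, l j <= dotv (W j) x].

Lemma measurable_poly J (W : J -> 'rV[R]_d) l : measurable (poly W l).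
Proof.
by apply: measurable_forall => j; apply: measurable_set_le => //; exact: measurable_dotv.
Qed.

Lemma closed_polyV J (W : J -> 'rV[R]_d) l : closed (polyV W l).
Proof.
have -> : polyV W l = \bigcap_(j in [set: J]) ((fun x => dotv (W j) x) @^-1` [set y | l j <= y]).
  by apply/seteqP; split => [x h j _|x h j]; exact: h.
apply: closed_bigI => j _; apply: closed_comp; last exact: closed_ge.
by move=> x _; exact: dotv_continuous.
Qed.

Definition flip (eta : 'I_d -> R) (t : 'rV[R]_d) : 'rV[R]_d := \row_i (eta i * t 0 i).

Lemma dotv_flip eta t x : dotv (flip eta t) x = dotv t (flip eta x).
Proof. by apply: eq_bigr => i _; rewrite !mxE mulrCA mulrA. Qed.

Lemma poly_flip J (W : J -> 'rV[R]_d) l (eta : 'I_d -> R) : unconditional_vec X ->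
  (forall i, eta i = 1 \/ eta i = -1) ->
  pr P (poly (fun j => flip eta (W j)) l) = pr P (poly W l).
Proof.
move=> HU He; rewrite /pr.
have := HU eta He (polyV W l); move=> /(_ _)/(congr1 fine).
have -> : rvec X @^-1` polyV W l = poly W l by [].
move=> ->.
  congr (fine (P _)); apply/seteqP; split => w h j; have := h j; rewrite /= dotv_flip;
  by congr (_ <= dotv _ _); apply/rowP => i; rewrite !mxE.
rewrite -[polyV W l]setCK; apply: sigma_algebraC; apply: sub_sigma_algebra.
by apply: closed_openC; exact: closed_polyV.
Qed.

Lemma compact_mink (K L : set 'rV[R]_d) (s : R) : compact K -> compact L -> compact (mink s K L).
Proof.
move=> cK cL.
have -> : mink s K L = (fun z : 'rV[R]_d * 'rV[R]_d => s *: z.1 + (1 - s) *: z.2) @` (K `*` L).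
  apply/seteqP; split => [x [k Kk [m Lm <-]]|x [[k m] /= [Kk Lm] <-]].
    by exists (k, m).
  by exists k => //; exists m.
apply: continuous_compact; last exact: compact_setX.
apply: continuous_subspaceT => z.
by apply: cvgD; apply: cvgZr; [exact: cvg_fst|exact: cvg_snd].
Qed.

Lemma compact_polyV_cube J (W : J -> 'rV[R]_d) l (n : nat) :
  compact (polyV W l `&` [set x | forall i, `|x 0 i| <= n%:R]).
Proof.
rewrite setIC; apply: compact_closedI; last exact: closed_polyV.
have := @rV_compact R d (fun=> `[- n%:R, n%:R]%classic) (fun=> @segment_compact _ _ _).
congr compact; apply/seteqP; split => x h i; have := h i; rewrite /= in_itv /= ler_norml //.
Qed.

(** The hypothesis speaks of nonempty compact sets. Each polyhedron is cut by a large cube that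
    keeps the share [th] of its probability; the common factor [th] comes out of the geometric mean
    because the exponents add to 1, and it can be taken as near 1 as desired. *)
Lemma pr_poly_log_concave J (W : J -> 'rV[R]_d) l l' (s : R) : log_concave_vec X ->
  0 < s < 1 ->
  (pr P (poly W l)) `^ s * (pr P (poly W l')) `^ (1 - s) <=
  pr P (poly W (fun j => s * l j + (1 - s) * l' j)).
Proof.
move=> HL /andP[s0 s1]; set a := pr P (poly W l); set b := pr P (poly W l').
have s1' : 0 < 1 - s by rewrite subr_gt0.
have a0 : 0 <= a by exact: pr_ge0.
have b0 : 0 <= b by exact: pr_ge0.
have [->|aN] := eqVneq a 0; first by rewrite powR0 ?gt_eqF // mul0r pr_ge0.
have [->|bN] := eqVneq b 0; first by rewrite powR0 ?gt_eqF // mulr0 pr_ge0.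
have {aN}a0 : 0 < a by rewrite lt_neqAle eq_sym aN.
have {bN}b0 : 0 < b by rewrite lt_neqAle eq_sym bN.
set c := pr P _; set M := a `^ s * b `^ (1 - s).
have M0 : 0 < M by rewrite mulr_gt0 // powR_gt0.
apply/ler_addgt0Pr => e e0.
pose th := Num.max (1 / 2) (1 - e / M) : R.
have th1 : th < 1 by rewrite gt_max; apply/andP; split; [lra|rewrite ltrBlDr ltrDl divr_gt0].
have th0 : 0 < th by rewrite lt_max; apply/orP; left; lra.
suff h : th * M <= c.
  rewrite -lerBlDr; apply: le_trans h.
  have -> : M - e = (1 - e / M) * M by field; rewrite gt_eqF.
  by rewrite ler_pM2r // le_max lexx orbT.
pose N w := \sum_i `|X i w|.
have mN : measurable_fun setT N.
  by apply: measurable_sum => i; apply: measurableT_comp.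
have N0 w : 0 <= N w by apply: sumr_ge0.
(* A loss of [(1 - th) * min a b] is at most the fraction [1 - th] of either polyhedron. *)
pose ep := (1 - th) * Num.min a b.
have ep0 : 0 < ep by rewrite mulr_gt0 ?subr_gt0 // lt_min a0.
have [n hn] := pr_norm_gt_small P mN ep0.
pose cube := [set x : 'rV[R]_d | forall i, `|x 0 i| <= n%:R].
have low (l0 : J -> R) : Num.min a b <= pr P (poly W l0) ->
    th * pr P (poly W l0) <= fine (lawX X (polyV W l0 `&` cube)).
  move=> ab; rewrite -[fine _]/(pr P (rvec X @^-1` (polyV W l0 `&` cube))).
  have mc : measurable (rvec X @^-1` (polyV W l0 `&` cube)).
    apply: closed_preimage_measurable; apply: compact_closed; last exact: compact_polyV_cube.
    exact: norm_hausdorff.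
  have mg : measurable [set w | n%:R < `|N w|].
    by apply: measurable_set_lt => //; apply: measurableT_comp.
  have : pr P (poly W l0) <= pr P (rvec X @^-1` (polyV W l0 `&` cube) `|` [set w | n%:R < `|N w|]).
    apply: le_pr; [exact: measurable_poly|exact: measurableU|].
    move=> w pw; have [h|h] := ltP n%:R (`|N w|); [by right|left; split => // i].
    rewrite rvecE; apply: le_trans h; rewrite [`|N w|]ger0_norm // /N (bigD1 i) //= lerDl.
    exact: sumr_ge0.
  move=> /le_trans /(_ (pr_setU_le P mc mg)) h.
  have h2 : (1 - th) * Num.min a b <= (1 - th) * pr P (poly W l0).
    by rewrite ler_pM2l // subr_gt0.
  by move: hn; rewrite /ep; lra.
have la : th * a <= _ := low l ltac:(by rewrite ge_min lexx).
have lb : th * b <= _ := low l' ltac:(by rewrite ge_min lexx orbT).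
have h k1 k2 k3 := HL (polyV W l `&` cube) (polyV W l' `&` cube) s
  (@compact_polyV_cube J W l n) k1 (@compact_polyV_cube J W l' n) k2 k3.
apply: (@le_trans _ _ ((fine (lawX X (polyV W l `&` cube))) `^ s *
   (fine (lawX X (polyV W l' `&` cube))) `^ (1 - s))).
  rewrite {1}/M; have -> : th * (a `^ s * b `^ (1 - s)) = (th * a) `^ s * (th * b) `^ (1 - s).
    rewrite !powRM ?(ltW th0) ?(ltW a0) ?(ltW b0) //.
    have -> : th `^ s * a `^ s * (th `^ (1 - s) * b `^ (1 - s)) =
       th `^ s * th `^ (1 - s) * (a `^ s * b `^ (1 - s)) by ring.
    rewrite -powRD; last by rewrite (gt_eqF th0) implybT.
    by rewrite (_ : s + (1 - s) = 1); [rewrite powRr1 // ltW|ring].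
  apply: ler_pM; rewrite ?powR_ge0 //; apply: ge0_ler_powR; rewrite ?nnegrE ?(ltW s0) ?(ltW s1') //.
  - by rewrite mulr_ge0 ?ltW.
  - exact: pr_ge0.
  - by rewrite mulr_ge0 ?ltW.
  - exact: pr_ge0.
have ne (l0 : J -> R) : 0 < pr P (poly W l0) ->
   th * pr P (poly W l0) <= fine (lawX X (polyV W l0 `&` cube)) -> polyV W l0 `&` cube !=set0.
  move=> p0 pl; apply/set0P/eqP => E; move: pl; rewrite E /lawX preimage_set0 measure0 /=.
  by rewrite leNgt mulr_gt0.
apply: (le_trans (h (ne _ a0 la) (ne _ b0 lb) _)); first by rewrite !ltW.
rewrite -[fine _]/(pr P (rvec X @^-1` _)); apply: le_pr.
- apply: closed_preimage_measurable; apply: compact_closed; first exact: norm_hausdorff.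
  by apply: compact_mink; exact: compact_polyV_cube.
- exact: measurable_poly.
- move=> w [k [pk _] [m [pm _] wE]] j; rewrite -wE dotvDr !dotvZr.
  by apply: lerD; rewrite ler_pM2l.
Qed.

End Polyhedra.

(** * One-dimensional tails and moments *)

Section Tails.
Context {R : realType} {d0 : measure_display} {Omega : measurableType d0}.
Context (P : probability Omega R) (d : nat) (X : 'I_d -> {RV P >-> R}).
Hypothesis HU : unconditional_vec X.
Hypothesis HL : log_concave_vec X.
Implicit Types (J : finType).

(** Weight [1 / k.+1] and a power [k.+1] remove the real exponents from the log-concavity
    inequality. *)
Lemma pr_poly_root J (W : J -> 'rV[R]_d) l l' (k : nat) :
  pr P (poly X W l) * pr P (poly X W l') ^+ k <=
  pr P (poly X W (fun j => (l j + k%:R * l' j) / k.+1%:R)) ^+ k.+1.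
Proof.
case: k => [|k].
  by rewrite expr0 mulr1 expr1; under eq_fun do rewrite mul0r addr0 divr1.
have k0 : (0 : R) < k.+2%:R by rewrite ltr0n.
have kE : k.+1%:R = k.+2%:R - 1 :> R by rewrite [X in _ = X - _]mulrS addrAC subrr add0r.
have s01 : 0 < (k.+2%:R : R)^-1 < 1 by rewrite invr_gt0 k0 invf_lt1 // ltr1n.
have := pr_poly_log_concave W l l' HL s01.
have -> : (fun j => k.+2%:R^-1 * l j + (1 - k.+2%:R^-1) * l' j) =
          (fun j => (l j + k.+1%:R * l' j) / k.+2%:R).
  apply: funext => j; rewrite kE; move: (k.+2%:R) k0 => y y0.
  by field; rewrite gt_eqF.
set a := pr P _; set b := pr P _; set c := pr P _ => h.
have a0 : 0 <= a by exact: pr_ge0.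
have b0 : 0 <= b by exact: pr_ge0.
have := @lerXn2r _ k.+2 _ _ _ _ h; rewrite !nnegrE => /(_ _ _); rewrite pr_ge0 => /(_ _ isT).
rewrite mulr_ge0 ?powR_ge0 // => /(_ isT); apply: le_trans.
rewrite exprMn -!powR_mulrn ?powR_ge0 // -!powRrM mulVf ?gt_eqF // powRr1 // mulrBl mul1r mulVf ?gt_eqF //.
by rewrite -kE powR_mulrn.
Qed.

Lemma pr_poly_mid J (W : J -> 'rV[R]_d) l l' :
  pr P (poly X W l) * pr P (poly X W l') <= pr P (poly X W (fun j => (l j + l' j) / 2)) ^+ 2.
Proof. by have := pr_poly_root W l l' 1; rewrite expr1; under eq_fun do rewrite mul1r. Qed.

Lemma pr_poly_convex J (W : J -> 'rV[R]_d) l l' (s : R) : 0 <= s <= 1 ->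
  pr P (poly X W l) = pr P (poly X W l') ->
  pr P (poly X W l) <= pr P (poly X W (fun j => s * l j + (1 - s) * l' j)).
Proof.
move=> /andP[s0 s1] E; have [->|sN0] := eqVneq s 0.
  by rewrite E; under [in leRHS]eq_fun do rewrite mul0r add0r subr0 mul1r.
have [->|sN1] := eqVneq s 1.
  by under [in leRHS]eq_fun do rewrite mul1r subrr mul0r addr0.
have s01 : 0 < s < 1 by rewrite !lt_neqAle eq_sym sN0 s0 sN1 s1.
have := pr_poly_log_concave W l l' HL s01; rewrite -E -powRD.
  by rewrite (_ : s + (1 - s) = 1) ?powRr1 ?pr_ge0 //; ring.
by rewrite (_ : s + (1 - s) = 1) ?oner_eq0 //; ring.
Qed.

Definition half (v : 'rV[R]_d) (u : R) := [set w | u <= dotv v (rvec X w)].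
Definition tail (v : 'rV[R]_d) (u : R) := [set w | u <= `|dotv v (rvec X w)|].

Lemma half_poly v u : half v u = poly X (fun _ : unit => v) (fun=> u).
Proof. by apply/seteqP; split => [w h _|w h]; [exact: h|exact: (h tt)]. Qed.

Lemma measurable_half v u : measurable (half v u).
Proof. by rewrite half_poly; exact: measurable_poly. Qed.

Lemma measurable_tail v u : measurable (tail v u).
Proof.
by apply: measurable_set_le => //; apply: measurableT_comp => //; exact: measurable_dotv.
Qed.

Lemma pr_half_opp v u : pr P (half (- v) u) = pr P (half v u).
Proof.
rewrite !half_poly; have -> : (fun _ : unit => - v) = fun j : unit => flip (fun=> -1) v.
  by apply: funext => _; apply/rowP => i; rewrite !mxE mulN1r.
by rewrite (poly_flip _ _ HU) // => i; right.
Qed.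

Lemma tail_half v u : tail v u = half v u `|` half (- v) u.
Proof.
apply/seteqP; split => [w|w]; rewrite /tail /half /= dotvNl.
  by case: ger0P => _ h; [left|right].
by case=> h; rewrite (le_trans h) // ?ler_norm // -normrN ler_norm.
Qed.

Lemma pr_tail_le v u : pr P (tail v u) <= 2 * pr P (half v u).
Proof.
rewrite tail_half; apply: le_trans (pr_setU_le P _ _) _; try exact: measurable_half.
by rewrite pr_half_opp; lra.
Qed.

Lemma pr_tail_half v u : 0 < u -> pr P (tail v u) = 2 * pr P (half v u).
Proof.
move=> u0; apply/le_anti; rewrite pr_tail_le /=.
have := @pr_disjoint_sum_le R _ _ P bool (fun b => half (if b then v else - v) u) (tail v u).
rewrite big_bool /= pr_half_opp => h.
have -> : 2 * pr P (half v u) = pr P (half v u) + pr P (half v u) by ring.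
apply: h => [b|||].
- exact: measurable_half.
- exact: measurable_tail.
- by rewrite tail_half; case; [left|right].
- by case; case=> w //=; rewrite /half /= dotvNl => h1 h2; lra.
Qed.

Lemma pr_half0 v : 1 <= 2 * pr P (half v 0).
Proof.
apply: le_trans (pr_tail_le v 0); rewrite -(prT P); apply: le_pr => //.
- exact: measurable_tail.
- by move=> w _; rewrite /tail /= normr_ge0.
Qed.

Lemma le_pr_tail v (u u' : R) : u <= u' -> pr P (tail v u') <= pr P (tail v u).
Proof.
move=> uu; apply: le_pr; try exact: measurable_tail.
by move=> w; apply: le_trans.
Qed.

(** Log-concavity between the levels [k * u] and 0. The half-space at level 0 has probability at
    least [1 / 2], which exactly absorbs the factors 2 relating tails to half-spaces, so no constant
    is lost. *)
Lemma pr_tail_pow v (u : R) (k : nat) : 0 < u -> pr P (tail v (k%:R * u)) <= pr P (tail v u) ^+ k.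
Proof.
move=> u0; case: k => [|k]; first by rewrite expr0 pr_le1 //; exact: measurable_tail.
rewrite !pr_tail_half ?mulr_gt0 //.
have := pr_poly_root (fun _ : unit => v) (fun=> k.+1%:R * u) (fun=> 0) k.
rewrite -!half_poly mulr0 addr0 (_ : k.+1%:R * u / k.+1%:R = u); last first.
  by rewrite mulrAC divff ?mul1r // pnatr_eq0.
have := pr_half0 v; set g0 := pr P (half v 0); set a := pr P _; set b := pr P _ => h0 h.
have a0 : 0 <= a by exact: pr_ge0.
rewrite exprMn; apply: le_trans (ler_wpM2l _ h); last by rewrite exprn_ge0.
rewrite exprS -mulrA ler_pM2l // mulrCA -exprMn; apply: ler_peMr => //.
exact: exprn_ege1.
Qed.

(** On the slice [k * v <= f < k.+1 * v] the integrand is at most [phi (k.+1 * v)], and the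
    allowances [B / 2 ^+ k.+1] add up to [B]. The integral is the extended one, so finiteness is
    obtained along with the bound. *)
Lemma integral_dyadic_tail (f : Omega -> R) (phi : R -> R) (v B : R) :
  measurable_fun setT f -> (forall w, 0 <= f w) -> 0 < v ->
  measurable_fun setT (fun w => phi (f w)) ->
  (forall x, 0 <= phi x) -> (forall x y, 0 <= x -> x <= y -> phi x <= phi y) ->
  (forall k : nat, phi (k.+1%:R * v) * pr P [set w | k%:R * v <= f w] <= B / 2 ^+ k.+1) ->
  (\int[P]_w (phi (f w))%:E <= B%:E)%E.
Proof.
move=> mf f0 v0 mphi phi0 phiM hB.
pose A (k : nat) := [set w | k%:R * v <= f w].
have mA k : measurable (A k) by exact: measurable_set_le.
pose g (k : nat) w := (phi (k.+1%:R * v) * \1_(A k) w)%:E.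
have g0 k w : (0 <= g k w)%E by rewrite lee_fin mulr_ge0 // indic_ge0.
have mg k : measurable_fun setT (g k).
  by apply/measurable_EFinP; apply: measurable_funM => //; exact: measurable_indic.
apply: (@le_trans _ _ (\int[P]_w (\sum_(k <oo) g k w))%E).
  apply: ge0_le_integral => //.
  - by move=> w _; rewrite lee_fin.
  - exact/measurable_EFinP.
  - exact: ge0_emeasurable_sum.
  - move=> w _; pose n := Num.truncn (f w / v).
    rewrite (nneseriesD1 (n := n)) //.
    apply: (@le_trans _ _ (g n w)); last by rewrite leeDl // nneseries_ge0.
    have /andP[n1 n2] : n%:R <= f w / v < n.+1%:R by apply: truncn_itv; rewrite divr_ge0 // ltW.
    rewrite /g indic_in ?mulr1 ?lee_fin; last by rewrite /A /= -ler_pdivlMr.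
    by apply: phiM => //; rewrite -ler_pdivrMr // ltW.
rewrite integral_nneseries //.
apply: (@le_trans _ _ (\sum_(k <oo) (B / (2 ^ (k + 1))%:R)%:E)%E).
  apply: lee_nneseries => [k _ _|k _]; first exact: integral_ge0.
  rewrite /g; under eq_integral do rewrite EFinM.
  rewrite ge0_integralZl //; [|by apply/measurable_EFinP; exact: measurable_indic|
    by rewrite lee_fin].
  have -> : (\int[P]_x (\1_(A k) x)%:E = (pr P (A k))%:E)%E.
    by rewrite integral_indic // setIT; exact: prE.
  rewrite -EFinM lee_fin.
  by rewrite natrX addn1; exact: hB.
have := cvg_lim _ (@cvg_geometric_eseries_half R B 0).
by rewrite expr0 divr1 => -> //.
Qed.

(** Some level [u] has tail at most [1 / 8], and by [pr_tail_pow] the tails at multiples of [u] are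
    then powers of [1 / 8], small enough to pay for both [k.+1] and [2 ^+ k]. *)
Lemma itg_dotv v : itg P (fun w => dotv v (rvec X w)).
Proof.
have mf := measurable_dotv X v.
have e8 : 0 < (1 / 8 : R) by rewrite divr_gt0.
have [n hn] := pr_norm_gt_small P mf e8.
pose u : R := n%:R + 1.
have u0 : 0 < u by rewrite ltr_wpDl.
have hu : pr P (tail v u) <= 1 / 8.
  apply: le_trans hn; apply: le_pr.
  - exact: measurable_tail.
  - by apply: measurable_set_lt => //; apply: measurableT_comp.
  - by move=> w; rewrite /tail /=; apply: lt_le_trans; rewrite ltrDl.
apply/integrableP; split; first exact/measurable_EFinP.
apply: (@le_lt_trans _ _ (2 * u)%:E); last exact: ltry.
have := @integral_dyadic_tail (fun w => `|dotv v (rvec X w)|) (fun x => `|x|) u (2 * u).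
have mn : measurable_fun setT (fun w => `|dotv v (rvec X w)|) by apply: measurableT_comp.
move=> h; apply: le_trans (h mn _ u0 _ _ _ _) => //.
- by apply: ge0_le_integral => //= [||w _]; rewrite ?normr_id //;
    do ?[apply/measurable_EFinP; do ?apply: measurableT_comp => //].
- by under eq_fun do rewrite normr_id.
- by move=> x y x0 xy; rewrite !ger0_norm // (le_trans x0).
- move=> k; rewrite ger0_norm ?mulr_ge0 ?(ltW u0) //.
  apply: le_trans (ler_wpM2l _ (pr_tail_pow v k u0)) _; first by rewrite mulr_ge0 // ltW.
  apply: (@le_trans _ _ (k.+1%:R * u * (1 / 8) ^+ k)).
    rewrite ler_wpM2l ?mulr_ge0 ?(ltW u0) // lerXn2r ?nnegrE ?pr_ge0 //.
  have -> : 2 * u / 2 ^+ k.+1 = u * (1 / 2) ^+ k.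
    by rewrite expr_div_n expr1n exprS; field; rewrite expf_neq0.
  rewrite [_ * u]mulrC -mulrA ler_pM2l //.
  have -> : (1 / 8 : R) ^+ k = (1 / 2) ^+ k * ((1 / 2) ^+ k * (1 / 2) ^+ k).
    by rewrite -!exprMn; congr (_ ^+ _); field.
  have h0 : 0 <= (1 / 2 : R) ^+ k by rewrite exprn_ge0.
  have h1 : (1 / 2 : R) ^+ k <= 1 by rewrite exprn_ile1 //; lra.
  have h2 : k.+1%:R * (1 / 2 : R) ^+ k <= 1.
    rewrite expr_div_n expr1n mulrA mulr1 ler_pdivrMr ?exprn_gt0 // mul1r -natrX ler_nat.
    exact: ltn_expl.
  rewrite mulrCA; apply: ler_piMr => //.
  by rewrite mulrA; apply: mulr_ile1 => //; rewrite mulr_ge0.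
Qed.

(** By contraposition. A tail below [expR (- (p / 64))] at [u] becomes [expR (- (4 * k * p))] at
    [k * 256 * u]; this beats [k.+1 ^ p <= expR (k * p)] and bounds the p-th moment by
    [2 * (256 * u) ^ p], hence the norm by [512 * u] as [p >= 1]. *)
Lemma pr_tail_ge_of_moment v (p u : R) : 1 <= p -> 0 < u ->
  ((512 * u)%:E < 'N[P]_(p%:E)[(fun w => (dotv v (rvec X w))%:E)])%E ->
  expR (- (p / 64)) <= pr P (tail v u).
Proof.
move=> p1 u0.
apply: contraTle => hu; rewrite -leNgt.
have p0 : 0 < p by apply: lt_le_trans p1.
pose V := 256 * u; have V0 : 0 < V by apply: mulr_gt0; [rewrite ltr0n|].
have mn : measurable_fun setT (fun w => `|dotv v (rvec X w)|).
  by apply: measurableT_comp => //; exact: measurable_dotv.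
have int_le : (\int[P]_w (`|dotv v (rvec X w)| `^ p)%:E <= (2 * V `^ p)%:E)%E.
  apply: (@integral_dyadic_tail (fun w => `|dotv v (rvec X w)|) (fun x => x `^ p) V) => //.
  - exact: (measurableT_comp (measurable_powR p) mn).
  - by move=> x; exact: powR_ge0.
  - move=> x y x0 xy.
    by apply: ge0_ler_powR; rewrite ?nnegrE ?(ltW p0) ?(le_trans x0 xy).
  move=> k.
  have -> : k%:R * V = (k * 256)%:R * u by rewrite /V natrM; ring.
  have h1 : pr P (tail v ((k * 256)%:R * u)) <= expR (- (4 * k%:R * p)).
    apply: le_trans (pr_tail_pow v (k * 256) u0) _.
    apply: (@le_trans _ _ (expR (- (p / 64)) ^+ (k * 256))).
      by rewrite lerXn2r ?nnegrE ?pr_ge0 ?expR_ge0 // ltW.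
    by rewrite -expRM_natl ler_expR natrM; lra.
  have h2 : (k.+1%:R * V) `^ p <= expR (k%:R * p) * V `^ p.
    rewrite powRM ?(ltW V0) // ler_wpM2r ?powR_ge0 // expRM.
    apply: ge0_ler_powR; rewrite ?nnegrE ?expR_ge0 // ?(ltW p0) //.
    by rewrite -natr1 addrC expR_ge1Dx.
  apply: (le_trans (ler_pM (powR_ge0 _ _) (pr_ge0 _ _) h2 h1)).
  rewrite mulrAC -expRD mulrC.
  have -> : 2 * V `^ p / 2 ^+ k.+1 = V `^ p * 2^-1 ^+ k.
    by rewrite exprVn exprS; field; rewrite expf_neq0.
  rewrite ler_wpM2l ?powR_ge0 //.
  apply: (@le_trans _ _ (expR (- 3) ^+ k)).
    rewrite -expRM_natl ler_expR.
    have : k%:R * 1 <= k%:R * p by rewrite ler_wpM2l.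
    lra.
  rewrite lerXn2r ?nnegrE ?expR_ge0 // expRN lef_pV2 ?posrE ?expR_gt0 //.
  by apply: le_trans (expR_ge1Dx _); lra.
rewrite unlock /=.
have e1 : ((2 * V `^ p)%:E `^ p^-1 <= (512 * u)%:E)%E.
  rewrite poweR_EFin lee_fin powRM ?powR_ge0 // -powRrM mulfV ?gt_eqF // powRr1 ?(ltW V0) //.
  have : 2 `^ p^-1 <= 2 `^ 1 :> R by rewrite ler_powR ?ler1n // invf_le1.
  rewrite powRr1 // => h.
  by apply: (le_trans (ler_wpM2r (ltW V0) h)); rewrite /V; lra.
apply: le_trans e1; apply: gt0_ler_poweR; rewrite ?invr_ge0 ?(ltW p0) //.
- by rewrite in_itv /= leey andbT; apply: integral_ge0.
- by rewrite in_itv /= leey andbT lee_fin mulr_ge0 // powR_ge0.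
Qed.

End Tails.

(** * Joint tails of several coordinates *)

Section OrthantTails.
Context {R : realType} {d0 : measure_display} {Omega : measurableType d0}.
Context (P : probability Omega R) (d : nat) (X : 'I_d -> {RV P >-> R}).
Hypothesis HU : unconditional_vec X.
Hypothesis HL : log_concave_vec X.
Implicit Types (I : {set 'I_d}) (l s : 'I_d -> R).

Definition unit_row (i : 'I_d) : 'rV[R]_d := \row_j (i == j)%:R.

Lemma dotv_unit_row i w : dotv (unit_row i) (rvec X w) = X i w.
Proof.
rewrite dotv_rvecE (bigD1 i) //= mxE eqxx mul1r big1 ?addr0 // => j ji.
by rewrite mxE eq_sym (negbTE ji) mul0r.
Qed.

Definition orth I l : set Omega := [set w | forall i, i \in I -> l i <= X i w].

(** Outside [I] the constraint reads [0 <= 0], so all sets [I] share the index type ['I_d]. *)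
Definition ortW I (i : 'I_d) : 'rV[R]_d := if i \in I then unit_row i else 0.
Definition ortl I l (i : 'I_d) : R := if i \in I then l i else 0.

Lemma dotv0 (x : 'rV[R]_d) : dotv 0 x = 0.
Proof. by rewrite /dotv big1 // => i _; rewrite mxE mul0r. Qed.

Lemma orth_poly I l : orth I l = poly X (ortW I) (ortl I l).
Proof.
apply/seteqP; split => w h i; have := h i; rewrite /ortW /ortl; case: ifP => iI.
- by rewrite dotv_unit_row; apply.
- by rewrite dotv0.
- by move=> + _; rewrite dotv_unit_row.
- by [].
Qed.

Lemma measurable_orth I l : measurable (orth I l).
Proof. by rewrite orth_poly; exact: measurable_poly. Qed.

Definition slab (k : 'I_d) (y u : R) : set Omega := [set w | `|X k w - y| <= u].

Lemma measurable_slab k y u : measurable (slab k y u).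
Proof.
have mf : measurable_fun setT (fun w => X k w - y) by exact: measurable_funB.
by apply: measurable_set_le => //; apply: measurableT_comp.
Qed.

Definition slW I k (j : 'I_d + bool) : 'rV[R]_d :=
  match j with inl i => ortW I i | inr b => if b then unit_row k else - unit_row k end.
Definition sll I l (y u : R) (j : 'I_d + bool) : R :=
  match j with inl i => ortl I l i | inr b => if b then y - u else - y - u end.

Lemma orth_slab_poly I l k y u : orth I l `&` slab k y u = poly X (slW I k) (sll I l y u).
Proof.
apply/seteqP; split => [w [+ +]|w h].
  rewrite orth_poly /slab /= ler_norml => ho /andP[h1 h2] [i|[]] /=; first exact: ho.
    by rewrite dotv_unit_row; lra.
  by rewrite dotvNl dotv_unit_row; lra.
split; first by rewrite orth_poly => i; exact: (h (inl i)).
have := h (inr true); have := h (inr false); rewrite /slab /= dotvNl dotv_unit_row ler_norml.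
by move=> h1 h2; apply/andP; split; lra.
Qed.

Definition flip1 (k : 'I_d) (i : 'I_d) : R := if i == k then -1 else 1.

Lemma flip1_sign k i : flip1 k i = 1 \/ flip1 k i = -1.
Proof. by rewrite /flip1; case: eqP; [right|left]. Qed.

Lemma flip_unit_row k i : flip (flip1 k) (unit_row i) = if i == k then - unit_row i else unit_row i.
Proof.
apply/rowP => j; rewrite /flip mxE /flip1; have [<-|ij] := eqVneq i j.
  by case: ifP => _; rewrite !mxE eqxx ?mulN1r ?mul1r.
by case: (i == k); rewrite !mxE (negbTE ij) mulr0 ?oppr0.
Qed.

Lemma flip0 eta : flip eta (0 : 'rV[R]_d) = 0.
Proof. by apply/rowP => j; rewrite !mxE mulr0. Qed.

Lemma flipN eta (v : 'rV[R]_d) : flip eta (- v) = - flip eta v.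
Proof. by apply/rowP => j; rewrite !mxE mulrN. Qed.

Lemma flip_ortW I k i : k \notin I -> flip (flip1 k) (ortW I i) = ortW I i.
Proof.
move=> kI; rewrite /ortW; case: ifP => iI; last exact: flip0.
by rewrite flip_unit_row; case: eqP => // ik; rewrite -ik iI in kI.
Qed.

Lemma pr_orth_slab_opp I l k y u : k \notin I ->
  pr P (orth I l `&` slab k (- y) u) = pr P (orth I l `&` slab k y u).
Proof.
move=> kI; rewrite !orth_slab_poly -(poly_flip _ _ HU (flip1_sign k)) //.
have fk : flip (flip1 k) (unit_row k) = - unit_row k by rewrite flip_unit_row eqxx.
congr (pr P _); apply/seteqP; split => w h [i|b] /=.
- by have := h (inl i); rewrite /= flip_ortW.
- by have := h (inr (~~ b)); case: b; rewrite /= ?flipN fk ?opprK.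
- by rewrite flip_ortW //; exact: (h (inl i)).
- by have := h (inr (~~ b)); case: b; rewrite /= ?flipN fk ?opprK.
Qed.

(** Reflecting the coordinate [k], free because [k] is not in [I], makes the slabs at [y] and [- y]
    equally likely; the centred slab is their midpoint. *)
Lemma pr_orth_slab_max I l k y u : k \notin I ->
  pr P (orth I l `&` slab k y u) <= pr P (orth I l `&` slab k 0 u).
Proof.
move=> kI; have E := pr_orth_slab_opp l y u kI.
have h01 : 0 <= (1 / 2 : R) <= 1 by apply/andP; split; lra.
rewrite -E; rewrite !orth_slab_poly in E *.
apply: le_trans (pr_poly_convex HL h01 E) _.
suff -> : (fun j => 1 / 2 * sll I l (- y) u j + (1 - 1 / 2) * sll I l y u j) = sll I l 0 u by [].
by apply: funext => -[i|[]] /=; lra.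
Qed.

(* [ -T, T ] is covered by [n] translates of [ -u, u ], none of which is more
   likely than the centred one. *)
Lemma pr_orth_slab_scale I l k (u T : R) : k \notin I -> 0 < u -> u <= T ->
  u / (2 * T) * pr P (orth I l `&` slab k 0 T) <= pr P (orth I l `&` slab k 0 u).
Proof.
move=> kI u0 uT; have T0 : 0 < T by apply: lt_le_trans uT.
(* Intervals of radius [u] centred at [(2 * j + 1 - n) * u] tile [[- n * u, n * u]], which contains
   [[- T, T]]; [u <= T] gives [n <= 2 * T / u]. *)
pose n := (Num.truncn (T / u)).+1.
have Tu0 : 0 <= T / u by rewrite divr_ge0 // ltW.
have /andP[n1 n2] := truncn_itv Tu0; rewrite -/n in n2.
have nT : T < n%:R * u by rewrite -ltr_pdivrMr.
have nle : n%:R <= 2 * T / u.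
  rewrite /n -natr1 ler_pdivlMr //.
  have : (Num.truncn (T / u))%:R * u <= T by rewrite -ler_pdivlMr.
  by lra.
pose y (j : 'I_n) : R := (2 * j%:R + 1 - n%:R) * u.
have cover : orth I l `&` slab k 0 T `<=` [set w | exists j, (orth I l `&` slab k (y j) u) w].
  move=> w [ow]; rewrite /slab /= subr0 ler_norml => /andP[h1 h2].
  pose z := (X k w / u + n%:R) / 2.
  have zu : z * (2 * u) = X k w + n%:R * u by rewrite /z; field; rewrite gt_eqF.
  have z0 : 0 <= z by rewrite -(pmulr_lge0 _ (_ : 0 < 2 * u)) ?zu ?mulr_gt0 //; lra.
  have zn : z < n%:R by rewrite -(ltr_pM2r (_ : 0 < 2 * u)) ?zu ?mulr_gt0 //; lra.
  have /andP[t1 t2] := truncn_itv z0.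
  have tn : (Num.truncn z < n)%N by rewrite -(ltr_nat R); exact: le_lt_trans zn.
  exists (Ordinal tn); split => //; rewrite ler_norml /y /=.
  have := ler_wpM2r (ltW (mulr_gt0 (ltr0Sn R 1) u0)) t1.
  have := ler_wpM2r (ltW (mulr_gt0 (ltr0Sn R 1) u0)) (ltW t2).
  rewrite zu -natr1 => q1 q2; apply/andP; split; lra.
have mA j : measurable (orth I l `&` slab k (y j) u).
  by apply: measurableI; [exact: measurable_orth|exact: measurable_slab].
have h : pr P (orth I l `&` slab k 0 T) <= n%:R * pr P (orth I l `&` slab k 0 u).
  apply: (@le_trans _ _ (pr P [set w | exists j, (orth I l `&` slab k (y j) u) w])).
    apply: le_pr => //.
      by apply: measurableI; [exact: measurable_orth|exact: measurable_slab].
    have -> : [set w | exists j, (orth I l `&` slab k (y j) u) w] =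
       \bigcup_(j in [set: 'I_n]) (orth I l `&` slab k (y j) u).
      by apply/seteqP; split => [w [j h]|w [j _ h]]; exists j.
    exact: fin_bigcup_measurable.
  apply: le_trans (pr_exists_le P mA) _.
  apply: (@le_trans _ _ (\sum_(j < n) pr P (orth I l `&` slab k 0 u))).
    by apply: ler_sum => j _; exact: pr_orth_slab_max.
  by rewrite sumr_const card_ord mulr_natl.
rewrite mulrAC ler_pdivrMr ?mulr_gt0 // mulrC.
apply: (@le_trans _ _ (n%:R * pr P (orth I l `&` slab k 0 u) * u)).
  by rewrite ler_pM2r.
have h2 : n%:R * u <= 2 * T by rewrite -ler_pdivlMr.
by have := ler_wpM2r (pr_ge0 P (orth I l `&` slab k 0 u)) h2; lra.
Qed.

Lemma orth_set1U I l k : orth (k |: I)%SET l = orth I l `&` [set w | l k <= X k w].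
Proof.
apply/seteqP; split => [w h|w [h1 h2] i].
  by split => [i iI|]; apply: h; rewrite in_setU1 ?iI ?orbT ?eqxx.
by rewrite in_setU1 => /orP[/eqP -> //|]; exact: h1.
Qed.

Lemma pr_orth_flip_half I l k : k \notin I ->
  pr P (orth I l `&` [set w | l k <= - X k w]) = pr P (orth (k |: I)%SET l).
Proof.
move=> kI; rewrite [in RHS]orth_poly -(poly_flip _ _ HU (flip1_sign k)).
congr (pr P _); apply/seteqP; split => [w [h1 h2] i|w h].
  rewrite /ortl /ortW in_setU1; case: eqP => [-> /=|ik /=].
    by rewrite flip_unit_row eqxx dotvNl dotv_unit_row.
  case: ifP => iI; last by rewrite flip0 dotv0.
  by rewrite flip_unit_row (introF eqP ik) dotv_unit_row; exact: h1.
split => [i iI|].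
  have := h i; rewrite /ortl /ortW in_setU1 iI orbT flip_unit_row.
  by case: eqP => [ik|_]; [rewrite -ik iI in kI|rewrite dotv_unit_row].
by have := h k; rewrite /ortl /ortW setU11 flip_unit_row eqxx dotvNl dotv_unit_row.
Qed.

Lemma measurable_orth_flip_half I l k : measurable (orth I l `&` [set w | l k <= - X k w]).
Proof.
apply: measurableI; first exact: measurable_orth.
by apply: measurable_set_le => //; exact: measurable_funN.
Qed.

(** The events [X k >= l k], [X k <= - l k] and [|X k| <= u] are disjoint, and within [orth I l] the
    first two are equally likely by reflection. *)
Lemma pr_orth_split I l k (u : R) : k \notin I -> 0 < l k -> u < l k ->
  2 * pr P (orth (k |: I)%SET l) + pr P (orth I l `&` slab k 0 u) <= pr P (orth I l).
Proof.
move=> kI lk ul.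
have := @pr_disjoint_sum_le R _ _ P (option bool) (fun b =>
  match b with Some true => orth (k |: I)%SET l | Some false => orth I l `&` [set w | l k <= - X k w]
   | None => orth I l `&` slab k 0 u end) (orth I l).
rewrite (bigD1 None) //= (bigD1 (Some true)) //= (bigD1 (Some false)) //= big1 ?addr0; last first.
  by case=> [[]|].
rewrite pr_orth_flip_half // => h; apply: le_trans (h _ _ _ _); first by lra.
- case=> [[]|]; [exact: measurable_orth|exact: measurable_orth_flip_half|].
  by apply: measurableI; [exact: measurable_orth|exact: measurable_slab].
- exact: measurable_orth.
- by case=> [[]|] w; [rewrite orth_set1U => -[]|case|case].
- case=> [[]|] [[]|] w //; rewrite ?orth_set1U /slab /= ?subr0 ?ler_norml;
    move=> [_ h1] [_ h2]; exfalso; move: h1 h2;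
    try move=> /andP[h1 h1']; try move=> h1; try move=> /andP[h2 h2']; try move=> h2; lra.
Qed.

Lemma pr_orth_set1U_le I l k : k \notin I -> 0 < l k ->
  2 * pr P (orth (k |: I)%SET l) <= pr P (orth I l).
Proof.
move=> kI lk; apply: le_trans (pr_orth_split kI lk (u := 0) lk).
by rewrite lerDl pr_ge0.
Qed.

Lemma set1U_ind (Q : {set 'I_d} -> Prop) : Q finset.set0 ->
  (forall k I, k \notin I -> Q I -> Q (k |: I)%SET) -> forall I, Q I.
Proof.
move=> Q0 QS I; elim: {I}#|I| {-2}I (erefl #|I|) => [|n IH] I.
  by move/eqP; rewrite cards_eq0 => /eqP ->.
move=> In; have /card_gt0P[k kI] : (0 < #|I|)%N by rewrite In.
rewrite -(finset.setD1K kI); apply: QS; first by rewrite finset.setD11.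
by apply: IH; move: In; rewrite (finset.cardsD1 k) kI => -[].
Qed.

Lemma pr_orth0_ge I : 1 <= 2 ^+ #|I| * pr P (orth I (fun=> 0)).
Proof.
elim/set1U_ind: I => [|k I kI IH].
  rewrite finset.cards0 expr0 mul1r -(prT P) le_pr //; first exact: measurable_orth.
  by move=> w _ i; rewrite finset.in_set0.
rewrite finset.cardsU1 kI exprS [2 * _]mulrC -mulrA.
apply: le_trans IH _; rewrite ler_wpM2l ?exprn_ge0 //.
have -> : 2 * pr P (orth (k |: I)%SET (fun=> 0)) = pr P (orth (k |: I)%SET (fun=> 0)) +
   pr P (orth I (fun=> 0) `&` [set w | 0 <= - X k w]).
  by rewrite (pr_orth_flip_half (fun=> 0)) //; ring.
apply: le_trans (pr_setU_le P _ _); last 2 first.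
- exact: measurable_orth.
- exact: (measurable_orth_flip_half I (fun=> 0) k).
apply: le_pr.
- exact: measurable_orth.
- apply: measurableU; first exact: measurable_orth.
  exact: (measurable_orth_flip_half I (fun=> 0) k).
- move=> w h; have [x0|x0] := lerP 0 (X k w); first by left; rewrite orth_set1U.
  by right; split => //=; rewrite oppr_ge0 ltW.
Qed.

(** The analogue of [pr_tail_pow]: the factor [2 ^+ #|I|] is the number of sign patterns, and
    [pr_orth0_ge] supplies the normalisation at level 0. *)
Lemma pr_orth_scale I s (k : nat) :
  2 ^+ #|I| * pr P (orth I s) <= (2 ^+ #|I| * pr P (orth I (fun i => s i / k.+1%:R))) ^+ k.+1.
Proof.
have := pr_poly_root HL (ortW I) (ortl I s) (ortl I (fun=> 0)) k.
have -> : (fun j => (ortl I s j + k%:R * ortl I (fun=> 0) j) / k.+1%:R) =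
   ortl I (fun i => s i / k.+1%:R).
  by apply: funext => j; rewrite /ortl; case: ifP => _; rewrite ?mulr0 ?addr0 ?mul0r.
rewrite -!orth_poly; have := pr_orth0_ge I; set a := 2 ^+ #|I|.
set q0 := pr P _; set q := pr P _; set q1 := pr P _ => h0 h.
have a0 : 0 <= a by rewrite exprn_ge0.
have q00 : 0 <= q by exact: pr_ge0.
rewrite exprMn; apply: le_trans (ler_wpM2l _ h); last by rewrite exprn_ge0.
rewrite exprS -mulrA ler_wpM2l // mulrCA -exprMn; apply: ler_peMr => //.
exact: exprn_ege1.
Qed.

(** Union bound over the signs of the coordinates in [I]. Patterns [S] not contained in [I] are
    assigned the empty event, which leaves [2 ^+ #|I|] terms, all equal by flipping. *)
Lemma pr_all_large_orth_le I s :
  pr P [set w | forall i, i \in I -> s i <= `|X i w|] <= 2 ^+ #|I| * pr P (orth I s).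
Proof.
pose sg (S : {set 'I_d}) i : R := if i \in S then -1 else 1.
have sgs S i : sg S i = 1 \/ sg S i = -1 by rewrite /sg; case: ifP; [right|left].
pose A (S : {set 'I_d}) := if S \subset I then
  poly X (fun j => flip (sg S) (ortW I j)) (ortl I s) else set0.
have mA S : measurable (A S).
  by rewrite /A; case: ifP => _; [exact: measurable_poly|exact: measurable0].
have fl S i : flip (sg S) (unit_row i) = sg S i *: unit_row i.
  apply/rowP => j; rewrite !mxE; have [->//|ij] := eqVneq i j; by rewrite !mulr0.
have mE : measurable [set w | forall i, i \in I -> s i <= `|X i w|].
  have -> : [set w | forall i, i \in I -> s i <= `|X i w|] =
    [set w | forall i, [set w | (if i \in I then s i else 0) <= `|X i w|] w].
    apply/seteqP; split => w h i; first by rewrite /=; case: ifP => // /h.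
    by move=> iI; have := h i; rewrite /= iI.
  apply: measurable_forall => i; apply: measurable_set_le => //.
  exact: measurableT_comp.
apply: (@le_trans _ _ (pr P [set w | exists S, A S w])).
  apply: le_pr => //.
    have -> : [set w | exists S, A S w] = \bigcup_(S in [set: {set 'I_d}]) A S.
      by apply/seteqP; split => [w [j h]|w [j _ h]]; exists j.
    exact: fin_bigcup_measurable.
  move=> w h; exists [set i in I | X i w < 0]%SET; rewrite /A.
  have -> : [set i in I | X i w < 0]%SET \subset I.
    by apply/fintype.subsetP => i; rewrite finset.inE => /andP[].
  move=> i; rewrite /ortl /ortW; case: ifP => iI; last by rewrite flip0 dotv0.
  rewrite fl dotvZl dotv_unit_row /sg finset.inE iI /=; have := h i iI.
  by case: ltP => x0; rewrite ?mulN1r ?mul1r; [rewrite ltr0_norm|rewrite ger0_norm].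
apply: le_trans (pr_exists_le P mA) _.
have -> : 2 ^+ #|I| * pr P (orth I s) = \sum_(S in finset.powerset I) pr P (orth I s).
  by rewrite sumr_const finset.card_powerset -[RHS]mulr_natl natrX.
rewrite [leRHS]big_mkcond; apply: ler_sum => S _.
rewrite finset.powersetE /A; case: ifP => _; last by rewrite pr0.
by rewrite (poly_flip _ _ HU (sgs S)) -orth_poly.
Qed.

Variable b : 'I_d -> R.
Hypothesis bE : forall i, b i = Ex P (fun w => `|X i w|).

Lemma itg_coord i : itg P (X i).
Proof. by have := itg_dotv HU HL (unit_row i); under eq_fun do rewrite dotv_unit_row. Qed.

Lemma pr_coord_markov i c : 0 < b i -> 0 < c ->
  pr P [set w | c * b i <= `|X i w|] <= c^-1.
Proof.
move=> b0 c0; have := @markov_pr R _ _ P (fun w => `|X i w|) (c * b i)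
  (itg_norm (itg_coord i)) (fun w => normr_ge0 _) (mulr_gt0 c0 b0).
by rewrite -bE invfM mulrCA mulfV ?mulr1 // gt_eqF.
Qed.

Lemma pr_orth_mono I (J : {set 'I_d}) l : (forall i, i \in J -> 0 < l i) -> I \subset J ->
  2 ^+ #|J| * pr P (orth J l) <= 2 ^+ #|I| * pr P (orth I l).
Proof.
move=> l0 IJ; have -> : J = ((J :\: I) :|: I)%SET.
  by apply/finset.setP => i; rewrite !finset.inE; have := fintype.subsetP IJ i; case: (i \in I) => [/(_ isT) ->|_]; rewrite ?orbF ?andbT ?orbT.
have : (J :\: I)%SET \subset J by exact: finset.subsetDl.
move: (J :\: I)%SET => K; elim/set1U_ind: K => [|k K kK IH] KJ; first by rewrite finset.set0U.
have kJ : k \in J by rewrite (fintype.subsetP KJ) // finset.setU11.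
have KJ' : K \subset J by apply: fintype.subset_trans KJ; exact: finset.subsetUr.
apply: le_trans (IH KJ'); rewrite -finset.setUA.
have [kKI|kKI] := boolP (k \in (K :|: I)%SET).
  by rewrite (_ : (k |: (K :|: I))%SET = (K :|: I)%SET) //; apply/finset.setUidPr; rewrite finset.sub1set.
rewrite finset.cardsU1 kKI exprS [2 * _]mulrC -mulrA ler_wpM2l ?exprn_ge0 //.
by apply: pr_orth_set1U_le => //; exact: l0.
Qed.

(* Adding the coordinates of [I] one at a time, each one loses at least its
   share of the slab [|X k| < l k], estimated by unimodality. *)
Lemma pr_orth_linear I l : (forall i, i \in I -> 0 < b i) -> (forall i, i \in I -> 0 < l i) ->
  2 ^+ #|I| * pr P (orth I l) <= 3 / 4 \/
  2 ^+ #|I| * pr P (orth I l) <= 1 - \sum_(i in I) l i / (32 * b i).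
Proof.
elim/set1U_ind: I => [|k I kI IH] b0 l0.
  right; rewrite big1 ?subr0 => [|i]; last by rewrite finset.inE.
  by rewrite finset.cards0 expr0 mul1r pr_le1 //; exact: measurable_orth.
have kkI : k \in (k |: I)%SET by rewrite finset.setU11.
have bk := b0 k kkI; have lk := l0 k kkI.
have sub i : i \in I -> i \in (k |: I)%SET by move=> iI; rewrite finset.in_setU1 iI orbT.
have [h|h] := lerP (2 ^+ #|(k |: I)%SET| * pr P (orth (k |: I)%SET l)) (3 / 4); first by left.
right.
have mono := pr_orth_mono l0 (finset.subsetUr [set k]%SET I).
have {IH}[IH|IH] := IH (fun i iI => b0 i (sub i iI)) (fun i iI => l0 i (sub i iI)).
  by have := le_lt_trans (le_trans mono IH) h; rewrite ltxx.
have cardU : 2 ^+ #|(k |: I)%SET| = 2 ^+ #|I| * 2 :> R by rewrite finset.cardsU1 kI exprSr.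
set a := 2 ^+ #|I| in IH cardU mono; have a0 : 0 < a by rewrite exprn_gt0.
rewrite (bigD1 k) //= (eq_bigl (mem I)) => [|i]; last first.
  rewrite !finset.inE; case: (eqVneq i k) => [->|ik]; last by rewrite andbT.
  by rewrite (negbTE kI).
(* By Markov the mass beyond [4 * b k] is at most [1 / 4], so at least [3 / 4 - 1 / 4] stays in the
   slab of height [T]. The slab of height [l k / 2] receives the share [l k / (16 * b k)] of it,
   whence the constant 32. If [l k > 8 * b k], Markov alone contradicts the bound [3 / 4]. *)
pose T := 4 * b k; have T0 : 0 < T by rewrite mulr_gt0.
have single (c : R) : 0 < c -> 2 * pr P (orth [set k]%SET (fun=> c * b k)) <= c^-1.
  move=> c0; apply: le_trans (pr_coord_markov bk c0).
  have -> : [set w | c * b k <= `|X k w|] = tail X (unit_row k) (c * b k).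
    by apply/seteqP; split => w; rewrite /tail /= dotv_unit_row.
  rewrite (pr_tail_half HU) ?mulr_gt0 // ler_pM2l //.
  rewrite le_eqVlt; apply/orP; left; apply/eqP; congr (pr P _).
  apply/seteqP; split => w; rewrite /half /= dotv_unit_row => h0.
    by apply: h0; rewrite finset.inE.
  by move=> i; rewrite finset.inE => /eqP ->.
have big_lk : l k <= 8 * b k.
  rewrite leNgt; apply/negP => lb.
  have : 2 ^+ #|(k |: I)%SET| * pr P (orth (k |: I)%SET l) <= 8^-1.
    apply: le_trans (pr_orth_mono l0 (finset.subsetUl [set k]%SET I)) _.
    rewrite finset.cards1 expr1; apply: le_trans (single 8 _) => //.
    rewrite ler_pM2l //; apply: le_pr; [exact: measurable_orth..|].
    move=> w h0 i; rewrite finset.inE => /eqP ->; apply: le_trans (ltW lb) _.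
    by apply: h0; rewrite finset.inE.
  lra.
have mT : a * pr P (orth I l `&` slab k 0 T) >= a * pr P (orth I l) - 1 / 4.
  pose lT i := if i == k then T else l i.
  have lT0 i : i \in (k |: I)%SET -> 0 < lT i by rewrite /lT; case: eqP => // _; exact: l0.
  have orthT : orth I lT = orth I l.
    apply/seteqP; split => w h0 i iI; have := h0 i iI; rewrite /lT; case: eqP => // ik;
    by rewrite -ik iI in kI.
  have lTk : lT k = T by rewrite /lT eqxx.
  have q4 : a * (2 * pr P (orth (k |: I)%SET lT)) <= 1 / 4.
    rewrite mulrA -cardU; apply: le_trans (pr_orth_mono lT0 (finset.subsetUl [set k]%SET I)) _.
    rewrite finset.cards1 expr1 div1r; apply: le_trans (single 4 _) => //.
    rewrite ler_pM2l //; apply: le_pr; [exact: measurable_orth..|].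
    by move=> w h0 i; rewrite finset.inE => /eqP ->; rewrite -/T -lTk; apply: h0; rewrite finset.inE.
  have mo := measurable_orth.
  have ms := measurable_slab.
  have : pr P (orth I l) <= pr P (orth I l `&` slab k 0 T) + 2 * pr P (orth (k |: I)%SET lT).
    have := pr_orth_flip_half lT kI; rewrite orthT lTk => fE.
    have mf := measurable_orth_flip_half I lT k; rewrite orthT lTk in mf.
    rewrite mulr2n mulrDl mul1r -{2}fE addrA.
    apply: le_trans (lerD (pr_setU_le P _ _) (lexx _)); [|exact: measurableI|exact: mo].
    apply: le_trans (pr_setU_le P _ mf); last by apply: measurableU => //; exact: measurableI.
    apply: le_pr => //; first by apply: measurableU => //; apply: measurableU => //; exact: measurableI.
    move=> w ow; have [h0|h0] := leP `|X k w| T; first by left; left; split; rewrite // /slab /= subr0.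
    rewrite orth_set1U orthT lTk.
    move: h0; case: ger0P => _ h0; [left; right|right]; split => //=; exact: ltW.
  move=> /(ler_wpM2l (ltW a0)); lra.
have u0 : 0 < l k / 2 by rewrite divr_gt0.
have uT : l k / 2 <= T by rewrite /T; lra.
have sc := ler_wpM2l (ltW a0) (pr_orth_slab_scale l kI u0 uT).
have ul : l k / 2 < l k by lra.
have spl := ler_wpM2l (ltW a0) (pr_orth_split kI lk ul).
rewrite mulrDr mulrA -cardU in spl.
have ratio : l k / 2 / (2 * T) = l k / (16 * b k) by rewrite /T; field; rewrite gt_eqF.
rewrite ratio in sc.
have hI : 3 / 4 < a * pr P (orth I l) by apply: lt_le_trans mono.
have half_ : 1 / 2 <= a * pr P (orth I l `&` slab k 0 T) by lra.
have r0 : 0 <= l k / (16 * b k) by rewrite divr_ge0 ?mulr_ge0 // ltW.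
have := ler_wpM2l r0 half_.
have -> : l k / (16 * b k) * (1 / 2) = l k / (32 * b k) by field; rewrite gt_eqF.
rewrite mulrCA in sc.
move: spl IH sc; set s1 := \sum_(i in I) _; lra.
Qed.

(** The linear estimate is useful only while the sum is of order 1. Dividing the levels by the
    integer part of [4 * S] brings the sum to at least [1 / 4], where the probability is at most
    [3 / 4 <= expR (- (1 / 4))]; [pr_orth_scale] raises this to the matching power. Rounding costs
    [expR (1 / 4) <= 2]. *)
Lemma pr_all_large_le I s : (forall i, i \in I -> 0 < b i) -> (forall i, i \in I -> 0 < s i) ->
  pr P [set w | forall i, i \in I -> s i <= `|X i w|] <=
  2 * expR (- (\sum_(i in I) s i / (32 * b i))).
Proof.
move=> b0 s0; apply: le_trans (pr_all_large_orth_le I s) _.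
set S := \sum_(i in I) _; set g := 2 ^+ #|I| * _.
have S0 : 0 <= S by apply: sumr_ge0 => i iI; rewrite divr_ge0 ?mulr_ge0 // ltW ?s0 ?b0.
have g1 : g <= 1.
  have := pr_orth_mono s0 (finset.sub0set I); rewrite finset.cards0 expr0 mul1r => /le_trans; apply.
  by rewrite pr_le1 //; exact: measurable_orth.
have [S4|S4] := lerP (4 * S) 1.
  apply: le_trans g1 _.
  have : 1 + - S <= expR (- S) by exact: expR_ge1Dx.
  lra.
have S40 : 0 <= 4 * S by rewrite mulr_ge0.
have /andP[n1 n2] := truncn_itv S40.
have : (0 < Num.truncn (4 * S))%N by rewrite truncn_gt0 ltW.
case E : (Num.truncn (4 * S)) => [//|k] _; rewrite E in n1 n2.
have k0 : (0 : R) < k.+1%:R by rewrite ltr0n.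
apply: le_trans (pr_orth_scale I s k) _; set h := 2 ^+ #|I| * _.
have h34 : h <= 3 / 4.
  have l0 i : i \in I -> 0 < s i / k.+1%:R by move=> iI; rewrite divr_gt0 ?s0.
  have [//|] := pr_orth_linear b0 l0.
  rewrite -/h => /le_trans; apply.
  have -> : \sum_(i in I) s i / k.+1%:R / (32 * b i) = S / k.+1%:R.
    by rewrite mulr_suml; apply: eq_bigr => i _; rewrite mulrAC.
  have : 1 / 4 <= S / k.+1%:R by rewrite ler_pdivlMr //; lra.
  by move: (S / _) => y hy; lra.
have h0 : 0 <= h by rewrite mulr_ge0 ?exprn_ge0 ?pr_ge0.
apply: (@le_trans _ _ (expR (- (1 / 4)) ^+ k.+1)).
  rewrite lerXn2r ?nnegrE ?expR_ge0 //; apply: le_trans h34 _.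
  by apply: le_trans (expR_ge1Dx _); lra.
rewrite -expRM_natl.
have : expR (k.+1%:R * - (1 / 4)) <= expR (1 / 4) * expR (- S).
  rewrite -expRD ler_expR; rewrite -[k.+2%:R]natr1 in n2.
  by move: (k.+1%:R) n2 => y hy; lra.
move=> /le_trans; apply; rewrite ler_wpM2r ?expR_ge0 //.
have : 1 + - (1 / 4) <= expR (- (1 / 4)) :> R by exact: expR_ge1Dx.
have e0 := expR_gt0 (1 / 4 : R).
have : expR (1 / 4) * expR (- (1 / 4)) = 1 :> R by rewrite -expRD subrr expR0.
nra.
Qed.

End OrthantTails.

(** * Exponential moments for small coefficients *)

Section ExponentialMoments.
Context {R : realType}.

(** With [u = expR (y / 2)] and [v = expR (- y / 2)], [cosh y - 1] equals [(u - v) ^+ 2 / 2], and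
    [u - v <= y * u] for [y >= 0]. *)
Lemma cosh_le (y : R) : (expR y + expR (- y)) / 2 <= 1 + y ^+ 2 * expR `|y| / 2.
Proof.
wlog y0 : y / 0 <= y => [h|].
  have [/h //|/ltW y0] := lerP 0 y.
  by have := h (- y); rewrite oppr_ge0 opprK sqrrN normrN addrC => /(_ y0).
rewrite ger0_norm //; pose a := y / 2; have a0 : 0 <= a by rewrite divr_ge0.
have -> : y = a + a by rewrite /a; field.
rewrite opprD !expRD; set u := expR a; set v := expR (- a).
have uv : u * v = 1 by rewrite -expRD subrr expR0.
have u0 : 0 < u := expR_gt0 _; have v0 : 0 < v := expR_gt0 _.
have h : u - v <= 2 * a * u.
  have : 1 + - (a + a) <= v * v by rewrite -expRD -opprD expR_ge1Dx.
  by move=> /(ler_wpM2l (ltW u0)); nra.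
have vu : v <= u by rewrite ler_expR; lra.
have : (u - v) ^+ 2 <= (2 * a * u) ^+ 2.
  by apply: lerXn2r => //; rewrite nnegrE ?subr_ge0 // !mulr_ge0 // ltW.
nra.
Qed.

Lemma sqr_le_exp (x : R) : 0 <= x -> x ^+ 2 <= 4 * expR x.
Proof.
move=> x0; have h : 1 + x / 2 <= expR (x / 2) by exact: expR_ge1Dx.
have -> : expR x = expR (x / 2) ^+ 2 by rewrite -expRM_natl; congr expR; field.
have : (1 + x / 2) ^+ 2 <= expR (x / 2) ^+ 2.
  by apply: lerXn2r => //; rewrite nnegrE ?expR_ge0 //; lra.
nra.
Qed.

(** Bounds [t ^+ 2 * expR (c * t)] for [j <= t < j.+1] and [0 <= c <= 1 / 256]; here [t] will be
    [|X i| / b i]. *)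
Definition lvl (j : nat) : R := j.+1%:R ^+ 2 * expR (j.+1%:R / 256).

Lemma lvl_ge0 j : 0 <= lvl j.
Proof. by rewrite mulr_ge0 ?expR_ge0 // exprn_ge0. Qed.

(** The square costs [2 ^+ 16 * expR (j.+1 / 128)]; against the decay [1 / 32 = 8 / 256] there
    remains the rate [5 / 256]. The geometric sum is at most [2 ^+ 6], and the shift by one index
    costs at most 2. *)
Lemma sum_lvl_le (M : nat) : \sum_(j < M) lvl j * expR (- (j%:R / 32)) <= 2 ^+ 23.
Proof.
pose q : R := expR (- (5 / 256)).
have q0 : 0 < q := expR_gt0 _.
have q1 : q * (1 + 5 / 256) <= 1.
  have h : 1 + 5 / 256 <= expR (5 / 256) :> R by exact: expR_ge1Dx.
  have := ler_wpM2l (ltW q0) h; by rewrite -expRD addNr expR0.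
have t j : lvl j * expR (- (j%:R / 32)) <= 2 ^+ 17 * q ^+ j.
  have x0 : 0 <= (j.+1%:R / 128 : R) by rewrite divr_ge0.
  have e2 : expR (3 / 256) <= 2 :> R.
    have : 1 + - (3 / 256) <= expR (- (3 / 256)) :> R by exact: expR_ge1Dx.
    have : expR (3 / 256) * expR (- (3 / 256)) = 1 :> R by rewrite -expRD subrr expR0.
    have := expR_gt0 (3 / 256 : R); nra.
  have sq : j.+1%:R ^+ 2 <= 2 ^+ 16 * expR (j.+1%:R / 128) :> R.
    have -> : (2 : R) ^+ 16 = 128 ^+ 2 * 4 by ring.
    rewrite -mulrA; apply: le_trans (ler_wpM2l _ (sqr_le_exp x0)); last by rewrite exprn_ge0.
    by rewrite -exprMn mulrC divfK.
  have -> : lvl j * expR (- (j%:R / 32)) =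
     j.+1%:R ^+ 2 * (expR (j.+1%:R / 256) * expR (- (j%:R / 32))) by rewrite /lvl mulrA.
  apply: (le_trans (ler_wpM2r _ sq)); first by rewrite mulr_ge0 ?expR_ge0.
  have -> : 2 ^+ 16 * expR (j.+1%:R / 128) * (expR (j.+1%:R / 256) * expR (- (j%:R / 32))) =
    2 ^+ 16 * (expR (3 / 256) * q ^+ j).
    rewrite -mulrA; congr (_ * _); rewrite /q -expRM_natl -!expRD; congr expR.
    by rewrite -natr1; field.
  have -> : 2 ^+ 17 * q ^+ j = 2 ^+ 16 * (2 * q ^+ j) by rewrite [2 ^+ 17]exprSr mulrA.
  by rewrite ler_wpM2l ?exprn_ge0 // ler_wpM2r // exprn_ge0 // ltW.
apply: (@le_trans _ _ (\sum_(j < M) 2 ^+ 17 * q ^+ j)); first by apply: ler_sum => j _; exact: t.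
rewrite -mulr_sumr.
have gs : (1 - q) * \sum_(j < M) q ^+ j <= 1.
  have : 0 <= q ^+ M by rewrite exprn_ge0 // ltW.
  by have := subrX1 q M; move: (\sum_(j < M) _) (q ^+ M) => S y h1 h2; lra.
have s0 : 0 <= \sum_(j < M) q ^+ j by apply: sumr_ge0 => j _; rewrite exprn_ge0 // ltW.
have : \sum_(j < M) q ^+ j <= 2 ^+ 6.
  move: (\sum_(j < M) q ^+ j) gs s0 => S gs s0.
  have : 1 / 53 <= 1 - q by lra.
  by move=> /(ler_wpM2r s0); lra.
have p17 : 0 <= (2 : R) ^+ 17 by exact: exprn_ge0.
by move=> h; rewrite (_ : 23 = 17 + 6)%N // exprD; apply: ler_wpM2l.
Qed.

Context {d0 : measure_display} {Omega : measurableType d0}.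
Context (P : probability Omega R) (d : nat) (X : 'I_d -> {RV P >-> R}).
Hypothesis HU : unconditional_vec X.
Hypothesis HL : log_concave_vec X.
Variable b : 'I_d -> R.
Hypothesis bE : forall i, b i = Ex P (fun w => `|X i w|).

Lemma sum_signs_exp (th x : 'I_d -> R) :
  \sum_(e : {ffun 'I_d -> bool}) expR (\sum_i (-1) ^+ e i * (th i * x i)) =
  2 ^+ d * \prod_i ((expR (th i * x i) + expR (- (th i * x i))) / 2).
Proof.
rewrite (eq_bigr (fun e : {ffun 'I_d -> bool} => \prod_i expR ((-1) ^+ e i * (th i * x i)))); last first.
  by move=> e _; rewrite expR_sum.
rewrite -(bigA_distr_bigA (fun i (c : bool) => expR ((-1) ^+ c * (th i * x i)))) /=.
have -> : (2 : R) ^+ d = \prod_(i < d) 2 by rewrite prodr_const card_ord.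
rewrite -big_split; apply: eq_bigr => i _.
by rewrite big_bool /= expr1 expr0 mulN1r mul1r; field.
Qed.

(** Weights and events of a bound for [cosh (th i * X i)]. The constant 1 sits at level 0, whose
    event is everything, so in the expanded product only coordinates at a nonzero level impose a
    tail condition. *)
Let fac (th : 'rV[R]_d) (M : nat) i (a : 'I_M.+1) : R :=
  if a == ord0 then 1 + (th 0 i * b i) ^+ 2 * lvl 0 else (th 0 i * b i) ^+ 2 * lvl a.

Let ev (M : nat) i (a : 'I_M.+1) : set Omega :=
  if a == ord0 then setT else [set w | a%:R * b i <= `|X i w|].

Lemma fac_ge0 th M i a : 0 <= @fac th M i a.
Proof.
rewrite /fac; case: ifP => _; first by rewrite addr_ge0 // mulr_ge0 ?sqr_ge0 ?lvl_ge0.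
by rewrite mulr_ge0 ?sqr_ge0 ?lvl_ge0.
Qed.

Lemma measurable_ev M i a : measurable (@ev M i a).
Proof.
rewrite /ev; case: ifP => _ //; apply: measurable_set_le => //.
exact: measurableT_comp.
Qed.

Lemma cosh_le_levels (th : 'rV[R]_d) M i w : th 0 i = 0 \/ 0 < b i -> `|th 0 i| * b i <= 1 / 256 ->
  (0 < b i -> `|X i w| < M.+1%:R * b i) ->
  (expR (th 0 i * X i w) + expR (- (th 0 i * X i w))) / 2 <=
  \sum_(a < M.+1) fac th i a * \1_(ev i a) w.
Proof.
move=> thb small XM; have term0 (a : 'I_M.+1) : 0 <= fac th i a * \1_(ev i a) w.
  by rewrite mulr_ge0 ?fac_ge0 ?indic_ge0.
have [t0|tN0] := eqVneq (th 0 i) 0.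
  rewrite t0 mul0r oppr0 expR0 (bigD1 ord0) //=; apply: (@le_trans _ _ (fac th i (ord0 : 'I_M.+1) * \1_(ev i (ord0 : 'I_M.+1)) w)).
    by rewrite /fac /ev eqxx indic_in // mulr1 t0 mul0r expr0n /= mul0r addr0; lra.
  by rewrite lerDl; apply: sumr_ge0.
have b0 : 0 < b i by case: thb => // t0; rewrite t0 eqxx in tN0.
set k := th 0 i * b i; set t := `|X i w| / b i.
have t0 : 0 <= t by rewrite divr_ge0 // ltW.
have nk : `|k| <= 1 / 256 by rewrite normrM (gtr0_norm b0).
have tX : t * b i = `|X i w| by rewrite /t divfK // gt_eqF.
have ny : `|th 0 i * X i w| = `|k| * t.
  by rewrite normrM /k normrM (gtr0_norm b0) -mulrA [b i * _]mulrC tX.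
apply: le_trans (cosh_le _) _.
rewrite -(real_normK (num_real (th 0 i * X i w))) ny.
have /andP[j1 j2] := truncn_itv t0; set j := Num.truncn t in j1 j2.
have jM : (j < M.+1)%N.
  rewrite -(ltr_nat R); apply: le_lt_trans j1 _.
  by rewrite -(ltr_pM2r b0) tX; exact: XM.
have lv : t ^+ 2 * expR (`|k| * t) <= lvl j.
  rewrite /lvl; apply: ler_pM; rewrite ?sqr_ge0 ?expR_ge0 //.
    by apply: lerXn2r; rewrite ?nnegrE // ltW.
  rewrite ler_expR; apply: (@le_trans _ _ (1 / 256 * t)); first exact: ler_wpM2r.
  have := ltW j2; lra.
have k20 : 0 <= k ^+ 2 := sqr_ge0 _.
apply: (@le_trans _ _ (1 + k ^+ 2 * lvl j)).
  rewrite lerD2l exprMn real_normK ?num_real //.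
  have h1 : 0 <= t ^+ 2 * expR (`|k| * t) by rewrite mulr_ge0 ?sqr_ge0 ?expR_ge0.
  have := ler_wpM2l k20 lv; have := mulr_ge0 k20 h1; lra.
pose a : 'I_M.+1 := Ordinal jM.
have inev : ev i a w.
  by rewrite /ev; case: ifP => // _; rewrite /= -tX ler_pM2r.
have fa : fac th i a * \1_(ev i a) w = fac th i a by rewrite indic_in // mulr1.
have [a0|aN] := eqVneq a ord0.
  rewrite (bigD1 a) //= fa; apply: (@le_trans _ _ (fac th i a)).
    rewrite /fac a0 eqxx; have -> : j = 0%N by have := congr1 val a0.
    by [].
  by rewrite lerDl; apply: sumr_ge0.
rewrite (bigD1 ord0) //= (bigD1 a) //= fa addrA.
have e0 : fac th i (ord0 : 'I_M.+1) * \1_(ev i (ord0 : 'I_M.+1)) w = 1 + k ^+ 2 * lvl 0.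
  by rewrite /fac /ev eqxx indic_in // mulr1.
rewrite e0 /fac (negbTE aN) /=.
have := mulr_ge0 k20 (lvl_ge0 0).
have : 0 <= \sum_(i0 < M.+1 | (i0 != ord0) && (i0 != a)) (if i0 == ord0 then
  1 + (th 0 i * b i) ^+ 2 * lvl 0 else (th 0 i * b i) ^+ 2 * lvl i0) * \1_(ev i i0) w.
  by apply: sumr_ge0 => c _; exact: term0.
set s := \sum_(i0 < M.+1 | _) _; rewrite -/k; lra.
Qed.

Lemma indic_prod (I : finType) (A : I -> set Omega) w :
  \prod_i \1_(A i) w = \1_[set w | forall i, A i w] w :> R.
Proof.
have [h|h] := pselect (forall i, A i w).
  by rewrite indic_in // big1 // => i _; rewrite indic_in.
rewrite indic_out //; have [i Ai] : exists i, ~ A i w by exact/existsNP.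
by rewrite (bigD1 i) //= indic_out // mul0r.
Qed.

(* Average over signs, bound [cosh] by a combination of indicators of
   [a b_i <= |X i|], and expand the product: the resulting probabilities are
   the joint tails of [pr_all_large_le]. *)
Lemma half_space_exp_bound (th : 'rV[R]_d) (u : R) :
  (forall i, th 0 i = 0 \/ 0 < b i) -> (forall i, `|th 0 i| * b i <= 1 / 256) ->
  pr P (half X th u) <= 3 * expR (- u + 2 ^+ 23 * \sum_i (th 0 i * b i) ^+ 2).
Proof.
move=> thb small; set V := \sum_i _.
have V0 : 0 <= V by apply: sumr_ge0 => i _; exact: sqr_ge0.
pose N w := \sum_i `|X i w| / b i.
have mN : measurable_fun setT N.
  apply: measurable_sum => i; apply: measurable_funM => //; exact: measurableT_comp.
(* Outside [Bad] only finitely many levels occur. [Bad] contributes the 1 in the constant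
   [3 = 1 + 2]; the 2 comes from [pr_all_large_le]. *)
have [M hM] := pr_norm_gt_small P mN (expR_gt0 (- u)).
set Bad := [set w | _] in hM.
have mBad : measurable Bad by apply: measurable_set_lt => //; apply: measurableT_comp.
pose E (f : {ffun 'I_d -> 'I_M.+1}) := [set w | forall i, ev i (f i) w].
have mE f : measurable (E f) by apply: measurable_forall => i; exact: measurable_ev.
pose c (f : {ffun 'I_d -> 'I_M.+1}) := \prod_i fac th i (f i).
have c0 f : 0 <= c f by apply: prodr_ge0 => i _; exact: fac_ge0.
pose F w := \sum_f c f * \1_(E f) w.
have iF : itg P F by apply: itg_sum => f; apply: itgZ; exact: itg_indic.
pose sg (e : {ffun 'I_d -> bool}) i : R := (-1) ^+ e i.
have sgs e i : sg e i = 1 \/ sg e i = -1.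
  by rewrite /sg; case: (e i); [right; rewrite expr1|left; rewrite expr0].
pose H (e : {ffun 'I_d -> bool}) := half X (flip (sg e) th) u.
have mH e : measurable (H e) by exact: measurable_half.
have prH e : pr P (H e) = pr P (half X th u).
  rewrite /H !half_poly -(poly_flip (fun _ : unit => th) (fun=> u) HU (sgs e)) //.
have dE e w : dotv (flip (sg e) th) (rvec X w) = \sum_i (-1) ^+ e i * (th 0 i * X i w).
  by rewrite dotv_rvecE; apply: eq_bigr => i _; rewrite mxE mulrA.
have point w : \sum_e \1_(H e) w <= 2 ^+ d * (\1_Bad w + expR (- u) * F w).
  have card2 : \sum_(e : {ffun 'I_d -> bool}) (1 : R) = 2 ^+ d.
    by rewrite sumr_const card_ffun card_bool card_ord natrX.
  have F0 : 0 <= F w by apply: sumr_ge0 => f _; rewrite mulr_ge0 // indic_ge0.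
  have [bw|nb] := pselect (Bad w).
    apply: (@le_trans _ _ (\sum_(e : {ffun 'I_d -> bool}) 1)).
      by apply: ler_sum => e _; rewrite indicE lern1 leq_b1.
    rewrite card2 indic_in // ler_peMr ?exprn_ge0 // lerDl.
    by rewrite mulr_ge0 // expR_ge0.
  rewrite (indic_out nb) // add0r.
  apply: (@le_trans _ _ (\sum_(e : {ffun 'I_d -> bool})
       expR (- u) * expR (\sum_i (-1) ^+ e i * (th 0 i * X i w)))).
    apply: ler_sum => e _; rewrite -expRD.
    have [he|he] := pselect (H e w); last by rewrite indic_out // expR_ge0.
    rewrite indic_in //; apply: le_trans (expR_ge1Dx _).
    by move: he; rewrite /H /half /= dE; lra.
  rewrite -mulr_sumr (sum_signs_exp (fun i => th 0 i) (fun i => X i w)) mulrCA.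
  rewrite ler_wpM2l ?exprn_ge0 // ler_wpM2l ?expR_ge0 //.
  have -> : F w = \prod_i \sum_(a < M.+1) fac th i a * \1_(ev i a) w.
    rewrite bigA_distr_bigA; apply: eq_bigr => f _.
    by rewrite big_split /= indic_prod.
  apply: ler_prod => i _; apply/andP; split.
    by rewrite divr_ge0 // addr_ge0 // expR_ge0.
  apply: cosh_le_levels => // bi.
  rewrite -ltr_pdivrMr //; move: nb; rewrite /Bad /= => /negP; rewrite -leNgt => nb.
  apply: (@le_lt_trans _ _ M%:R); last by rewrite ltr_nat.
  apply: le_trans nb; rewrite [`|N w|]ger0_norm; last first.
    by apply: sumr_ge0 => j _; rewrite divr_ge0 // bE; apply: Ex_ge0 => w'.
  rewrite /N (bigD1 i) //= lerDl; apply: sumr_ge0 => j _.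
  by rewrite divr_ge0 // bE; apply: Ex_ge0 => w'.
have Ecf f : pr P (E f) * c f <= 2 * \prod_i (fac th i (f i) * expR (- ((f i)%:R / 32))).
  (* A nonzero level at a coordinate with [th 0 i = 0] has weight 0; otherwise [b i > 0] wherever
     the level is nonzero, as the joint tail bound requires. *)
  have [z|nz] := pselect (exists i, (f i != ord0) /\ th 0 i = 0).
    have [i [fi ti]] := z.
    have -> : c f = 0.
      by rewrite /c (bigD1 i) //= /fac (negbTE fi) ti mul0r expr0n /= !mul0r.
    rewrite mulr0 mulr_ge0 //; apply: prodr_ge0 => j _; by rewrite mulr_ge0 ?fac_ge0 ?expR_ge0.
  pose I := [set i | f i != ord0]%SET.
  have bI i : i \in I -> 0 < b i.
    rewrite finset.inE => fi; case: (thb i) => // ti; exfalso; apply: nz; by exists i.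
  have sI i : i \in I -> 0 < (f i)%:R * b i.
    move=> iI; rewrite mulr_gt0 ?bI // ltr0n lt0n.
    by move: iI; rewrite finset.inE; apply: contra => /eqP h; apply/eqP/val_inj.
  have EI : E f = [set w | forall i, i \in I -> (f i)%:R * b i <= `|X i w|].
    apply/seteqP; split => w h i.
      by rewrite finset.inE => fi; have := h i; rewrite /ev (negbTE fi).
    rewrite /ev; case: ifP => // /negbT fi; apply: h; by rewrite finset.inE.
  rewrite mulrC big_split /= -/(c f) mulrCA ler_wpM2l // EI.
  apply: le_trans (pr_all_large_le HU HL bE bI sI) _.
  rewrite ler_pM2l // -expR_sum ler_expR sumrN lerN2.
  rewrite [leLHS](bigID (mem I)) /= [X in _ + X]big1 ?addr0; last first.
    by move=> i; rewrite finset.inE negbK => /eqP ->; rewrite mul0r.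
  apply: ler_sum => i iI; rewrite le_eqVlt; apply/orP; left; apply/eqP.
  by field; rewrite gt_eqF ?bI.
have sumE : \sum_f c f * pr P (E f) <= 2 * expR (2 ^+ 23 * V).
  apply: (@le_trans _ _ (2 * \prod_i \sum_(a < M.+1) (fac th i a * expR (- (a%:R / 32))))).
    rewrite bigA_distr_bigA mulr_sumr; apply: ler_sum => f _; rewrite mulrC; exact: Ecf.
  rewrite ler_pM2l // /V mulr_sumr expR_sum; apply: ler_prod => i _; apply/andP; split.
    by apply: sumr_ge0 => a _; rewrite mulr_ge0 ?fac_ge0 ?expR_ge0.
  apply: le_trans (expR_ge1Dx _).
  have -> : \sum_(a < M.+1) fac th i a * expR (- (a%:R / 32)) =
      1 + (th 0 i * b i) ^+ 2 * \sum_(a < M.+1) lvl a * expR (- (a%:R / 32)).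
    rewrite big_ord_recl [in RHS]big_ord_recl /= /fac eqxx mul0r oppr0 expR0 !mulr1 mulrDr addrA.
    by congr (_ + _); rewrite mulr_sumr; apply: eq_bigr => a _; rewrite -mulrA.
  rewrite lerD2l [X in _ <= X]mulrC ler_wpM2l ?sqr_ge0 //; exact: sum_lvl_le.
have key : 2 ^+ d * pr P (half X th u) <= 2 ^+ d * (expR (- u) + expR (- u) * (2 * expR (2 ^+ 23 * V))).
  have -> : 2 ^+ d * pr P (half X th u) = Ex P (fun w => \sum_e \1_(H e) w).
    rewrite Ex_sum => [|e]; last exact: itg_indic.
    rewrite (eq_bigr (fun=> pr P (half X th u))); last by move=> e _; rewrite Ex_indic // prH.
    by rewrite sumr_const card_ffun card_bool card_ord -[RHS]mulr_natl natrX.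
  have iB : itg P (fun w => \1_Bad w + expR (- u) * F w).
    by apply: itgD; [exact: itg_indic|exact: itgZ].
  apply: le_trans (le_Ex _ _ point) _.
  - by apply: itg_sum => e; exact: itg_indic.
  - exact: itgZ.
  rewrite ExZ // ler_pM2l ?exprn_gt0 // ExD; [|exact: itg_indic|exact: itgZ].
  rewrite Ex_indic // ExZ // lerD // ler_wpM2l ?expR_ge0 //.
  rewrite /F Ex_sum => [|f]; last by apply: itgZ; exact: itg_indic.
  apply: le_trans sumE; apply: ler_sum => f _.
  by rewrite ExZ ?Ex_indic //; exact: itg_indic.
rewrite ler_pM2l ?exprn_gt0 // in key; apply: le_trans key _.
rewrite expRD; have e1 : 1 <= expR (2 ^+ 23 * V).
  by rewrite -[leLHS](@expR0 R) ler_expR mulr_ge0 // exprn_ge0.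
have eu := expR_gt0 (- u).
have := ler_wpM2l (ltW eu) e1; rewrite mulr1; lra.
Qed.

End ExponentialMoments.

(** * Riemann sums on geometric grids *)

Section GeometricGrid.
Context {R : realType}.
Implicit Types (A k a b Y y e : R).

Definition geo A k (i : nat) : R := A * k ^+ i.

Lemma geo_ge0 A k i : 0 <= A -> 0 <= k -> 0 <= geo A k i.
Proof. by move=> A0 k0; rewrite mulr_ge0 ?exprn_ge0. Qed.

Lemma geoS A k i : geo A k i.+1 = k * geo A k i.
Proof. by rewrite /geo exprS mulrCA. Qed.

Lemma geo_le A k i : 0 <= A -> 0 <= k <= 1 -> geo A k i <= A.
Proof. by move=> A0 /andP[k0 k1]; rewrite ler_piMr // exprn_ile1. Qed.

Lemma telescope_iota (c : nat -> R) n : \sum_(i <- iota 0 n) (c i - c i.+1) = c 0%N - c n.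
Proof.
rewrite -{1}(subn0 n) -/(index_iota 0 n); elim: n => [|n IH].
  by rewrite big_geq // subrr.
by rewrite big_nat_recr //= IH; ring.
Qed.

Definition clamp a b y : R := Num.max a (Num.min b y).

(** Cells [[geo A k i.+1, geo A k i]] with right end in [[a, b]] do not overlap and lie in
    [[k * a, b]]; clamping their ends makes the total length telescope. *)
Lemma geo_sum_le A k a b n : 0 <= A -> 0 <= k <= 1 -> 0 <= a -> 0 <= b ->
  \sum_(i <- iota 0 n) (geo A k i - geo A k i.+1) * ((a <= geo A k i <= b)%R)%:R
    <= Num.max 0 (b - k * a).
Proof.
move=> A0 /andP[k0 k1] a0 b0.
apply: (@le_trans _ _ (clamp (k * a) b (geo A k 0) - clamp (k * a) b (geo A k n))).
  rewrite -(telescope_iota (fun i => clamp (k * a) b (geo A k i))); apply: ler_sum => i _.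
  have g0 := geo_ge0 i A0 k0; rewrite geoS; move: (geo A k i) g0 => g g0.
  have kg : k * g <= g by rewrite ler_piMl.
  have le_clamp : clamp (k * a) b (k * g) <= clamp (k * a) b g.
    by rewrite /clamp le_max2 ?lexx // le_min2 ?lexx.
  case: (boolP (a <= g <= b)) => [/andP[ag gb]|_] /=; last by rewrite mulr0 subr_ge0.
  rewrite mulr1 /clamp (min_r gb) min_r ?(le_trans kg) //.
  have kag : k * a <= k * g by rewrite ler_wpM2l.
  by rewrite !max_r ?(le_trans kag).
rewrite /clamp; have h1 (y : R) : k * a <= Num.max (k * a) (Num.min b y) by rewrite le_max lexx.
have h2 : Num.max (k * a) (Num.min b (geo A k 0)) <= Num.max (k * a) b.
  by rewrite le_max2 ?lexx // ge_min lexx.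
apply: (le_trans (lerB h2 (h1 _))).
by rewrite /Num.max; case: ifP; case: ifP; lra.
Qed.

(** The same cells cover the part of [[a, k * b]] above the last grid point. *)
Lemma geo_sum_ge A k a b n : 0 <= A -> 0 <= k <= 1 -> 0 <= a -> 0 <= b -> b <= A ->
  k * b - a - geo A k n <=
  \sum_(i <- iota 0 n) (geo A k i - geo A k i.+1) * ((a <= geo A k i <= b)%R)%:R.
Proof.
move=> A0 /andP[k0 k1] a0 b0 bA.
have kb : k * b <= b by rewrite ler_piMl.
apply: (@le_trans _ _ (clamp a (k * b) (geo A k 0) - clamp a (k * b) (geo A k n))).
  have gA : geo A k 0 = A by rewrite /geo expr0 mulr1.
  have h1 : k * b <= clamp a (k * b) (geo A k 0).
    by rewrite gA /clamp (min_l (le_trans kb bA)) le_max lexx orbT.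
  have h2 : clamp a (k * b) (geo A k n) <= a + geo A k n.
    rewrite /clamp ge_max lerDl geo_ge0 //= ge_min; apply/orP; right.
    by rewrite lerDr.
  lra.
rewrite -(telescope_iota (fun i => clamp a (k * b) (geo A k i))); apply: ler_sum => i _.
have g0 := geo_ge0 i A0 k0; rewrite geoS; move: (geo A k i) g0 => g g0.
have kg : k * g <= g by rewrite ler_piMl.
have [|] := boolP (a <= g <= b) => [/andP[ag gb]|] /=.
  rewrite mulr1 /clamp.
  have kgb : k * g <= k * b by rewrite ler_wpM2l.
  rewrite (min_r kgb); have : Num.max a (Num.min (k * b) g) <= g.
    by rewrite ge_max ag ge_min lexx orbT.
  have : k * g <= Num.max a (k * g) by rewrite le_max lexx orbT.
  lra.
rewrite mulr0 negb_and -!ltNge => /orP[ga|bg]; rewrite /clamp.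
  rewrite !max_l ?subrr // ge_min ?(ltW ga) ?orbT //.
  by rewrite (le_trans kg (ltW ga)) orbT.
rewrite !min_l ?subrr //; first by rewrite ler_wpM2l // ltW.
exact: le_trans kb (ltW bg).
Qed.

(** Counts the signs for which [Y] or [- Y] is within [e] of [y]. For a jointly sign-symmetric
    family, the mean of a product of such factors is a power of 2 times a box probability. *)
Definition psi e Y y : R := ((`|Y - y| <= e)%R)%:R + ((`|Y + y| <= e)%R)%:R.

Lemma psi_ge0 e Y y : 0 <= psi e Y y.
Proof. by rewrite addr_ge0. Qed.

Lemma psi_norm e Y y : psi e Y y = psi e `|Y| y.
Proof.
rewrite /psi; case: (ger0P Y) => // _.
have -> : `|- Y - y| = `|Y + y| by rewrite -opprD normrN.
have -> : `|- Y + y| = `|Y - y| by rewrite addrC distrC.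
by rewrite addrC.
Qed.

Lemma psi_itv e Y y : 0 <= Y -> 0 <= y ->
  psi e Y y = ((Num.max 0 (Y - e) <= y <= Y + e)%R)%:R + ((0 <= y <= e - Y)%R)%:R.
Proof.
move=> Y0 y0; rewrite /psi; congr ((nat_of_bool _)%:R + (nat_of_bool _)%:R).
  rewrite ler_norml ge_max y0 /=.
  by apply/andP/andP => -[h1 h2]; split; lra.
rewrite ger0_norm ?addr_ge0 // y0 /=.
by apply/idP/idP; lra.
Qed.

Lemma geo_sumE A k n (F : R -> R) :
  \sum_(i <- iota 0 n) (geo A k i - geo A k i.+1) * F (geo A k i) =
  (1 - k) * \sum_(i <- iota 0 n) geo A k i * F (geo A k i).
Proof. by rewrite mulr_sumr; apply: eq_bigr => i _; rewrite geoS; ring. Qed.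

(** On [y >= 0], [psi e Y] is the sum of the indicators of two intervals, the second empty when
    [|Y| > e], of total length [2 * e] whatever [Y] is. The Riemann sum is thus near [2 * e],
    uniformly in [Y]. *)
Lemma geo_psi_le e A k Y n : 0 <= e -> 0 <= A -> 0 <= k <= 1 ->
  (1 - k) * \sum_(i <- iota 0 n) geo A k i * psi e Y (geo A k i) <=
  2 * e + (1 - k) * (A + e).
Proof.
move=> e0 A0 k01; have /andP[k0 k1] := k01.
have k1' : 0 <= 1 - k by rewrite subr_ge0.
have Ae : 0 <= (1 - k) * (A + e) by rewrite mulr_ge0 // addr_ge0.
under eq_bigr do rewrite psi_norm.
have : 0 <= `|Y| by []; move: (`|Y|) => {}Y Y0.
have g0 i : 0 <= geo A k i := geo_ge0 i A0 k0.
have [big|sm] := ltP (A + e) Y.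
  rewrite big1 => [|i _]; first by rewrite mulr0; lra.
  have gA := geo_le i A0 k01; rewrite psi_itv //.
  have -> : (Num.max 0 (Y - e) <= geo A k i) = false.
    by rewrite ge_max g0 /=; apply/negbTE; rewrite -ltNge; lra.
  have -> : (geo A k i <= e - Y) = false.
    by apply/negbTE; rewrite -ltNge; have := g0 i; lra.
  by rewrite andbF addr0 mulr0.
rewrite -geo_sumE; under eq_bigr do rewrite psi_itv // mulrDr.
rewrite big_split /=.
have := @geo_sum_le A k (Num.max 0 (Y - e)) (Y + e) n A0 k01.
rewrite le_max lexx => /(_ isT (addr_ge0 Y0 e0)).
have [Ye|Ye] := lerP Y e.
  have := @geo_sum_le A k 0 (e - Y) n A0 k01 (lexx 0).
  rewrite subr_ge0 Ye => /(_ isT).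
  rewrite (max_l (_ : Y - e <= 0)) ?subr_le0 // !mulr0 !subr0 !max_r ?subr_ge0 ?addr_ge0 //.
  move: (\sum_(i <- _) _) (\sum_(i <- _) _) => S1 S2 h1 h2; lra.
rewrite [X in _ -> _ + X <= _]big1 => [|i _]; last first.
  have -> : (geo A k i <= e - Y) = false.
    by apply/negbTE; rewrite -ltNge; have := g0 i; lra.
  by rewrite andbF mulr0.
rewrite addr0 (max_r (_ : 0 <= Y - e)) ?subr_ge0 ?(ltW Ye) //.
move=> /le_trans; apply; rewrite ge_max; apply/andP; split; first lra.
have : (1 - k) * Y <= (1 - k) * (A + e) by rewrite ler_wpM2l.
have : 0 <= (1 - k) * e by rewrite mulr_ge0.
lra.
Qed.

Lemma geo_psi_ge e A k Y n : 0 <= e -> 0 <= A -> 0 <= k <= 1 -> 2 * e <= A -> `|Y| + e <= A ->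
  2 * e - (1 - k) * A - 2 * geo A k n <=
  (1 - k) * \sum_(i <- iota 0 n) geo A k i * psi e Y (geo A k i).
Proof.
move=> e0 A0 k01 eA; have /andP[k0 k1] := k01.
under [X in _ -> _ <= _ * X]eq_bigr do rewrite psi_norm.
have : 0 <= `|Y| by []; move: (`|Y|) => {}Y Y0 YA.
have g0 i : 0 <= geo A k i := geo_ge0 i A0 k0.
rewrite -geo_sumE; under eq_bigr do rewrite psi_itv // mulrDr.
rewrite big_split /=.
have := @geo_sum_ge A k (Num.max 0 (Y - e)) (Y + e) n A0 k01.
rewrite le_max lexx => /(_ isT (addr_ge0 Y0 e0) YA).
have kA : (1 - k) * (Y + e) <= (1 - k) * A by rewrite ler_wpM2l // subr_ge0.
have gn := g0 n.
have [Ye|Ye] := lerP Y e.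
  have eYA : e - Y <= A by lra.
  have eY0 : 0 <= e - Y by rewrite subr_ge0.
  have := @geo_sum_ge A k 0 (e - Y) n A0 k01 (lexx 0) eY0 eYA.
  rewrite (max_l (_ : Y - e <= 0)) ?subr_le0 //.
  have : (1 - k) * (2 * e) <= (1 - k) * A by rewrite ler_wpM2l // subr_ge0.
  move: (\sum_(i <- _) _) (\sum_(i <- _) _) => S1 S2 q1 h1 h2; lra.
rewrite (max_r (_ : 0 <= Y - e)) ?subr_ge0 ?(ltW Ye) //.
have : 0 <= \sum_(i <- iota 0 n) (geo A k i - geo A k i.+1) * ((0 <= geo A k i <= e - Y)%R)%:R.
  apply: sumr_ge0 => i _; rewrite mulr_ge0 // subr_ge0 geoS ler_piMl //.
move: (\sum_(i <- _) _) (\sum_(i <- _) _) => S1 S2 q1 h1; lra.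
Qed.

End GeometricGrid.

(** * Choice of the three grids *)

Section GridParameters.
Context {R : realType}.

Lemma subn_split (a b c : nat) : (a + c <= b)%N ->
  (b - c = a + (b - c - a))%N /\ (b = a + (c + (b - c - a)))%N.
Proof. by lia. Qed.

(** A ratio arbitrarily near 1 for which halving is a whole number of grid steps, so that doubling a
    grid is a shift of its index. *)
Lemma half_root_near1 (t : R) : 0 < t -> exists (s : nat) (u : R),
  [/\ (0 < s)%N, 0 < u, u < 1, u ^+ s = 2^-1 & 1 - u <= t].
Proof.
move=> t0; pose s := (Num.truncn (2 / t)).+1.
have s0 : (0 : R) < s%:R by rewrite ltr0n.
have ln2 : 0 < ln (2 : R) by rewrite ln_gt0 // ltr1n.
exists s, (expR (- (ln 2 / s%:R))); split => //.
- exact: expR_gt0.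
- by rewrite expR_lt1 oppr_lt0 divr_gt0.
- by rewrite -expRM_natl mulrN mulrC divfK ?gt_eqF // expRN lnK // posrE.
- have : (1 : R) + - (ln (2:R) / s%:R) <= expR (- (ln (2:R) / s%:R)). by exact: expR_ge1Dx.
  have : ln 2 / s%:R <= t.
    rewrite ler_pdivrMr //; have : ln (2 : R) < 2 by apply: ln_sublinear; rewrite ltr0n.
    have /andP[_] := truncn_itv (ltW (divr_gt0 (ltr0Sn R 1) t0)).
    by rewrite -/s ltr_pdivrMr // mulrC; lra.
  lra.
Qed.

Lemma exp4_unbounded (c : R) : exists n : nat, c <= 4 ^+ n.
Proof.
have c0 : 0 <= Num.max 0 c by rewrite le_max lexx.
exists (Num.bound (Num.max 0 c)); apply: (@le_trans _ _ (Num.max 0 c)); first by rewrite le_max lexx orbT.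
apply: le_trans (ltW (archi_boundP c0)) _; rewrite -natrX ler_nat.
exact/ltnW/ltn_expl.
Qed.

Lemma exp_half_le2 (x : R) : x <= 1 / 2 -> expR x <= 2.
Proof.
move=> x2; have e0 := expR_gt0 x.
have : 1 + - x <= expR (- x) by exact: expR_ge1Dx.
have : expR x * expR (- x) = 1 by rewrite -expRD subrr expR0.
nra.
Qed.

(* [x], [y], [z] are geometric grids with [z l] about [sqrt (x i * y j)], doubled
   when [y j >= 32 e]: as [x i <= 2 e] it stays below [(x i + y j) / 2], and the
   doubling yields the factor [4]. *)
Lemma grid_parameters (N : nat) (e Rm : R) : 0 < e -> exists (K : nat)
    (x y z p q r : nat -> R) (CF CG CH : R),
  [/\ forall i, 0 <= p i /\ 0 <= q i /\ 0 <= r i,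
   forall i j l, l = (i + j)%N \/ l = (i + j).+1 -> q j = 0 \/
     [/\ p i * q j <= r l ^+ 2, 0 <= z l & z l <= (x i + y j) / 2],
   (forall Y, \sum_(l <- iota 0 (K + K)) r l * psi e Y (z l) <= CH),
   (forall Y, `|Y| <= e -> CF <= \sum_(i <- iota 0 K) p i * psi e Y (x i)) &
   (forall Y, `|Y| <= Rm ->
     CG * (if 40 * e <= `|Y| then 4 else 1) <= \sum_(j <- iota 0 K) q j * psi e Y (y j)) /\
   [/\ 0 < CF, 0 < CG & (CH ^+ 2) ^+ N <= 2 * (4 * (CF * CG)) ^+ N]].
Proof.
move=> e0; pose M := 2 * e; have M0 : 0 < M by rewrite mulr_gt0.
have [J0 hJ0] := exp4_unbounded ((Rm + e) / (16 * M)).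
pose Y0 := 16 * M * 4 ^+ J0; pose Z0 := 8 * M * 2 ^+ J0.
have Y00 : 0 < Y0 by rewrite mulr_gt0 ?exprn_gt0 // mulr_gt0.
have Z00 : 0 < Z0 by rewrite mulr_gt0 ?exprn_gt0 // mulr_gt0.
have RmY : Rm + e <= Y0 by move: hJ0; rewrite ler_pdivrMr ?mulr_gt0 // mulrC.
have p41 : 1 <= (4 : R) ^+ J0 by apply: exprn_ege1; rewrite ler1n.
have MY : M <= Y0 by rewrite /Y0; nra.
(* The relative mesh error enters with the power [N]; [dl] of order [1 / N] keeps
   [(1 + 11 * dl) ^+ N] below 2. *)
pose dl : R := (60 * N%:R + 100)^-1.
have dl0 : 0 < dl by rewrite invr_gt0 ltr_wpDl // mulr_ge0.
have dl1 : dl <= 1 / 100.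
  have n0 : 0 <= (N%:R : R) by [].
  by rewrite div1r lef_pV2 ?posrE; lra.
have dlN : 11 * dl * N%:R <= 1 / 2.
  rewrite mulrAC ler_pdivrMr; last by rewrite ltr_wpDl // mulr_ge0.
  have : 0 <= (N%:R : R) by []; lra.
pose tau := Num.min dl (e * dl / (Y0 + Z0 + e)).
have S0 : 0 < Y0 + Z0 + e by rewrite !addr_gt0.
have tau0 : 0 < tau by rewrite lt_min dl0 divr_gt0 ?mulr_gt0.
have [s [u [s0 u0 u1 us ut]]] := half_root_near1 tau0.
have ud : 1 - u <= dl by apply: le_trans ut _; rewrite ge_min lexx.
have uS : (1 - u) * (Y0 + Z0 + e) <= e * dl.
  by rewrite -ler_pdivlMr //; apply: le_trans ut _; rewrite ge_min lexx orbT.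
have u1' : 0 < 1 - u by rewrite subr_gt0.
have uY : (1 - u) * Y0 <= e * dl by nra.
have uZ : (1 - u) * (Z0 + e) <= e * dl by nra.
have k01 : 0 <= u <= 1 by rewrite !ltW.
pose k := u ^+ 2.
have k02 : 0 <= k <= 1 by rewrite exprn_ge0 ?exprn_ile1 // ltW.
have kE : 1 - k = (1 - u) * (1 + u) by rewrite /k; ring.
have k1 : 0 < 1 - k by rewrite kE mulr_gt0 // addr_gt0.
have ks : k ^+ s = 4^-1 by rewrite /k -exprM mulnC exprM us; field.
have [K1 hK1] := exp4_unbounded (Y0 / (e * dl)).
have ed0 : 0 < e * dl by rewrite mulr_gt0.
(* After [J] steps [yy] has come down to [16 * M = 32 * e]; after [K] steps the remainders are below
   [e * dl]. *)
pose K0 := (J0 + K1).+1; pose J := (s * J0)%N; pose K := (s * K0)%N.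
have JsK : (J + s <= K)%N by rewrite /J /K -mulnSr leq_mul2l ltnS leq_addr orbT.
pose yy := geo Y0 k; pose x := geo M k; pose z := geo Z0 u.
have kpow (n : nat) : k ^+ (s * n) = (4 ^+ n)^-1 by rewrite exprM ks exprVn.
have K4 : (4 : R) ^+ K1 <= 4 ^+ (J0 + K1).
  by rewrite exprD ler_peMl // exprn_ge0.
have endY : yy (K - s)%N <= e * dl.
  rewrite /yy /geo; have -> : (K - s)%N = (s * (J0 + K1))%N by rewrite /K mulnS addKn.
  rewrite kpow ler_pdivrMr ?exprn_gt0 // mulrC -ler_pdivrMr //.
  exact: le_trans hK1 K4.
have endX : x K <= e * dl.
  rewrite /x /geo kpow ler_pdivrMr ?exprn_gt0 //; apply: (le_trans MY).
  rewrite mulrC -ler_pdivrMr //; apply: le_trans hK1 (le_trans K4 _).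
  by rewrite [leRHS]exprS ler_peMl ?exprn_ge0 // ler1n.
(* Always [z (i + j) ^+ 2 = 4 * (x i * yy j)]. Past [J] the index of [yy] is delayed by [s], over
   which [yy] loses the factor 4, so the same grid [z] becomes the undoubled geometric mean. In the
   gap of [s] indices the weight [q] is 0. *)
pose y j := if (j < J)%N then yy j else yy (j - s)%N.
pose q j := if (j < J)%N then 4 * yy j else if (j < J + s)%N then 0 else yy (j - s)%N.
have yy0 j : 0 <= yy j by apply: geo_ge0; rewrite ?(ltW Y00) //; case/andP: k02.
have x0 j : 0 <= x j by apply: geo_ge0; rewrite ?(ltW M0) //; case/andP: k02.
have z0 j : 0 <= z j by apply: geo_ge0; exact: ltW.
pose CFG := 2 * e * (1 - 2 * dl) / (1 - k).
have CFG0 : 0 < CFG by rewrite divr_gt0 // mulr_gt0 ?mulr_gt0 //; lra.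
exists K, x, y, z, x, q, (fun l => z l / u), CFG, CFG, (2 * e * (1 + dl) / (u * (1 - u))).
have zsq i j : z (i + j)%N ^+ 2 = 4 * (x i * yy j).
  have Z02 : Z0 ^+ 2 = 64 * (M * M) * 4 ^+ J0.
    rewrite (_ : 4 = 2 ^+ 2 :> R); last by ring.
    by rewrite -exprM mulnC exprM /Z0; ring.
  have uk : (u ^+ (i + j)) ^+ 2 = k ^+ i * k ^+ j by rewrite -exprD /k -!exprM mulnC.
  rewrite /z /x /yy /geo [LHS]exprMn uk Z02 /Y0.
  by generalize (k ^+ i) (k ^+ j) M ((4 : R) ^+ J0) => a b c f; ring.
have zle l : z l.+1 <= z l by rewrite /z geoS ler_piMl // ltW.
have zu l : z l <= z l / u by rewrite ler_pdivlMr // ler_piMr // ltW.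
split.
- move=> i; split=> //; split; last by rewrite divr_ge0 // ltW.
  by rewrite /q; case: ifP => _; [rewrite mulr_ge0|case: ifP].
- move=> i j l lij.
  have zll : 0 <= z l <= z (i + j)%N by rewrite z0; case: lij => ->; rewrite ?lexx ?zle.
  have rl : z (i + j)%N ^+ 2 <= (z l / u) ^+ 2.
    apply: lerXn2r; rewrite ?nnegrE ?divr_ge0 ?(ltW u0) //.
    by case: lij => ->; [exact: zu|rewrite /z geoS mulrAC divff ?mul1r // gt_eqF].
  have xM : x i <= M by apply: geo_le; rewrite ?(ltW M0).
  rewrite /q /y; case: ltnP => jJ.
    right; have /andP[z1 z2] := zll; split => //.
      by apply: le_trans rl; rewrite zsq mulrCA.
    have yM : 16 * M <= yy j.
      rewrite /yy /geo /Y0 -mulrA ler_peMr //; first by rewrite mulr_ge0 // ltW.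
      rewrite -ler_pdivrMl ?exprn_gt0 // mulr1 -kpow.
      by apply: ler_wiXn2l; [case/andP: k02..|exact: ltnW].
    apply: le_trans z2 _; rewrite -(@ler_pXn2r _ 2) ?nnegrE ?divr_ge0 ?addr_ge0 // zsq.
    have := x0 i; move: (x i) (yy j) xM yM => a b aM bM a0; nra.
  case: ltnP => jJs; [by left|right]; have /andP[z1 z2] := zll.
  have sj : (s <= j)%N by apply: leq_trans jJs; exact: leq_addl.
  have zs : z (i + j)%N ^+ 2 = x i * yy (j - s)%N.
    rewrite zsq; have -> : yy j = 4^-1 * yy (j - s)%N.
      by rewrite /yy /geo -{1}(subnKC sj) exprD ks mulrCA.
    by field.
  split => //; first by rewrite -zs.
  apply: le_trans z2 _; rewrite -(@ler_pXn2r _ 2) ?nnegrE ?divr_ge0 ?addr_ge0 // zs.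
  by have := sqr_ge0 (x i - yy (j - s)%N); lra.
- move=> Y; have := @geo_psi_le R e Z0 u Y (K + K) (ltW e0) (ltW Z00) k01.
  rewrite -/z => h.
  rewrite (eq_bigr (fun l => u^-1 * (z l * psi e Y (z l)))); last first.
    by move=> l _; rewrite mulrA [u^-1 * _]mulrC.
  rewrite -mulr_sumr ler_pdivlMr ?mulr_gt0 //.
  rewrite mulrACA mulVf ?gt_eqF // mul1r mulrC; apply: le_trans h _.
  by lra.
- move=> Y Ye; have := @geo_psi_ge R e M k Y K (ltW e0) (ltW M0) k02 (lexx _).
  rewrite -/x => h; rewrite ler_pdivrMr // [X in _ <= X]mulrC; apply: le_trans (h _); last by rewrite /M; lra.
  have : (1 - k) * M <= 2 * (e * dl) by rewrite kE; nra.
  lra.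
- split; last split => //.
    move=> Y YR.
    have h := @geo_psi_ge R e Y0 k Y (K - s) (ltW e0) (ltW Y00) k02 MY.
    have {}h : CFG <= \sum_(i <- iota 0 (K - s)) yy i * psi e Y (yy i).
      rewrite ler_pdivrMr // [X in _ <= X]mulrC; apply: le_trans (h _); last by lra.
      have : (1 - k) * Y0 <= 2 * (e * dl) by rewrite kE; nra.
      rewrite -/yy; lra.
    have [KsE KE] := subn_split JsK.
    have q1 : \sum_(j <- iota 0 J) q j * psi e Y (y j) = \sum_(j <- iota 0 J) 4 * (yy j * psi e Y (yy j)).
      by apply: eq_big_seq => j; rewrite mem_iota /= add0n /q /y => ->; rewrite mulrA.
    have q2 : \sum_(j <- iota J s) q j * psi e Y (y j) = 0.
      rewrite big_seq big1 // => j; rewrite mem_iota /q => /andP[h1 h2].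
      by rewrite ltnNge h1 h2 /= mul0r.
    have q3 : \sum_(j <- iota (J + s) (K - s - J)) q j * psi e Y (y j) =
        \sum_(j <- iota J (K - s - J)) yy j * psi e Y (yy j).
      rewrite addnC iotaDl big_map; apply: eq_big_seq => j; rewrite mem_iota => /andP[h1 _].
      rewrite /q /y; have -> : (s + j < J)%N = false by rewrite ltnNge (leq_trans h1 (leq_addl s j)).
      have -> : (s + j < J + s)%N = false by rewrite addnC ltn_add2r ltnNge h1.
      by rewrite addKn.
    rewrite {1}KE !iotaD !big_cat /= add0n q1 q2 q3 add0r.
    rewrite KsE iotaD big_cat /= add0n in h.
    have p1 i : 0 <= yy i * psi e Y (yy i) by rewrite mulr_ge0 ?psi_ge0.
    rewrite -mulr_sumr.
    have s1 : 0 <= \sum_(j <- iota 0 J) yy j * psi e Y (yy j) by apply: sumr_ge0.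
    have [Ybig|_] := lerP (40 * e) `|Y|; last by rewrite mulr1; lra.
    suff z3 : \sum_(j <- iota J (K - s - J)) yy j * psi e Y (yy j) = 0 by lra.
    rewrite big_seq big1 // => j; rewrite mem_iota => /andP[Jj _].
    have yM : yy j <= 16 * M.
      rewrite /yy /geo /Y0 -mulrA ler_piMr //; first by rewrite mulr_ge0 // ltW.
      rewrite -ler_pdivlMl ?exprn_gt0 // mulr1 -kpow.
      by apply: ler_wiXn2l; [case/andP: k02..|].
    have y0 := yy0 j.
    rewrite psi_norm /psi; move: (`|Y|) Ybig => Ya Ybig.
    have -> : (`|Ya - yy j| <= e) = false.
      apply/negbTE; rewrite -ltNge; apply: lt_le_trans (ler_norm _).
      by move: yM; rewrite /M; lra.
    have -> : (`|Ya + yy j| <= e) = false.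
      apply/negbTE; rewrite -ltNge; apply: lt_le_trans (ler_norm _).
      lra.
    by rewrite addr0 mulr0.
  (* As [1 - k = (1 - u) * (1 + u)] is nearly [2 * (1 - u)], [CH ^+ 2] nearly equals
     [4 * (CFG * CFG)]: the factor 4 of the discrete inequality is used up exactly. *)
  have step : (2 * e * (1 + dl) / (u * (1 - u))) ^+ 2 <= (1 + 11 * dl) * (4 * (CFG * CFG)).
    have -> : (1 + 11 * dl) * (4 * (CFG * CFG)) =
       (1 + 11 * dl) * (2 * (2 * e * (1 - 2 * dl))) ^+ 2 / (1 - k) ^+ 2.
      by rewrite /CFG; field; rewrite gt_eqF.
    rewrite ler_pdivlMr ?exprn_gt0 // kE.
    have -> : (2 * e * (1 + dl) / (u * (1 - u))) ^+ 2 * ((1 - u) * (1 + u)) ^+ 2 =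
      (2 * e) ^+ 2 * ((1 + dl) * (1 + u) / u) ^+ 2 by field; rewrite ?gt_eqF // ?mulr_gt0.
    have -> : (1 + 11 * dl) * (2 * (2 * e * (1 - 2 * dl))) ^+ 2 =
      (2 * e) ^+ 2 * ((1 + 11 * dl) * (2 * (1 - 2 * dl)) ^+ 2) by ring.
    rewrite ler_pM2l ?exprn_gt0 ?mulr_gt0 //.
    have ul : 1 - dl <= u by lra.
    apply: (@le_trans _ _ (((1 + 5 * dl) * (2 * (1 - 2 * dl))) ^+ 2)).
      apply: lerXn2r; rewrite ?nnegrE.
      + by rewrite divr_ge0 ?mulr_ge0 ?addr_ge0 // ltW.
      + by rewrite !mulr_ge0 //; lra.
      + rewrite ler_pdivrMr //; nra.
    rewrite exprMn ler_wpM2r ?sqr_ge0 //; nra.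
  apply: (@le_trans _ _ (((1 + 11 * dl) * (4 * (CFG * CFG))) ^+ N)).
    apply: lerXn2r => //; rewrite nnegrE; first exact: sqr_ge0.
    by apply: le_trans step; exact: sqr_ge0.
  have c0 : 0 <= 4 * (CFG * CFG) by apply: mulr_ge0 => //; apply: mulr_ge0; exact: ltW.
  rewrite exprMn; apply: (ler_wpM2r (exprn_ge0 N c0)).
  apply: (@le_trans _ _ (expR (11 * dl) ^+ N)).
    apply: lerXn2r; rewrite ?nnegrE ?expR_ge0 ?expR_ge1Dx //.
    by apply: addr_ge0 => //; apply: mulr_ge0 => //; exact: ltW.
  by rewrite -expRM_natl mulrC; exact: exp_half_le2.
Qed.

End GridParameters.

(** * Few large values in a sign-symmetric log-concave family *)

Section LargeCoordinates.
Context {R : realType} {d0 : measure_display} {Omega : measurableType d0}.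
Context (P : probability Omega R) (d : nat) (X : 'I_d -> {RV P >-> R}).
Hypothesis HU : unconditional_vec X.
Hypothesis HL : log_concave_vec X.

Lemma msum_Ex (N K : nat) (Phi : seq nat -> Omega -> R) : (forall s, itg P (Phi s)) ->
  itg P (fun w => msum N K (fun s => Phi s w)) /\
  msum N K (fun s => Ex P (Phi s)) = Ex P (fun w => msum N K (fun s => Phi s w)).
Proof.
elim: N Phi => [|N IH] Phi iPhi /=; first by split.
have h i := IH (fun s => Phi (i :: s)) (fun s => iPhi (i :: s)).
split; first by apply: itg_sum => i; exact: (h i).1.
rewrite Ex_sum => [|i]; last exact: (h i).1.
by apply: eq_bigr => i _; exact: (h i).2.
Qed.

Lemma half_sum_rel_nth s t u k : half_sum_rel s t u -> (k < size s)%N ->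
  (nth 0 u k = nth 0 s k + nth 0 t k \/ nth 0 u k = (nth 0 s k + nth 0 t k).+1)%N.
Proof.
elim: s t u k => [|i s IH] [|j t] [|l u] [|k] //=; first by case.
by case=> _ /IH; apply.
Qed.

Variables (N : nat) (v : 'I_N -> 'rV[R]_d).

(** Sign symmetry of the variables [Y k] in usable form: every change of their signs is induced by a
    coordinate flip of [X]. *)
Definition sign_family := forall sg : 'I_N -> R, (forall k, sg k = 1 \/ sg k = -1) ->
  exists eta : 'I_d -> R, (forall i, eta i = 1 \/ eta i = -1) /\
    forall k, flip eta (v k) = sg k *: v k.

Hypothesis sf : sign_family.
Variable e : R.
Hypothesis e0 : 0 < e.

Let Y k w := dotv (v k) (rvec X w).

Definition box (y : 'I_N -> R) : set Omega := [set w | forall k, `|Y k w - y k| <= e].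

Let bW (j : 'I_N * bool) : 'rV[R]_d := if j.2 then v j.1 else - v j.1.
Let bl (y : 'I_N -> R) (j : 'I_N * bool) : R := (if j.2 then y j.1 else - y j.1) - e.

Lemma box_poly y : box y = poly X bW (bl y).
Proof.
apply/seteqP; split => [w h [k b]|w h k].
  have := h k; rewrite ler_norml => /andP[h1 h2].
  by rewrite /bW /bl /=; case: b; rewrite ?dotvNl -/(Y k w); lra.
have := h (k, true); have := h (k, false); rewrite /bW /bl /= dotvNl -/(Y k w) ler_norml.
by move=> h1 h2; apply/andP; split; lra.
Qed.

Lemma measurable_box y : measurable (box y).
Proof. by rewrite box_poly; exact: measurable_poly. Qed.

Lemma pr_box_sign y (sg : 'I_N -> R) : (forall k, sg k = 1 \/ sg k = -1) ->
  pr P [set w | forall k, `|sg k * Y k w - y k| <= e] = pr P (box y).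
Proof.
move=> sg1; have [eta [eta1 etav]] := sf sg1.
rewrite [in RHS]box_poly -(poly_flip bW (bl y) HU eta1).
have fb k b w : dotv (flip eta (bW (k, b))) (rvec X w) = (if b then sg k * Y k w else - (sg k * Y k w)).
  by rewrite /bW /=; case: b; rewrite ?flipN etav ?dotvNl dotvZl.
congr (pr P _); apply/seteqP; split => [w h [k b]|w h k].
  have := h k; rewrite /= ler_norml => /andP[h1 h2].
  by rewrite fb /bl /=; case: b; lra.
have := h (k, true); have := h (k, false); rewrite !fb /bl /= ler_norml.
by move=> h1 h2; apply/andP; split; lra.
Qed.

Lemma pr_box_flip y (sg : 'I_N -> R) : (forall k, sg k = 1 \/ sg k = -1) ->
  pr P (box (fun k => sg k * y k)) = pr P (box y).
Proof.
move=> sg1; rewrite -(pr_box_sign _ sg1); congr (pr P _); apply/seteqP.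
split => w h k; have := h k; rewrite -mulrBr normrM.
  by case: (sg1 k) => ->; rewrite ?normrN normr1 mul1r.
by move=> h1; case: (sg1 k) => ->; rewrite ?normrN normr1 mul1r.
Qed.

Lemma pr_box_mid x y : pr P (box x) * pr P (box y) <= pr P (box (fun k => (x k + y k) / 2)) ^+ 2.
Proof.
rewrite !box_poly; apply: le_trans (pr_poly_mid HL _ _ _) _.
suff -> : (fun j => (bl x j + bl y j) / 2) = bl (fun k => (x k + y k) / 2) by [].
by apply: funext => -[k b]; rewrite /bl /=; case: b; field.
Qed.

(** Coordinates move from [y] to [z] one at a time: [z k] is a convex combination of [y k] and
    [- y k], whose boxes are equally likely. *)
Lemma pr_box_mono y z : (forall k, 0 <= z k <= y k) -> pr P (box y) <= pr P (box z).
Proof.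
move=> zy; pose h (I : {set 'I_N}) k := if k \in I then z k else y k.
have -> : z = h [set: 'I_N]%SET by apply: funext => k; rewrite /h finset.in_setT.
elim/set1U_ind: [set: 'I_N]%SET => [|k I kI IH].
  by rewrite (_ : h _ = y) //; apply: funext => k; rewrite /h finset.in_set0.
apply: le_trans IH _.
pose sg i : R := if i == k then -1 else 1.
have sg1 i : sg i = 1 \/ sg i = -1 by rewrite /sg; case: eqP; [right|left].
have /andP[z0 zyk] := zy k.
have [yk0|yk0] := eqVneq (y k) 0.
  suff -> : h (k |: I)%SET = h I by [].
  apply: funext => i; rewrite /h finset.in_setU1; case: eqVneq => //= ->.
  by rewrite (negbTE kI) yk0; apply/le_anti; rewrite z0 -yk0 zyk.
have yk : 0 < y k by rewrite lt_neqAle eq_sym yk0 (le_trans z0).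
pose s := (1 + z k / y k) / 2.
have zr : 0 <= z k / y k <= 1 
  by apply/andP; split; [exact: divr_ge0 z0 (ltW yk)|rewrite ler_pdivrMr // mul1r].
have s01 : 0 <= s <= 1 by case/andP: zr => r0 r1; rewrite /s; apply/andP; split; lra.
have E := pr_box_flip (h I) sg1; rewrite !box_poly in E *.
apply: le_trans (pr_poly_convex HL s01 (esym E)) _.
suff -> : (fun j => s * bl (h I) j + (1 - s) * bl (fun k => sg k * h I k) j) = bl (h (k |: I)%SET) by [].
have sk : s * y k + (1 - s) * - y k = z k by rewrite /s; field; rewrite gt_eqF.
apply: funext => -[i b]; rewrite /bl /= /h /sg finset.in_setU1.
have [->|ik] := eqVneq i k; last by rewrite /= mul1r; case: b; ring.
by rewrite (negbTE kI) /= -sk; case: b; ring.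
Qed.

(** The product expands over sign patterns, and every pattern has the probability of the same
    box. *)
Lemma Ex_prod_psi (y : 'I_N -> R) :
  itg P (fun w => \prod_k psi e (Y k w) (y k)) /\
  Ex P (fun w => \prod_k psi e (Y k w) (y k)) = 2 ^+ N * pr P (box y).
Proof.
pose A (tau : {ffun 'I_N -> bool}) := [set w | forall k, `|(-1) ^+ tau k * Y k w - y k| <= e].
have sg1 (tau : {ffun 'I_N -> bool}) k : (-1 : R) ^+ tau k = 1 \/ (-1 : R) ^+ tau k = -1.
  by case: (tau k); [right; rewrite expr1|left; rewrite expr0].
have mA tau : measurable (A tau).
  apply: measurable_forall => k; apply: measurable_set_le => //.
  have mY : measurable_fun setT (fun w => Y k w) by exact: measurable_dotv.
  have mf : measurable_fun setT (fun w => (-1) ^+ tau k * Y k w - y k).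
    by apply: measurable_funB => //; exact: measurable_funM.
  exact: measurableT_comp.
have E w : \prod_k psi e (Y k w) (y k) = \sum_tau \1_(A tau) w.
  have -> : \prod_k psi e (Y k w) (y k) =
     \prod_k \sum_(b : bool) \1_[set w | `|(-1) ^+ b * Y k w - y k| <= e] w.
    apply: eq_bigr => k _; rewrite big_bool !indic_boolE expr1 expr0 mulN1r mul1r.
    by rewrite -opprD normrN /psi [RHS]addrC.
  rewrite bigA_distr_bigA; apply: eq_bigr => tau _.
  by rewrite (indic_prod (fun k => [set w | `|(-1) ^+ tau k * Y k w - y k| <= e])).
have -> : (fun w => \prod_k psi e (Y k w) (y k)) = fun w => \sum_tau \1_(A tau) w.
  by apply: funext => w; exact: E.
split; first by apply: itg_sum => tau; exact: itg_indic.
rewrite Ex_sum => [|tau]; last exact: itg_indic.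
rewrite (eq_bigr (fun=> pr P (box y))); last first.
  by move=> tau _; rewrite Ex_indic // (pr_box_sign y (sg1 tau)).
by rewrite sumr_const card_ffun card_bool card_ord -[LHS]mulr_natl natrX.
Qed.

Lemma prod_1D_ge (a : 'I_N -> R) : (forall k, 0 <= a k) -> \sum_k a k <= \prod_k (1 + a k).
Proof.
move=> a0; suff [_ h] : 0 <= \sum_k a k /\ 1 + \sum_k a k <= \prod_k (1 + a k).
  by apply: le_trans h; rewrite lerDr.
elim: (index_enum _) => [|k s [IH0 IH1]]; first by rewrite !big_nil addr0.
rewrite !big_cons; split; first by rewrite addr_ge0.
have a0k := a0 k; apply: le_trans (ler_wpM2l (addr_ge0 ler01 a0k) IH1).
by have := mulr_ge0 a0k IH0; lra.
Qed.

(* By Prekopa-Leindler on the grids, the product over [k] of [4] or [1], according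
   as [40 e <= |Y k|] or not, has bounded expectation; it dominates the number
   of large coordinates. *)
Lemma sum_pr_large_coordinates :
  1 / 2 <= pr P (box (fun=> 0)) -> \sum_k pr P (tail X (v k) (40 * e)) <= 5.
Proof.
move=> hB; set B := box _ in hB.
have mY k : measurable_fun setT (fun w => Y k w) by exact: measurable_dotv.
pose Nf w := \sum_k `|Y k w|.
have mNf : measurable_fun setT Nf.
  by apply: measurable_sum => k; exact: measurableT_comp.
have N10 : 0 < (N.+1%:R : R)^-1 by rewrite invr_gt0 ltr0n.
(* The loss [1 / N.+1] is incurred once for each of the [N] coordinates, at most 1 in total: this is
   the step from 4 to 5. *)
have [Rm hRm] := pr_norm_gt_small P mNf N10.
set Bad := [set w | _] in hRm.
have mBad : measurable Bad by apply: measurable_set_lt => //; exact: measurableT_comp.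
have [K [x [y [z [p [q [r [CF [CG [CH [pqr0 grid hH hF [hG [CF0 CG0 CFGH]]]]]]]]]]]]] :=
  @grid_parameters R N e Rm%:R e0.
pose Yn (k : nat) w := oapp (fun k' : 'I_N => Y k' w) 0 (insub k).
have YnE (k : 'I_N) w : Yn k w = Y k w by rewrite /Yn valK.
pose fam (c g : nat -> R) (s : seq nat) w := \prod_(k < N) (c (nth 0%N s k) * psi e (Yn k w) (g (nth 0%N s k))).
have famE c g s w : fam c g s w = (\prod_(k < N) c (nth 0%N s k)) * \prod_(k < N) psi e (Y k w) (g (nth 0%N s k)).
  by rewrite /fam big_split /=; congr (_ * _); apply: eq_bigr => k _; rewrite YnE.
have ifam c g s : itg P (fam c g s).
  have -> : fam c g s = fun w => (\prod_(k < N) c (nth 0%N s k)) * \prod_(k < N) psi e (Y k w) (g (nth 0%N s k)).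
    by apply: funext => w; exact: famE.
  by apply: itgZ; exact: (Ex_prod_psi _).1.
have Efam c g s : Ex P (fam c g s) = (\prod_(k < N) c (nth 0%N s k)) * (2 ^+ N * pr P (box (fun k : 'I_N => g (nth 0%N s k)))).
  rewrite (eq_Ex P (famE c g s)) ExZ; last exact: (Ex_prod_psi _).1.
  by rewrite (Ex_prod_psi (fun k : 'I_N => g (nth 0%N s k))).2.
have prod0 (c : nat -> R) s : (forall i, 0 <= c i) -> 0 <= \prod_(k < N) c (nth 0%N s k).
  by move=> c0; apply: prodr_ge0.
have fam0 c g s : (forall i, 0 <= c i) -> 0 <= Ex P (fam c g s).
  move=> c0; rewrite Efam; apply: mulr_ge0; first exact: prod0.
  by apply: mulr_ge0; [rewrite exprn_ge0|exact: pr_ge0].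
have p0 i : 0 <= p i := (pqr0 i).1.
have q0 i : 0 <= q i := (pqr0 i).2.1.
have r0 i : 0 <= r i := (pqr0 i).2.2.
have PL := @msum_prekopa_leindler R N K (fun s => Ex P (fam p x s))
  (fun s => Ex P (fam q y s)) (fun s => Ex P (fam r z s))
  (fun s => fam0 p x s p0) (fun s => fam0 q y s q0) (fun s => fam0 r z s r0).
have {}PL : 4 ^+ N * (msum N K (fun s => Ex P (fam p x s)) * msum N K (fun s => Ex P (fam q y s)))
   <= msum N (K + K) (fun s => Ex P (fam r z s)) ^+ 2.
  apply: PL => s t u sN stu; rewrite !Efam.
  have rel (k : 'I_N) : (nth 0 u k = nth 0 s k + nth 0 t k \/
      nth 0 u k = (nth 0 s k + nth 0 t k).+1)%N.
    by apply: (half_sum_rel_nth stu); rewrite sN.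
  (* If some index of [t] falls in the gap of the grid, the left side is 0. *)
  have [[k qk]|nq] := pselect (exists k : 'I_N, q (nth 0%N t k) = 0).
    have -> : \prod_(k < N) q (nth 0%N t k) = 0 by rewrite (bigD1 k) //= qk mul0r.
    by rewrite mul0r mulr0 sqr_ge0.
  have g3 (k : 'I_N) : [/\ p (nth 0%N s k) * q (nth 0%N t k) <= r (nth 0%N u k) ^+ 2,
      0 <= z (nth 0%N u k) & z (nth 0%N u k) <= (x (nth 0%N s k) + y (nth 0%N t k)) / 2].
    by have [qk|//] := grid _ _ _ (rel k); case: nq; exists k.
  have pq : (\prod_(k < N) p (nth 0%N s k)) * (\prod_(k < N) q (nth 0%N t k)) <= (\prod_(k < N) r (nth 0%N u k)) ^+ 2.
    rewrite -big_split -prodrXl /=; apply: ler_prod => k _.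
    by have [h1 _ _] := g3 k; rewrite h1 andbT mulr_ge0.
  have bb : pr P (box (fun k : 'I_N => x (nth 0%N s k))) * pr P (box (fun k : 'I_N => y (nth 0%N t k))) <=
      pr P (box (fun k : 'I_N => z (nth 0%N u k))) ^+ 2.
    apply: le_trans (pr_box_mid _ _) _.
    apply: lerXn2r; rewrite ?nnegrE ?pr_ge0 //.
    by apply: pr_box_mono => k; have [_ h1 h2] := g3 k; rewrite h1 h2.
  move: pq bb; move: (prod0 p s p0) (prod0 q t q0) (prod0 r u r0).
  set a1 := \prod_(k < N) p _; set a2 := \prod_(k < N) q _; set a3 := \prod_(k < N) r _.
  move: (pr_ge0 P (box (fun k : 'I_N => x (nth 0%N s k)))) (pr_ge0 P (box (fun k : 'I_N => y (nth 0%N t k)))).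
  set b1 := pr P _; set b2 := pr P _; set b3 := pr P _ => b10 b20 a10 a20 a30 pq bb.
  have -> : a1 * (2 ^+ N * b1) * (a2 * (2 ^+ N * b2)) = (2 ^+ N * 2 ^+ N) * ((a1 * a2) * (b1 * b2)) by ring.
  have -> : (a3 * (2 ^+ N * b3)) ^+ 2 = (2 ^+ N * 2 ^+ N) * (a3 ^+ 2 * b3 ^+ 2) by ring.
  apply: ler_wpM2l; first by rewrite mulr_ge0 ?exprn_ge0.
  by apply: ler_pM => //; exact: mulr_ge0.
have msE (n : nat) c g : msum N n (fun s => Ex P (fam c g s)) =
    Ex P (fun w => \prod_(k < N) \sum_(i <- iota 0 n) c i * psi e (Y k w) (g i)) /\
    itg P (fun w => \prod_(k < N) \sum_(i <- iota 0 n) c i * psi e (Y k w) (g i)).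
  have [h1 h2] := @msum_Ex N n (fun s w => fam c g s w) (ifam c g).
  have E : (fun w => msum N n (fun s => fam c g s w)) =
     fun w => \prod_(k < N) \sum_(i <- iota 0 n) c i * psi e (Y k w) (g i).
    apply: funext => w; rewrite (msum_prod N n (fun k i => c i * psi e (Yn k w) (g i))).
    by apply: eq_bigr => k _; apply: eq_bigr => i _; rewrite YnE.
  by rewrite E in h1 h2; split.
have [EH iH] := msE (K + K)%N r z; have [EF iF] := msE K p x; have [EG iG] := msE K q y.
rewrite EH EF EG in PL.
have sum0 (n : nat) (c g : nat -> R) k w : (forall i, 0 <= c i) ->
    0 <= \sum_(i <- iota 0 n) c i * psi e (Y k w) (g i).
  by move=> c0; apply: sumr_ge0 => i _; rewrite mulr_ge0 ?psi_ge0.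
set eF := Ex P _ in PL; set eG := Ex P _ in PL; set eH := Ex P _ in PL.
have prodc (c : R) : c ^+ N = \prod_(k < N) c by rewrite prodr_const card_ord.
have boundH : eH <= CH ^+ N.
  rewrite -[leRHS](Ex_cst P); apply: le_Ex => // [|w]; first exact: itg_cst.
  rewrite (prodc CH); apply: ler_prod => k _.
  by rewrite hH andbT; exact: sum0.
have eH0 : 0 <= eH by apply: Ex_ge0 => w; apply: prodr_ge0 => k _; exact: sum0.
have mB : measurable B by exact: measurable_box.
have boundF : CF ^+ N * pr P B <= eF.
  rewrite -Ex_indic // -ExZ; last exact: itg_indic.
  apply: le_Ex => // [|w]; first by apply: itgZ; exact: itg_indic.
  have [Bw|nB] := pselect (B w); last first.
    by rewrite indic_out // mulr0; apply: prodr_ge0 => k _; exact: sum0.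
  rewrite indic_in // mulr1 (prodc CF); apply: ler_prod => k _.
  rewrite ltW //=; apply: hF; have := Bw k; by rewrite subr0.
pose Zg w := \sum_k \1_(tail X (v k) (40 * e) `\` Bad) w : R.
have mT k : measurable (tail X (v k) (40 * e) `\` Bad).
  by apply: measurableD => //; exact: measurable_tail.
have iZ : itg P Zg by apply: itg_sum => k; exact: itg_indic.
have boundG : CG ^+ N * Ex P Zg <= eG.
  rewrite -ExZ //; apply: le_Ex => // [|w]; first exact: itgZ.
  have [Bw|nB] := pselect (Bad w).
    rewrite /Zg big1 => [|k _]; last by rewrite indic_out // => -[].
    by rewrite mulr0; apply: prodr_ge0 => k _; exact: sum0.
  pose a k : R := \1_(tail X (v k) (40 * e) `\` Bad) w.
  apply: (@le_trans _ _ (CG ^+ N * \prod_k (1 + a k))).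
    rewrite ler_wpM2l ?exprn_ge0 ?(ltW CG0) //; apply: prod_1D_ge => k; exact: indic_ge0.
  rewrite (prodc CG) -big_split /=; apply: ler_prod => k _.
  have ak0 : 0 <= a k by exact: indic_ge0.
  rewrite mulr_ge0 ?addr_ge0 ?(ltW CG0) //=.
  have Yk : `|Y k w| <= Rm%:R.
    move: nB; rewrite /Bad /= => /negP; rewrite -leNgt; apply: le_trans.
    rewrite [leRHS]ger0_norm; last by apply: sumr_ge0.
    by rewrite /Nf (bigD1 k) //= lerDl; apply: sumr_ge0.
  apply: le_trans (hG _ Yk); rewrite ler_pM2l // /a.
  have [big|sm] := lerP (40 * e) `|Y k w|.
    by rewrite indicE; case: (w \in _); rewrite /= ?mulr1n ?mulr0n; lra.
  rewrite indic_out ?addr0 // => -[h _]; move: h; rewrite /tail /= -/(Y k w).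
  by rewrite leNgt sm.
have EZ0 : 0 <= Ex P Zg by apply: Ex_ge0 => w; apply: sumr_ge0 => k _; exact: indic_ge0.
(* The N-th powers cancel; one factor 2 comes from the grids, the other from [pr P B >= 1 / 2]. *)
have EZ4 : Ex P Zg <= 4.
  have c0 : 0 < 4 ^+ N * (CF ^+ N * CG ^+ N) by rewrite !mulr_gt0 ?exprn_gt0.
  have h1 : 4 ^+ N * ((CF ^+ N * pr P B) * (CG ^+ N * Ex P Zg)) <= (CH ^+ 2) ^+ N.
    apply: (@le_trans _ _ (4 ^+ N * (eF * eG))).
      rewrite ler_wpM2l ?exprn_ge0 //; apply: ler_pM => //.
        by rewrite mulr_ge0 ?pr_ge0 ?exprn_ge0 // ltW.
      by rewrite mulr_ge0 ?exprn_ge0 // ltW.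
    apply: le_trans PL _; rewrite exprAC; apply: lerXn2r; rewrite ?nnegrE //.
    exact: le_trans boundH.
  have := le_trans h1 CFGH; rewrite !exprMn.
  have -> : 4 ^+ N * (CF ^+ N * pr P B * (CG ^+ N * Ex P Zg)) =
     4 ^+ N * (CF ^+ N * CG ^+ N) * (pr P B * Ex P Zg) by ring.
  rewrite [X in _ <= X]mulrC ler_pM2l //.
  have := ler_wpM2r EZ0 hB; lra.
have : \sum_k pr P (tail X (v k) (40 * e)) <= Ex P Zg + \sum_(k < N) pr P Bad.
  rewrite /Zg Ex_sum => [|k]; last exact: itg_indic.
  rewrite -big_split /=; apply: ler_sum => k _; rewrite Ex_indic //.
  apply: le_trans (pr_setU_le P (mT k) mBad); apply: le_pr.
  - exact: measurable_tail.
  - exact: measurableU.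
  - by move=> w tw; have [bw|nb] := pselect (Bad w); [right|left].
rewrite sumr_const card_ord -[pr P Bad *+ N]mulr_natl.
have : N%:R * pr P Bad <= 1.
  apply: (@le_trans _ _ (N%:R * (N.+1%:R)^-1)); first by rewrite ler_wpM2l.
  by rewrite ler_pdivrMr ?ltr0n // mul1r ler_nat.
lra.
Qed.

End LargeCoordinates.

(** * Symmetrization and comparison with a Rademacher process *)

Section Symmetrization.
Context {R : realType} {d0 : measure_display} {Omega : measurableType d0}.
Context (P : probability Omega R).

Lemma Ex_eq_of_law (f g : Omega -> R) : measurable_fun setT f -> measurable_fun setT g ->
  (forall w, 0 <= f w) -> (forall w, 0 <= g w) ->
  (forall r, pr P [set w | f w <= r] = pr P [set w | g w <= r]) -> Ex P f = Ex P g.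
Proof.
move=> mf mg f0 g0 fg.
pose F : {RV P >-> R} := HB.pack f (isMeasurableFun.Build _ _ _ _ f mf).
pose G : {RV P >-> R} := HB.pack g (isMeasurableFun.Build _ _ _ _ g mg).
have EF := @ge0_expectation_ccdf _ _ _ P F f0.
have EG := @ge0_expectation_ccdf _ _ _ P G g0.
rewrite /Ex /Rintegral; congr fine.
rewrite !expectation_def in EF EG; rewrite [LHS]EF [RHS]EG.
apply: eq_integral => r _; rewrite /ccdf /distribution /pushforward /=.
have E (h : Omega -> R) (mh : measurable_fun setT h) :
    P (h @^-1` `]r, +oo[) = (1 - pr P [set w | h w <= r])%:E.
  have ml : measurable [set w | h w <= r] by exact: measurable_set_le.
  rewrite -prC // -prE; last exact: measurableC.
  by congr (P _); apply/seteqP; split => w; rewrite /= in_itv /= andbT ltNge => /negP.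
by rewrite !E // fg.
Qed.

Context (d : nat) (X : 'I_d -> {RV P >-> R}).
Hypothesis HU : unconditional_vec X.
Hypothesis HL : log_concave_vec X.
Variables (I : finType) (i0 : I).

Lemma measurable_mx (f : I -> Omega -> R) : (forall i, measurable_fun setT (f i)) ->
  measurable_fun setT (fun w => mx i0 (fun i => f i w)).
Proof.
move=> mf; rewrite /mx; elim: (index_enum I) => [|i s IH].
  by under eq_fun do [rewrite big_nil]; exact: mf.
under eq_fun do rewrite big_cons.
exact: measurable_maxr.
Qed.

Lemma itg_mx (f : I -> Omega -> R) : (forall i, itg P (f i)) -> itg P (fun w => mx i0 (fun i => f i w)).
Proof.
move=> fi; have is_ : itg P (fun w => \sum_i `|f i w|) by apply: itg_sum => i; exact: itg_norm.
apply: itg_le is_; first by apply: measurable_mx => i; exact: itg_meas.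
move=> w; have [i ->] := mx_attained i0 (fun i => f i w).
by rewrite (bigD1 i) //= lerDl; apply: sumr_ge0.
Qed.

Definition Emax (x : I -> 'rV[R]_d) : R :=
  Ex P (fun w => mx i0 (fun i => dotv (x i) (rvec X w))).

(** With [x i0 = 0] the maximum is nonnegative, so its mean is determined by its distribution
    function; its sublevel sets are polyhedra, on which flips act. *)
Lemma Emax_flip (x : I -> 'rV[R]_d) (eta : 'I_d -> R) : x i0 = 0 ->
  (forall i, eta i = 1 \/ eta i = -1) -> Emax (fun i => flip eta (x i)) = Emax x.
Proof.
move=> x0 eta1.
have nn (y : I -> 'rV[R]_d) w : y i0 = 0 -> 0 <= mx i0 (fun i => dotv (y i) (rvec X w)).
  by move=> y0; apply: le_trans (le_mx i0 _ i0); rewrite y0 dotv0.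
apply: Ex_eq_of_law.
- by apply: measurable_mx => i; exact: measurable_dotv.
- by apply: measurable_mx => i; exact: measurable_dotv.
- by move=> w; apply: nn; rewrite x0 flip0.
- by move=> w; exact: nn.
move=> r.
have E (y : I -> 'rV[R]_d) : [set w | mx i0 (fun i => dotv (y i) (rvec X w)) <= r] =
    poly X (fun i => - y i) (fun=> - r).
  apply/seteqP; split => w.
    by move=> /mx_leP h i; rewrite dotvNl lerN2.
  by move=> h; apply/mx_leP => i; have := h i; rewrite dotvNl lerN2.
rewrite !E -(poly_flip (fun i => - x i) _ HU eta1).
by congr (pr P (poly _ _ _)); apply: funext => i; rewrite flipN.
Qed.

Definition ext (f : 'I_d -> R) (k : nat) : R := oapp f 0 (insub k).

Lemma ext_ord f (k : 'I_d) : ext f k = f k.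
Proof. by rewrite /ext valK. Qed.

Lemma rdotE e (f : nat -> R) : rdot e f = \sum_(k < size e) nth 0 e k * f k.
Proof.
elim: e f => [|a e IH] f /=; first by rewrite big_ord0.
by rewrite big_ord_recl IH.
Qed.

Lemma rdot_ext e f : size e = d -> rdot e (ext f) = \sum_(k < d) nth 0 e k * f k.
Proof.
move=> ed; rewrite rdotE ed; apply: eq_bigr => k _; by rewrite ext_ord.
Qed.

Lemma signs_nth N (e : seq R) k : signs N e -> (k < N)%N -> nth 0 e k = 1 \/ nth 0 e k = -1.
Proof.
elim: N e k => [|N IH] [|a e] [|k] //=; last by move=> [_ /IH h]; exact: h.
move=> [a1 _] _; have /eqP := a1; rewrite eqr_norml ler01 andbT => /orP[/eqP|/eqP]; by [left|right].
Qed.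

Lemma ravg_itg N (F : seq R -> Omega -> R) : (forall e, itg P (F e)) ->
  itg P (fun w => ravg N (fun e => F e w)) /\
  Ex P (fun w => ravg N (fun e => F e w)) = ravg N (fun e => Ex P (F e)).
Proof.
elim: N F => [|N IH] F iF //=.
have [i1 E1] := IH (fun e => F (1 :: e)) (fun e => iF _).
have [i2 E2] := IH (fun e => F (- 1 :: e)) (fun e => iF _).
have i3 := itgD i1 i2.
have e1 : (fun w => (ravg N (fun e => F (1 :: e) w) + ravg N (fun e => F (- 1 :: e) w)) / 2) =
  fun w => 2^-1 * (ravg N (fun e => F (1 :: e) w) + ravg N (fun e => F (- 1 :: e) w)).
  by apply: funext => w; rewrite mulrC.
rewrite e1; split; first exact: itgZ.
by rewrite ExZ // ExD // E1 E2 mulrC.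
Qed.

Let cn (t : 'rV[R]_d) w := ext (fun k => t 0 k * X k w).
Let an (t : 'rV[R]_d) w := ext (fun k => t 0 k * `|X k w|).

Let itg_rdot_coord e (f : 'I_d -> Omega -> R) : (forall k, itg P (f k)) ->
  itg P (fun w => rdot e (ext (fun k => f k w))).
Proof.
move=> fi; under eq_fun do rewrite rdotE.
have h : itg P (fun w => \sum_(k < size e) nth 0 e k * ext (fun k => f k w) k).
  apply: itg_sum => k; apply: itgZ; rewrite /ext; case: insub => [k'|] /=; first exact: fi.
  exact: itg_cst.
exact: h.
Qed.

(** All flips give the same mean, hence so does their average; given [X], what is averaged is a
    Rademacher process, open to the contraction lemmas. *)
Lemma Emax_ravg (x : I -> 'rV[R]_d) : x i0 = 0 ->
  itg P (fun w => ravg d (fun e => mx i0 (fun i => rdot e (cn (x i) w)))) /\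
  Emax x = Ex P (fun w => ravg d (fun e => mx i0 (fun i => rdot e (cn (x i) w)))).
Proof.
move=> x0.
have ie e : itg P (fun w => mx i0 (fun i => rdot e (cn (x i) w))).
  apply: itg_mx => i; apply: itg_rdot_coord => k; apply: itgZ; exact: (itg_coord HU HL).
have [h ->] := ravg_itg d ie; split => //.
have key e : signs d e -> Emax x = Ex P (fun w => mx i0 (fun i => rdot e (cn (x i) w))).
  move=> ed; rewrite -(@Emax_flip x (fun k => nth 0 e k) x0) => [|k]; last exact: (signs_nth ed).
  apply: eq_Ex => w; congr mx; apply: funext => i.
  rewrite dotv_rvecE rdot_ext ?(signs_size ed) //; apply: eq_bigr => k _; by rewrite mxE mulrA.
rewrite -[LHS](ravg_cst d); apply/le_anti/andP; split; apply: le_ravg_signs => e /key E.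
  by rewrite -E.
by rewrite -E.
Qed.

Lemma Emax_contraction (x z : I -> 'rV[R]_d) : x i0 = 0 -> z i0 = 0 ->
  (forall k i j, `|z i 0 k - z j 0 k| <= `|x i 0 k - x j 0 k|) -> Emax z <= Emax x.
Proof.
move=> x0 z0 zx; have [ix ->] := Emax_ravg x0; have [iz ->] := Emax_ravg z0.
apply: le_Ex => // w.
have add0 (f : I -> seq R -> R) : ravg d (fun e => mx i0 (fun i => f i e)) =
    ravg d (fun e => mx i0 (fun i => 0 + f i e)).
  by apply: eq_ravg => e; congr mx; apply: funext => i; rewrite add0r.
rewrite (add0 (fun i e => rdot e (cn (z i) w))) (add0 (fun i e => rdot e (cn (x i) w))).
apply: ravg_contraction => k i j; rewrite /cn /ext; case: insub => [k'|] /=; last by [].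
by rewrite -!mulrBl !normrM ler_wpM2r.
Qed.

Variable b : 'I_d -> R.
Hypothesis bE : forall i, b i = Ex P (fun w => `|X i w|).

(** Contraction removes the sign of [X k], since [|X k|] and [X k] have coefficients of equal
    variation; Jensen then replaces [|X k|] by its mean. *)
Lemma rademacher_le_Emax (x : I -> 'rV[R]_d) : x i0 = 0 ->
  ravg d (fun e => mx i0 (fun i => rdot e (ext (fun k => x i 0 k * b k)))) <= Emax x.
Proof.
move=> x0; have [ix ->] := Emax_ravg x0.
have iabs i k : itg P (fun w => x i 0 k * `|X k w|).
  by apply: itgZ; apply: itg_norm; exact: (itg_coord HU HL).
have ird e i : itg P (fun w => rdot e (an (x i) w)) by exact: itg_rdot_coord.
have ie e : itg P (fun w => mx i0 (fun i => rdot e (an (x i) w))) by exact: itg_mx.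
have [h hE] := ravg_itg d ie.
apply: (@le_trans _ _ (Ex P (fun w => ravg d (fun e => mx i0 (fun i => rdot e (an (x i) w)))))).
  rewrite hE; apply: le_ravg => e ed; apply/mx_leP => i.
  apply: (@le_trans _ _ (Ex P (fun w => rdot e (an (x i) w)))); last first.
    by apply: le_Ex => // w; exact: (le_mx i0 (fun i => rdot e (an (x i) w))).
  rewrite rdot_ext // le_eqVlt; apply/orP; left; apply/eqP.
  have -> : (fun w => rdot e (an (x i) w)) = fun w => \sum_(k < d) nth 0 e k * (x i 0 k * `|X k w|).
    by apply: funext => w; rewrite rdot_ext.
  rewrite Ex_sum => [|k]; last by apply: itgZ.
  apply: eq_bigr => k _; rewrite ExZ // ExZ ?bE //.
  by apply: itg_norm; exact: (itg_coord HU HL).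
apply: le_Ex => // w.
have add0 (f : I -> seq R -> R) : ravg d (fun e => mx i0 (fun i => f i e)) =
    ravg d (fun e => mx i0 (fun i => 0 + f i e)).
  by apply: eq_ravg => e; congr mx; apply: funext => i; rewrite add0r.
rewrite (add0 (fun i e => rdot e (an (x i) w))) (add0 (fun i e => rdot e (cn (x i) w))).
apply: ravg_contraction => k i j; rewrite /cn /an /ext; case: insub => [k'|] /=; last by [].
by rewrite -!mulrBl !normrM normr_id.
Qed.

End Symmetrization.

(** * Chopping a coordinate into layers of height a *)

Section Chopping.
Context {R : realType}.
Variables (a : R) (Q0 : nat).
Hypothesis a0 : 0 < a.

Let c (l : nat) : R := (l%:R - Q0%:R) * a.

(** The part of [y] falling in the cell from [c l] to [c l.+1]; the layers add up to a clamped [y]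
    minus the constant [c 0]. *)
Definition layer (l : nat) (y : R) : R := Num.min y (c l.+1) - Num.min y (c l).

Lemma c_S l : c l.+1 = c l + a.
Proof. by rewrite /c -natr1; ring. Qed.

Lemma layer_itv l y : 0 <= layer l y <= a.
Proof.
rewrite /layer c_S !minElt; move: (c l) a0 => z h3.
by case: ltP => h1; case: ltP => h2; apply/andP; split; lra.
Qed.

Lemma layer_mono l x y : y <= x -> layer l y <= layer l x.
Proof.
rewrite /layer c_S !minElt; move: (c l) a0 => z h3 yx.
by do 4 (case: ltP => ?); lra.
Qed.

Lemma sum_layer_lip Q x y : \sum_(l < Q) `|layer l x - layer l y| <= `|x - y|.
Proof.
wlog yx : x y / y <= x => [h|].
  have [/h //|/ltW xy] := leP y x.
  rewrite distrC; apply: le_trans (h y x xy).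
  by rewrite le_eqVlt; apply/orP; left; apply/eqP; apply: eq_bigr => l _; rewrite distrC.
have -> : \sum_(l < Q) `|layer l x - layer l y| = \sum_(l < Q) (layer l x - layer l y).
  by apply: eq_bigr => l _; rewrite ger0_norm // subr_ge0 layer_mono.
have tel z n : \sum_(l < n) layer l z = Num.min z (c n) - Num.min z (c 0).
  elim: n => [|n IH]; first by rewrite big_ord0 subrr.
  by rewrite big_ord_recr /= IH /layer; ring.
rewrite sumrB !tel (ger0_norm (_ : 0 <= x - y)) ?subr_ge0 //.
have cc : c 0 <= c Q by rewrite /c; apply: ler_wpM2r; rewrite ?(ltW a0) // lerB ?ler_nat.
rewrite !minElt; move: (c 0) (c Q) cc yx => u v cc yx.
by do 4 (case: ltP => ?); lra.
Qed.

(** If [x] and [y] share a cell, one layer carries the whole difference. Otherwise the cell of the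
    smaller point and the next one carry amounts [A] and [B] with [A + B >= min (x - y) a], and
    [(A + B) ^+ 2 <= 2 * (A ^+ 2 + B ^+ 2)]. *)
Lemma sum_layer_sqr x y : `|x| <= Q0%:R * a -> `|y| <= Q0%:R * a ->
  Num.min ((x - y) ^+ 2) (a ^+ 2) <= 2 * \sum_(l < Q0.*2.+1) (layer l x - layer l y) ^+ 2.
Proof.
wlog yx : x y / y <= x => [h xQ yQ|].
  have [yx|/ltW xy] := leP y x; first exact: h.
  have -> : (x - y) ^+ 2 = (y - x) ^+ 2 by ring.
  apply: le_trans (h y x xy yQ xQ) _; rewrite le_eqVlt; apply/orP; left; apply/eqP; congr (_ * _).
  by apply: eq_bigr => l _; ring.
rewrite !ler_norml => /andP[x1 x2] /andP[y1 y2].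
pose z := y / a + Q0%:R.
have za : z * a = y + Q0%:R * a by rewrite /z mulrDl divfK ?gt_eqF.
have z0 : 0 <= z by rewrite -(pmulr_lge0 _ a0) za; lra.
have /andP[l1 l2] := truncn_itv z0; set l := Num.truncn z in l1 l2.
have cy : c l <= y by have := ler_wpM2r (ltW a0) l1; rewrite za /c; lra.
have yc : y < c l.+1 by have : z * a < l.+1%:R * a; [rewrite ltr_pM2r|rewrite za /c; lra].
have zQ : z <= (Q0 + Q0)%:R by rewrite -(ler_pM2r a0) za natrD; lra.
have lQ : (l <= Q0.*2)%N.
  by rewrite -(ler_nat R) -addnn; exact: le_trans zQ.
have ll : (l < Q0.*2.+1)%N by rewrite ltnS.
have ly : layer l y = y - c l by rewrite /layer (min_l (ltW yc)) (min_r cy).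
have ly1 : layer l.+1 y = 0.
  by rewrite /layer (min_l (ltW yc)) min_l ?subrr // c_S (le_trans (ltW yc)) // lerDl ltW.
have sq0 k : 0 <= (layer k x - layer k y) ^+ 2 := sqr_ge0 _.
have [xc|cx] := leP x (c l.+1).
  have lx : layer l x = x - c l.
    by rewrite /layer (min_l xc) min_r // (le_trans cy).
  rewrite (bigD1 (Ordinal ll)) //= lx ly ge_min; apply/orP; left.
  have -> : x - c l - (y - c l) = x - y by ring.
  have := sqr_ge0 (x - y).
  have : 0 <= \sum_(i < Q0.*2.+1 | i != Ordinal ll) (layer i x - layer i y) ^+ 2 by apply: sumr_ge0.
  move: (\sum_(i < _ | _) _) => S; lra.
have lx : layer l x = a.
  by rewrite /layer (min_r (ltW cx)) min_r ?(le_trans cy) // c_S; ring.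
have cQ : c Q0.*2 = Q0%:R * a by rewrite /c -addnn natrD; ring.
have l1Q : (l.+1 < Q0.*2.+1)%N.
  rewrite ltnS ltnNge; apply/negP => Ql.
  have : c Q0.*2 <= c l by rewrite /c; apply: ler_wpM2r; rewrite ?(ltW a0) // lerB ?ler_nat.
  rewrite cQ; move: cx; rewrite c_S; have := a0; lra.
rewrite (bigD1 (Ordinal ll)) //= (bigD1 (Ordinal l1Q)) /=; last by rewrite -val_eqE /= gtn_eqF.
have S0 : 0 <= \sum_(i < Q0.*2.+1 | (i != Ordinal ll) && (i != Ordinal l1Q)) (layer i x - layer i y) ^+ 2.
  by apply: sumr_ge0.
rewrite lx ly ly1 subr0; set A := a - (y - c l); set B := layer l.+1 x.
have AB : Num.min (x - y) a <= A + B.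
  have c2 := c_S l.+1; have c1 := c_S l.
  rewrite /A /B /layer (min_r (ltW cx)) c2 !minElt.
  move: (c l.+1) (c l) c1 cx cy yc a0 => v u c1 cx cy yc a1.
  by do 2 (case: ltP => ?); lra.
have m0 : 0 <= Num.min (x - y) a by rewrite le_min subr_ge0 yx ltW.
have mm : Num.min ((x - y) ^+ 2) (a ^+ 2) <= Num.min (x - y) a ^+ 2.
  by rewrite (minElt (x - y)); case: ifP => _; rewrite ge_min lexx ?orbT.
apply: (le_trans mm); have : Num.min (x - y) a ^+ 2 <= (A + B) ^+ 2.
  by apply: lerXn2r => //; rewrite nnegrE // (le_trans m0).
have := sqr_ge0 (A - B); move: (\sum_(i < _ | _) _) S0 => S S0; lra.
Qed.

End Chopping.

(** * A dense ball for the truncated distance *)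

Section DenseBall.
Context {R : realType}.

Lemma sum_ord_mul (F : nat -> R) d Q :
  \sum_(k < d * Q) F k = \sum_(k < d) \sum_(l < Q) F (k * Q + l)%N.
Proof.
elim: d => [|d IH]; first by rewrite mul0n !big_ord0.
rewrite big_ord_recr /= -IH mulSnr big_split_ord /=; congr (_ + _).
Qed.

Definition trunc_dist (d : nat) (a : R) (x y : nat -> R) : R :=
  \sum_(k < d) Num.min ((x k - y k) ^+ 2) (a ^+ 2).

Lemma trunc_dist_sym d a x y : trunc_dist d a x y = trunc_dist d a y x.
Proof. by apply: eq_bigr => k _; congr Num.min; ring. Qed.

(** Chopping makes all coordinate differences at most [a], does not increase the process by the l1
    contraction, and keeps at least half of the truncated distance: 64 becomes the 32 of
    [sudakov_rademacher]. *)
Lemma card_trunc_separated (I : finType) (i0 : I) d (m a p : R) (x : I -> nat -> R) :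
  0 < m -> 0 < p -> a = m / p ->
  (forall s, ravg d (fun e => mx i0 (fun i => rdot e (x i) - rdot e (x s))) <= m) ->
  (forall i j, i != j -> 64 * m * a < trunc_dist d a (x i) (x j)) ->
  #|I|%:R <= 8 * expR (3 * p ^+ 2).
Proof.
move=> m0 p0 aE Hm Hs; have a0 : 0 < a by rewrite aE divr_gt0.
pose Q0 := (Num.truncn ((\sum_i \sum_(k < d) `|x i k|) / a)).+1.
have xQ i (k : nat) : (k < d)%N -> `|x i k| <= Q0%:R * a.
  move=> kd; have s0 : 0 <= (\sum_i \sum_(k < d) `|x i k|) / a.
    by rewrite divr_ge0 ?(ltW a0) //; apply: sumr_ge0 => j _; apply: sumr_ge0.
  have /andP[_ /ltW] := truncn_itv s0; rewrite -/Q0 ler_pdivrMr //; apply: le_trans.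
  rewrite (bigD1 i) //= (bigD1 (Ordinal kd)) //= -addrA lerDl.
  apply: addr_ge0; first by apply: sumr_ge0.
  by apply: sumr_ge0 => j _; apply: sumr_ge0.
pose Q := Q0.*2.+1.
pose z i (n : nat) := layer a Q0 (n %% Q)%N (x i (n %/ Q)%N).
have zE i k l : (l < Q)%N -> z i (k * Q + l)%N = layer a Q0 l (x i k).
  by move=> lQ; rewrite /z modnMDl modn_small // divnMDl // divn_small // addn0.
apply: (@sudakov_rademacher R I i0 (d * Q) m a p z m0 p0 aE).
- move=> s; apply: le_trans (Hm s).
  have h := @ravg_chop_contraction R I i0 d Q (fun=> 0) (fun i k => x i k - x s k)
    (fun i n => z i n - z s n).
  have E (N : nat) (f : I -> nat -> R) : ravg N (fun e => mx i0 (fun i => rdot e (f i) - rdot e (f s))) =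
     ravg N (fun e => mx i0 (fun i => 0 + rdot e (fun k => f i k - f s k))).
    by apply: eq_ravg => e; congr mx; apply: funext => i; rewrite add0r rdotB.
  rewrite !E; apply: h => k i j.
  have -> : x i k - x s k - (x j k - x s k) = x i k - x j k by ring.
  apply: le_trans (sum_layer_lip Q0 a0 Q _ _); rewrite le_eqVlt; apply/orP; left; apply/eqP.
  by apply: eq_bigr => l _; rewrite !zE //; congr (`|_|); ring.
- move=> i j k; rewrite /z.
  have /andP[h1 h2] := layer_itv Q0 a0 (k %% Q)%N (x i (k %/ Q)%N).
  have /andP[h3 h4] := layer_itv Q0 a0 (k %% Q)%N (x j (k %/ Q)%N).
  by rewrite ler_norml; apply/andP; split; lra.
- move=> i j ij; have := Hs i j ij.
  rewrite (sum_ord_mul (fun n => (z i n - z j n) ^+ 2)).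
  have : trunc_dist d a (x i) (x j) <= 2 * \sum_(k < d) \sum_(l < Q) (z i (k * Q + l)%N - z j (k * Q + l)%N) ^+ 2.
    rewrite mulr_sumr; apply: ler_sum => k _.
    apply: le_trans (sum_layer_sqr a0 (xQ i k (ltn_ord k)) (xQ j k (ltn_ord k))) _.
    rewrite le_eqVlt; apply/orP; left; apply/eqP; congr (_ * _); apply: eq_bigr => l _.
    by rewrite !zE.
  lra.
Qed.

(** Balls around a maximal separated set cover [I], and such a set is small by
    [card_trunc_separated]; one ball receives its share. *)
Lemma exists_dense_ball (I : finType) (i0 : I) d (m a p : R) (x : I -> nat -> R) :
  0 < m -> 0 < p -> a = m / p ->
  (forall s, ravg d (fun e => mx i0 (fun i => rdot e (x i) - rdot e (x s))) <= m) ->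
  exists s : I, #|I|%:R <=
    8 * expR (3 * p ^+ 2) * #|[set i | trunc_dist d a (x i) (x s) <= 64 * m * a]%SET|%:R.
Proof.
move=> m0 p0 aE Hm.
pose sep (S : {set I}) := [forall i in S, forall j in S, (i != j) ==>
   (64 * m * a < trunc_dist d a (x i) (x j))].
have sep0 : sep finset.set0 by apply/forall_inP => i; rewrite finset.in_set0.
have [S /finset.maxsetP[/forall_inP sS maxS] _] := finset.maxset_exists sep0.
have ball_cover i : exists2 s, s \in S & trunc_dist d a (x i) (x s) <= 64 * m * a.
  apply: contrapT => h.
  have far s : s \in S -> 64 * m * a < trunc_dist d a (x i) (x s).
    by move=> sS'; rewrite ltNge; apply/negP => le; apply: h; exists s.
  have a0 : 0 < a by rewrite aE divr_gt0.
  have iS : i \notin S.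
    apply/negP => /far; rewrite /trunc_dist big1 => [|k _]; last first.
      by rewrite subrr expr0n /= min_l // sqr_ge0.
    by rewrite ltNge ltW // !mulr_gt0.
  have : sep (i |: S)%SET.
    apply/forall_inP => k; rewrite finset.in_setU1 => kS; apply/forall_inP => l.
    rewrite finset.in_setU1 => lS; apply/implyP => kl.
    move: kS lS kl => /orP[/eqP ->|kS] /orP[/eqP ->|lS] kl.
    - by rewrite eqxx in kl.
    - exact: far.
    - by rewrite trunc_dist_sym; exact: far.
    - exact: (implyP (forall_inP (sS k kS) l lS)).
  by move=> /maxS/(_ (finset.subsetUr _ _)) E; move: iS; rewrite -E finset.setU11.
have [s1 s1S _] := ball_cover i0.
pose J := {i : I | i \in S}.
pose j0 : J := Sub s1 s1S.
have cardS : #|S|%:R <= 8 * expR (3 * p ^+ 2).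
  have <- : #|{: J}| = #|S| by rewrite card_sig; apply: eq_card => i.
  apply: (@card_trunc_separated _ j0 d m a p (fun j => x (val j)) m0 p0 aE).
    move=> s; apply: le_trans (Hm (val s)); apply: le_ravg => e _; apply/mx_leP => j.
    exact: (le_mx i0 (fun i => rdot e (x i) - rdot e (x (val s)))).
  move=> i j ij; apply: (implyP (forall_inP (sS (val i) (valP i)) (val j) (valP j))).
  by rewrite (inj_eq val_inj).
pose Bl s := [set i | trunc_dist d a (x i) (x s) <= 64 * m * a]%SET.
apply: contrapT => nex.
have lt s : 8 * expR (3 * p ^+ 2) * #|Bl s|%:R < #|I|%:R.
  by rewrite ltNge; apply/negP => h; apply: nex; exists s.
have S0 : (0 < #|S|)%N by apply/card_gt0P; exists s1.
have : (#|I| <= \sum_(s in S) #|Bl s|)%N.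
  apply: (@leq_trans #|\bigcup_(s in S) Bl s|%SET).
    rewrite -cardsT; apply: subset_leq_card; apply/fintype.subsetP => i _.
    have [s sS' h] := ball_cover i; apply/finset.bigcupP; exists s => //.
    by rewrite finset.inE.
  elim/big_rec2: _ => [|k A B kV Aa]; first by rewrite finset.cards0.
  by rewrite (leq_trans (leq_card_setU _ _)) // leq_add.
rewrite -(ler_nat R) natr_sum.
have e0 : 0 < 8 * expR (3 * p ^+ 2) by rewrite mulr_gt0 ?expR_gt0.
move=> /(ler_wpM2l (ltW e0)); rewrite mulr_sumr.
have : \sum_(s in S) 8 * expR (3 * p ^+ 2) * #|Bl s|%:R < \sum_(s in S) #|I|%:R :> R.
  apply: ltr_sum => //; by apply/hasP; exists s1; rewrite ?mem_index_enum.
rewrite sumr_const -[#|I|%:R *+ #|S|]mulr_natl => h1 h2; have := le_lt_trans h2 h1.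
by rewrite ltNge ler_wpM2r.
Qed.

End DenseBall.

(** * Soft thresholding *)

Section SoftThreshold.
Context {R : realType}.
Variable a : R.
Hypothesis a0 : 0 <= a.

Definition sclamp (x : R) : R := Num.max (- a) (Num.min x a).
Definition soft (x : R) : R := x - sclamp x.

Lemma norm_clamp_le x : `|sclamp x| <= a.
Proof.
rewrite /sclamp ler_norml le_max lexx /= ge_max ge_min lexx orbT andbT; have := a0; lra.
Qed.

Lemma clamp_id x : `|x| <= a -> sclamp x = x.
Proof. by rewrite ler_norml /sclamp => /andP[h1 h2]; rewrite min_l // max_r. Qed.

Lemma soft_eq0 x : `|x| <= a -> soft x = 0.
Proof. by move=> h; rewrite /soft clamp_id // subrr. Qed.

Lemma sqr_clamp x : sclamp x ^+ 2 = Num.min (x ^+ 2) (a ^+ 2).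
Proof.
have E := real_normK (num_real x).
have [h|h] := lerP `|x| a.
  by rewrite clamp_id // min_l // -E ler_pXn2r ?nnegrE.
rewrite min_r; last by rewrite -E ler_pXn2r ?nnegrE // ltW.
have [x0|x0] := lerP 0 x.
  by move: h; rewrite ger0_norm // => h; rewrite /sclamp min_r ?(ltW h) // max_r // (le_trans _ a0) // oppr_le0.
move: h; rewrite ltr0_norm // => h; rewrite /sclamp min_l; last by have := a0; lra.
by have := a0; rewrite max_l ?sqrrN //; lra.
Qed.

Lemma clampP x : [\/ x <= - a /\ sclamp x = - a, - a <= x <= a /\ sclamp x = x | a <= x /\ sclamp x = a].
Proof.
have [h|h] := lerP `|x| a; first by apply: Or32; rewrite clamp_id // -ler_norml.
have := a0; have [x0|x0] := lerP 0 x => a1.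
  by apply: Or33; rewrite ger0_norm // in h; rewrite /sclamp min_r ?max_r; lra.
by apply: Or31; rewrite ltr0_norm // in h; rewrite /sclamp min_l ?max_l; lra.
Qed.

Lemma soft_lip x y : `|soft x - soft y| <= `|x - y|.
Proof.
wlog yx : x y / y <= x => [h|].
  by have [/h //|/ltW/h] := leP y x; rewrite distrC [X in _ <= X]distrC.
rewrite [X in _ <= X]ger0_norm ?subr_ge0 // /soft ler_norml; have := a0; move: yx.
by have [] := clampP x => -[h1 ->]; have [] := clampP y => -[h2 ->] yx a1; apply/andP; split; lra.
Qed.

Lemma norm_soft_le x : `|soft x| <= `|x|.
Proof. by have := soft_lip x 0; rewrite (soft_eq0 (x := 0)) ?normr0 // !subr0. Qed.

End SoftThreshold.

(** * Null coordinates and the spread part *)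

Section TailPieces.
Context {R : realType} {d0 : measure_display} {Omega : measurableType d0}.
Context (P : probability Omega R) (d : nat) (X : 'I_d -> {RV P >-> R}).
Hypothesis HU : unconditional_vec X.
Hypothesis HL : log_concave_vec X.

Lemma pr_tailD (x y : 'rV[R]_d) (u u' : R) :
  pr P (tail X (x + y) (u + u')) <= pr P (tail X x u) + pr P (tail X y u').
Proof.
have mx' := measurable_tail X x u; have my := measurable_tail X y u'.
apply: le_trans (pr_setU_le P mx' my).
apply: le_pr; [exact: measurable_tail|exact: measurableU|move=> w; rewrite /tail /= dotvDl => h].
have [?|h1] := leP u `|dotv x (rvec X w)|; first by left.
have [?|h2] := leP u' `|dotv y (rvec X w)|; first by right.
by have := le_trans h (ler_normD _ _); lra.
Qed.

Lemma tailN (x : 'rV[R]_d) u : tail X (- x) u = tail X x u.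
Proof. by apply/seteqP; split => w; rewrite /tail /= dotvNl normrN. Qed.

Variable b : 'I_d -> R.
Hypothesis bE : forall i, b i = Ex P (fun w => `|X i w|).

Lemma mean_abs_ge0 i : 0 <= b i.
Proof. by rewrite bE; exact: Ex_ge0. Qed.

Lemma pr_null_coord k : b k = 0 -> pr P [set w | 0 < `|X k w|] = 0.
Proof.
move=> bk; have ik := itg_norm (itg_coord HU HL k).
have mX : measurable_fun setT (fun w => `|X k w|) := itg_meas ik.
have I0 : (\int[P]_w `|(`|X k w|)%:E| = 0)%E.
  have -> : (fun w => `|(`|X k w|)%:E|%E) = (fun w => (`|X k w|)%:E).
    by apply: funext => w; rewrite gee0_abs // lee_fin.
  have := bE k; rewrite bk /Ex /Rintegral => /esym E.
  by have /fineK <- := integrable_fin_num measurableT ik; rewrite E.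
have mE : measurable_fun setT (EFin \o fun w => `|X k w|) by exact: measurableT_comp.
have /iffLR/(_ I0) h := ae_eq_integral_abs P measurableT mE.
have m0 : measurable [set w | 0 < `|X k w|] by apply: measurable_set_lt.
have : P.-negligible [set w | 0 < `|X k w|].
  apply: negligibleS h => w /= h1 h2; have := h2 Logic.I; move=> [] E.
  by rewrite E ltxx in h1.
by move=> /(measure_negligible m0) E; rewrite /pr E.
Qed.

Lemma pr_tail_add_null (x n : 'rV[R]_d) u : (forall k, n 0 k = 0 \/ b k = 0) ->
  pr P (tail X (x + n) u) <= pr P (tail X x u).
Proof.
move=> nk; pose A k := [set w | b k = 0 /\ 0 < `|X k w|].
have mA k : measurable (A k).
  have [bk|bk] := eqVneq (b k) 0.
    have -> : A k = [set w | 0 < `|X k w|] by apply/seteqP; split => w; rewrite /A /= bk => //; case.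
    apply: measurable_set_lt => //; apply: itg_meas; apply: itg_norm; exact: (itg_coord HU HL).
  have -> : A k = set0 by rewrite -subset0 => w [] /eqP; rewrite (negbTE bk).
  exact: measurable0.
have pA k : pr P (A k) = 0.
  have [bk|bk] := eqVneq (b k) 0.
    have -> : A k = [set w | 0 < `|X k w|] by apply/seteqP; split => w; rewrite /A /= bk => //; case.
    exact: pr_null_coord.
  have -> : A k = set0 by rewrite -subset0 => w [] /eqP; rewrite (negbTE bk).
  exact: pr0.
have mE : measurable [set w | exists k, A k w].
  have -> : [set w | exists k, A k w] = \bigcup_(k in [set: 'I_d]) A k.
    by apply/seteqP; split => w [k]; [exists k|exists k].
  exact: fin_bigcup_measurable.
have E0 : pr P [set w | exists k, A k w] <= 0.
  by apply: le_trans (pr_exists_le P mA) _; rewrite big1.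
have mt := measurable_tail X x u.
apply: (@le_trans _ _ (pr P (tail X x u `|` [set w | exists k, A k w]))).
  apply: le_pr; [exact: measurable_tail|exact: measurableU|move=> w].
  have [[k Ak]|nA] := pselect (exists k, A k w); first by right; exists k.
  rewrite /tail /= dotvDl (_ : dotv n _ = 0) ?addr0; first by left.
  rewrite dotv_rvecE big1 // => k _; case: (nk k) => [->|bk]; first by rewrite mul0r.
  have -> : X k w = 0; last by rewrite mulr0.
  apply/eqP; rewrite -normr_eq0 eq_le normr_ge0 andbT leNgt; apply/negP => h.
  by apply: nA; exists k.
apply: le_trans (pr_setU_le P mt mE) _; lra.
Qed.

(** The scaling [la = p / (256 * m)] brings the coefficients down to [1 / 256]. The exponent is then
    at most [- 2 ^+ 14 * p + 2 ^+ 23 * (p / 2 ^+ 10)], that is [- 2 ^+ 13 * p]. *)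
Lemma pr_tail_spread (v : 'rV[R]_d) (m p : R) : 0 < m -> 1 <= p ->
  (forall k, v 0 k = 0 \/ 0 < b k) -> (forall k, `|v 0 k| * b k <= m / p) ->
  \sum_k (v 0 k * b k) ^+ 2 <= 64 * m ^+ 2 / p ->
  pr P (tail X v (2 ^+ 22 * m)) <= 6 * expR (- (8 * p)).
Proof.
move=> m0 p1 v0 vb vs; pose la := p / (256 * m).
have p0 : 0 < p by lra.
have la0 : 0 < la by apply: divr_gt0 p0 _; apply: mulr_gt0 m0; rewrite ltr0n.
apply: le_trans (pr_tail_le HU v _) _.
have -> : half X v (2 ^+ 22 * m) = half X (la *: v) (2 ^+ 14 * p).
  have E : 2 ^+ 14 * p = la * (2 ^+ 22 * m) by rewrite /la; field; lra.
  by apply/seteqP; split => w; rewrite /half /= dotvZl E ler_pM2l.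
suff : pr P (half X (la *: v) (2 ^+ 14 * p)) <= 3 * expR (- (8 * p)) by lra.
apply: le_trans (half_space_exp_bound HU HL bE _ _ _) _.
- by move=> k; rewrite mxE; case: (v0 k) => [->|]; [left; rewrite mulr0|right].
- move=> k; rewrite mxE normrM (gtr0_norm la0) -mulrA.
  apply: (@le_trans _ _ (la * (m / p))); first by rewrite ler_pM2l.
  by rewrite /la le_eqVlt; apply/orP; left; apply/eqP; field; lra.
rewrite ler_pM2l // ler_expR.
have -> : \sum_i ((la *: v) 0 i * b i) ^+ 2 = la ^+ 2 * \sum_k (v 0 k * b k) ^+ 2.
  by rewrite mulr_sumr; apply: eq_bigr => k _; rewrite mxE; ring.
have : la ^+ 2 * \sum_k (v 0 k * b k) ^+ 2 <= la ^+ 2 * (64 * m ^+ 2 / p).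
  by rewrite ler_wpM2l // sqr_ge0.
have -> : la ^+ 2 * (64 * m ^+ 2 / p) = p / 2 ^+ 10 by rewrite /la; field; lra.
move: (la ^+ 2 * _) => Z hZ.
have : 2 ^+ 23 * Z <= 2 ^+ 13 * p.
  apply: (@le_trans _ _ (2 ^+ 23 * (p / 2 ^+ 10))); first by rewrite ler_pM2l.
  by rewrite le_eqVlt; apply/orP; left; apply/eqP; field.
move: (2 ^+ 23 * Z) => Z' hZ'.
have -> : 2 ^+ 14 = 2 * 2 ^+ 13 :> R by rewrite exprS.
have : 16 <= 2 ^+ 13 :> R by rewrite -natrX ler_nat.
move: (2 ^+ 13) hZ' => z hZ' z16.
have : 16 * p <= z * p by rewrite ler_pM2r.
lra.
Qed.

End TailPieces.


(** * The kernel and the disjoint parts *)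

Section KernelAndDisjointParts.
Context {R : realType} {d0 : measure_display} {Omega : measurableType d0}.
Context (P : probability Omega R) (d : nat) (X : 'I_d -> {RV P >-> R}).
Hypothesis HU : unconditional_vec X.
Hypothesis HL : log_concave_vec X.
Variable b : 'I_d -> R.
Hypothesis bE : forall i, b i = Ex P (fun w => `|X i w|).

Lemma pr_coord_tail k (s : R) : 0 < b k -> 0 < s ->
  pr P [set w | s * b k <= `|X k w|] <= 2 * expR (- (s / 32)).
Proof.
move=> bk s0; have h := pr_all_large_le HU HL bE (I := [set k]%SET) (s := fun i => s * b i).
have ms : measurable [set w | s * b k <= `|X k w|].
  by apply: measurable_set_le => //; apply: itg_meas; apply: itg_norm; exact: (itg_coord HU HL).
have E : [set w | forall i, i \in [set k]%SET -> s * b i <= `|X i w|] = [set w | s * b k <= `|X k w|].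
  apply/seteqP; split => w /= H; first by apply: H; rewrite finset.in_set1.
  by move=> i; rewrite finset.in_set1 => /eqP ->.
rewrite -E; apply: le_trans (h _ _) _ => [i|i|].
- by rewrite finset.in_set1 => /eqP ->.
- by rewrite finset.in_set1 => /eqP ->; rewrite mulr_gt0.
by rewrite finset.big_set1 (_ : s * b k / (32 * b k) = s / 32) //; field; rewrite gt_eqF.
Qed.

Lemma expR_lin_bound (p : R) : 1 <= p -> 128 * p * expR (- (16 * p)) <= expR (- p) / 4.
Proof.
move=> p1; have e1 : p <= expR p by have := expR_ge1Dx p; lra.
have e2 : 512 <= expR (14 * p).
  have h : (1 + 1 / 2) ^+ 28 <= expR (14 : R).
    rewrite (_ : 14 = 28%:R * (1 / 2)) ?expRM_natl; last by field.
    by rewrite lerXn2r ?nnegrE ?expR_ge0 ?expR_ge1Dx //; lra.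
  have : expR (14 : R) <= expR (14 * p) by rewrite ler_expR; lra.
  lra.
have -> : expR (- p) = expR (14 * p) * expR p * expR (- (16 * p)).
  by rewrite -!expRD; congr expR; ring.
rewrite [leRHS]mulrAC; apply: ler_wpM2r; first exact: expR_ge0.
have : 512 * p <= expR (14 * p) * expR p by apply: ler_pM e2 e1; [rewrite ler0n|lra].
move: (_ * expR p) => Z; lra.
Qed.

(** If [|X k| < 512 * p * b k] on [J], each term is at most [m / (64 * p)] and their sum at most
    [m]. The union bound over [64 * p] coordinates costs [128 * p * expR (- (16 * p))]. *)
Lemma pr_tail_kernel (J : {set 'I_d}) (x : 'rV[R]_d) (m p : R) : 0 < m -> 1 <= p ->
  #|J|%:R <= 64 * p -> (forall k, x 0 k = 0 \/ k \in J /\ 0 < b k) ->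
  (forall k, `|x 0 k| * b k <= m / (2 ^+ 15 * p ^+ 2)) ->
  pr P (tail X x (2 * m)) <= expR (- p) / 4.
Proof.
move=> m0 p1 Jp xJ xb; have p0 : 0 < p by lra.
pose A (k : 'I_d) := if (k \in J) && (0 < b k) then [set w | 512 * p * b k <= `|X k w|] else set0.
have mX k : measurable_fun setT (fun w => `|X k w|).
  by apply: itg_meas; apply: itg_norm; exact: (itg_coord HU HL).
have mA k : measurable (A k).
  by rewrite /A; case: ifP => // _; exact: measurable_set_le.
apply: (@le_trans _ _ (pr P [set w | exists k, A k w])).
  apply: le_pr; first exact: measurable_tail.
    have -> : [set w | exists k, A k w] = \bigcup_(k in [set: 'I_d]) A k.
      by apply/seteqP; split => w [k]; [exists k|exists k].
    exact: fin_bigcup_measurable.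
    move=> w; rewrite /tail /= leNgt => /negP h; apply: contrapT => nA; apply: h.
  apply: (@le_lt_trans _ _ (\sum_k (if k \in J then m / (64 * p) else 0))).
    rewrite dotv_rvecE; apply: le_trans (ler_norm_sum _ _ _) _; apply: ler_sum => k _.
    have mp0 : 0 <= m / (64 * p) by apply: divr_ge0; [exact: ltW|rewrite mulr_ge0 ?(ltW p0)].
    case: (xJ k) => [->|[kJ bk]]; first by rewrite mul0r normr0; case: ifP.
    have := xb k; rewrite kJ normrM => xbk.
    have Xk : `|X k w| < 512 * p * b k.
      by rewrite ltNge; apply/negP => h; apply: nA; exists k; rewrite /A kJ bk.
    apply: (@le_trans _ _ (`|x 0 k| * (512 * p * b k))).
      by rewrite ler_wpM2l // ltW.
    have -> : m / (64 * p) = 512 * p * (m / (2 ^+ 15 * p ^+ 2)) by field; lra.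
    have -> : `|x 0 k| * (512 * p * b k) = 512 * p * (`|x 0 k| * b k) by ring.
    by apply: ler_wpM2l xbk; apply: mulr_ge0 (ltW p0); rewrite ler0n.
  rewrite -big_mkcond sumr_const -[_ *+ _]mulr_natl.
  have : #|J|%:R * (m / (64 * p)) <= 64 * p * (m / (64 * p)).
    by apply: ler_wpM2r Jp; apply: divr_ge0; [exact: ltW|rewrite mulr_ge0 ?(ltW p0)].
  have -> : 64 * p * (m / (64 * p)) = m by field; lra.
  by lra.
apply: le_trans (pr_exists_le P mA) _.
apply: le_trans (expR_lin_bound p1).
apply: (@le_trans _ _ (\sum_(k in J) 2 * expR (- (16 * p)))).
  rewrite [X in _ <= X]big_mkcond; apply: ler_sum => k _; rewrite /A.
  case: (k \in J) => /=; last by rewrite pr0.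
  case: ltP => bk; last by rewrite pr0 mulr_ge0 ?expR_ge0.
  apply: le_trans (pr_coord_tail bk _) _; first by apply: mulr_gt0 p0; rewrite ltr0n.
  by rewrite (_ : 512 * p / 32 = 16 * p) //; field.
rewrite sumr_const -[_ *+ _]mulr_natl mulrA ler_wpM2r ?expR_ge0 //; lra.
Qed.
(** Each coordinate takes the sign of the only vector whose support can contain it. *)
Lemma disjoint_supports_sign_family (N : nat) (w : 'I_N -> 'rV[R]_d) :
  (forall i j k, i != j -> w i 0 k = 0 \/ w j 0 k = 0) -> sign_family w.
Proof.
move=> dis sg sg1; pose eta k := oapp sg 1 [pick i | w i 0 k != 0].
exists eta; split => [k|i].
  by rewrite /eta; case: pickP => [i _|_] /=; [exact: sg1|left].
apply/rowP => k; rewrite !mxE /eta; case: pickP => [j wj|w0] /=.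
  have [->//|ij] := eqVneq j i.
  by case: (dis j i k ij) => E; [rewrite E eqxx in wj|rewrite E !mulr0].
by have /negbFE/eqP -> := w0 i; rewrite !mulr0.
Qed.

(** Only differences of points are known to have heavy tails, hence the hypothesis on pairs: at most
    one index has probability below [c], which accounts for [N - 1]. *)
Lemma card_disjoint_large (N : nat) (w : 'I_N -> 'rV[R]_d) (m c : R) : 0 < m -> 0 <= c ->
  (forall i j k, i != j -> w i 0 k = 0 \/ w j 0 k = 0) ->
  1 / 2 <= pr P [set o | forall k, `|dotv (w k) (rvec X o)| <= 4 * m] ->
  (forall i j, i != j -> 2 * c <= pr P (tail X (w i) (160 * m)) + pr P (tail X (w j) (160 * m))) ->
  (N%:R - 1) * c <= 5.
Proof.
move=> m0 c0 dis hb hp; have e0 : 0 < 4 * m by lra.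
have := sum_pr_large_coordinates HU HL (disjoint_supports_sign_family dis) e0.
have -> : 40 * (4 * m) = 160 * m by ring.
have -> : box X w (4 * m) (fun=> 0) = [set o | forall k, `|dotv (w k) (rvec X o)| <= 4 * m].
  by apply/seteqP; split => o h k; have := h k; rewrite subr0.
move=> /(_ hb); apply: le_trans.
pose F k := pr P (tail X (w k) (160 * m)); rewrite -[leRHS]/(\sum_k F k).
have F0 k : 0 <= F k by exact: pr_ge0.
have [/existsP[i Fi]|/existsPn Fc] := boolP [exists i, F i < c].
  have lb k : k != i -> c <= F k by move=> /hp; rewrite -/(F k) -/(F i); lra.
  rewrite (bigD1 i) //= -[X in X <= _]add0r; apply: lerD => //.
  apply: (@le_trans _ _ (\sum_(k | k != i) c)); last exact: ler_sum.
  rewrite sumr_const (_ : #|_| = N.-1); last first.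
    by have := cardC1 i; rewrite card_ord => <-; apply: eq_card => k; rewrite !inE.
  have N0 : (0 < N)%N := leq_ltn_trans (leq0n i) (ltn_ord i).
  by rewrite -[c *+ _]mulr_natl -[in leLHS](prednK N0) -natr1 addrK.
apply: (@le_trans _ _ (\sum_(k < N) c)); last by apply: ler_sum => k _; rewrite leNgt.
by rewrite sumr_const card_ord -[c *+ _]mulr_natl ler_wpM2r //; lra.
Qed.

End KernelAndDisjointParts.

(** * Cardinality needed by the sunflower *)

Section Counting.
Context {R : realType}.

Lemma natr_le_expR (k : nat) (x : R) : k%:R <= x -> 2 ^+ k <= expR x.
Proof.
move=> kx; apply: (@le_trans _ _ (expR (k%:R * 1))); last by rewrite ler_expR mulr1.
by rewrite expRM_natl lerXn2r ?nnegrE ?expR_ge0 // (le_trans _ (expR_ge1Dx 1)).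
Qed.

(** [N0] and [q] are at most [expR (7 * p)] and [c] at most [expR (21 * p)], so the base is at most
    [expR (36 * p)] and its power at most [expR (2304 * p ^+ 2)]; the other factors add at most
    [13 * p ^+ 2] to the exponent. *)
Lemma sunflower_size_bound (p : R) (N0 q c : nat) : 1 <= p ->
  N0%:R <= 41 * expR p + 2 -> q%:R <= 64 * p -> c%:R <= 2 ^+ 18 * p ^+ 2 + 1 ->
  8 * expR (3 * p ^+ 2) * ((N0 * q * c + 1) ^ q * N0)%:R < expR (4096 * p ^+ 2).
Proof.
move=> p1 hN hq hc; have p0 : 0 < p by lra.
have pe : p <= expR p by have := expR_ge1Dx p; lra.
have e1 : 1 <= expR p by rewrite -expR0 ler_expR; lra.
have eD x y : expR x * expR y = expR (x + y) :> R by rewrite expRD.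
have h6 : 64 <= expR (6 * p).
  by apply: le_trans (@natr_le_expR 6 _ _); [rewrite -natrX ler_nat|lra].
have N7 : N0%:R <= expR (7 * p).
  apply: (le_trans hN); apply: (@le_trans _ _ (64 * expR p)); first by lra.
  apply: (@le_trans _ _ (expR (6 * p) * expR p)); first by rewrite ler_wpM2r ?expR_ge0.
  by rewrite eD ler_expR; lra.
have q7 : q%:R <= expR (7 * p).
  apply: (le_trans hq); apply: (@le_trans _ _ (expR (6 * p) * expR p)).
    by apply: ler_pM h6 pe; [rewrite ler0n|exact: ltW].
  by rewrite eD ler_expR; lra.
have c21 : c%:R <= expR (21 * p).
  have h18 : 2 ^+ 19 <= expR (19 * p) by apply: natr_le_expR; lra.
  have p2 : 1 <= p ^+ 2 by rewrite exprn_ege1.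
  have pp : p ^+ 2 <= expR (2 * p) by rewrite expRM_natl lerXn2r ?nnegrE ?expR_ge0 // ltW.
  apply: (le_trans hc); apply: (@le_trans _ _ (2 ^+ 19 * p ^+ 2)).
    have : 1 <= 2 ^+ 18 :> R by rewrite exprn_ege1 // ler1n.
    rewrite [2 ^+ 19]exprS; move: (2 ^+ 18) => z z1.
    have : 1 * 1 <= z * p ^+ 2 by apply: ler_pM.
    lra.
  apply: (@le_trans _ _ (expR (19 * p) * expR (2 * p))).
    by apply: ler_pM h18 pp; rewrite ?exprn_ge0 // ltW.
  by rewrite eD ler_expR; lra.
have M36 : (N0 * q * c + 1)%:R <= expR (36 * p).
  rewrite natrD !natrM.
  apply: (@le_trans _ _ (expR (7 * p) * expR (7 * p) * expR (21 * p) + 1)).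
    by rewrite lerD2r; apply: ler_pM c21 => //; apply: ler_pM.
  rewrite !eD (_ : 36 * p = (7 * p + 7 * p + 21 * p) + p); last by ring.
  have z1 : 1 <= expR (7 * p + 7 * p + 21 * p).
    by have := expR_ge1Dx (7 * p + 7 * p + 21 * p); lra.
  rewrite -[leRHS]eD; move: (7 * p + 7 * p + 21 * p) z1 => z z1.
  have : expR z * 2 <= expR z * expR p.
    by rewrite ler_wpM2l ?expR_ge0 //; apply: (@natr_le_expR 1).
  by move: (expR z * expR p) => E; lra.
have Mq : ((N0 * q * c + 1) ^ q)%:R <= expR (2304 * p ^+ 2).
  rewrite natrX; apply: (@le_trans _ _ (expR (36 * p) ^+ q)).
    by rewrite lerXn2r ?nnegrE ?expR_ge0.
  rewrite -expRM_natl ler_expR.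
  apply: (@le_trans _ _ (64 * p * (36 * p))); first by rewrite ler_wpM2r //; lra.
  by rewrite expr2; lra.
rewrite natrM; apply: (@le_lt_trans _ _ (8 * expR (3 * p ^+ 2) * (expR (2304 * p ^+ 2) * expR (7 * p)))).
  rewrite ler_wpM2l ?mulr_ge0 ?expR_ge0 //.
  by apply: ler_pM.
have h3 : 8 <= expR (3 * p).
  by apply: le_trans (@natr_le_expR 3 _ _); [rewrite -natrX ler_nat|lra].
apply: (@le_lt_trans _ _ (expR (3 * p) * expR (3 * p ^+ 2) * (expR (2304 * p ^+ 2) * expR (7 * p)))).
  by rewrite !ler_wpM2r ?mulr_ge0 ?expR_ge0.
rewrite !eD ltr_expR; have : 1 * p <= p * p by rewrite ler_wpM2r // ltW.
rewrite expr2.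
lra.
Qed.

End Counting.

(** * Splitting a difference of points *)

Section Splitting.
Context {R : realType} {d0 : measure_display} {Omega : measurableType d0}.
Context (P : probability Omega R) (d : nat) (X : 'I_d -> {RV P >-> R}).
Hypothesis HU : unconditional_vec X.
Hypothesis HL : log_concave_vec X.
Variable b : 'I_d -> R.
Hypothesis bE : forall i, b i = Ex P (fun w => `|X i w|).

(** The sum of the two maxima dominates every absolute value, both being nonnegative by [w s = 0];
    its mean is at most [2 * m], so Markov at level [4 * m] leaves probability [1 / 2]. *)
Lemma pr_all_small_of_Emax (I : finType) (s : I) (w : I -> 'rV[R]_d) (m : R) : 0 < m ->
  w s = 0 -> Emax X s w <= m -> Emax X s (fun i => - w i) <= m ->
  1 / 2 <= pr P [set o | forall i, `|dotv (w i) (rvec X o)| <= 4 * m].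
Proof.
move=> m0 ws E1 E2.
pose G o := mx s (fun i => dotv (w i) (rvec X o)) + mx s (fun i => dotv (- w i) (rvec X o)).
have i1 : itg P (fun o => mx s (fun i => dotv (w i) (rvec X o))).
  by apply: itg_mx => i; exact: (itg_dotv HU HL).
have i2 : itg P (fun o => mx s (fun i => dotv (- w i) (rvec X o))).
  by apply: itg_mx => i; exact: (itg_dotv HU HL).
have iG : itg P G by exact: itgD.
have p1 o : 0 <= mx s (fun i => dotv (w i) (rvec X o)).
  by apply: le_trans (le_mx s _ s); rewrite ws dotv0.
have p2 o : 0 <= mx s (fun i => dotv (- w i) (rvec X o)).
  by apply: le_trans (le_mx s _ s); rewrite ws oppr0 dotv0.
have G0 o : 0 <= G o by exact: addr_ge0.
have m4 : 0 < 4 * m by lra.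
have := markov_pr iG G0 m4.
have EG : Ex P G = Emax X s w + Emax X s (fun i => - w i) by exact: ExD.
have : Ex P G / (4 * m) <= 1 / 2 by rewrite EG ler_pdivrMr //; lra.
have mG : measurable [set o | 4 * m <= G o].
  by apply: measurable_set_le; [exact: measurable_cst|exact: itg_meas iG].
have := prC P mG.
have mB : measurable [set o | forall i, `|dotv (w i) (rvec X o)| <= 4 * m].
  apply: measurable_forall => i; apply: measurable_set_le => //; apply: itg_meas; apply: itg_norm.
  exact: (itg_dotv HU HL).
have : pr P (~` [set o | 4 * m <= G o]) <= pr P [set o | forall i, `|dotv (w i) (rvec X o)| <= 4 * m].
  apply: le_pr => //; first exact: measurableC.
  move=> o /negP; rewrite -ltNge => h i.
  have h1 := le_mx s (fun i => dotv (w i) (rvec X o)) i.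
  have := le_mx s (fun i => dotv (- w i) (rvec X o)) i; rewrite dotvNl => h2.
  have := p1 o; have := p2 o; move: h; rewrite /G ler_norml => h3 h4 h5; apply/andP; split; lra.
lra.
Qed.

(** The threshold applies to [y 0 k * b k], whose absolute value is the mean of [|y 0 k * X k|]. *)
Definition softv (a : R) (y : 'rV[R]_d) : 'rV[R]_d := \row_k (soft a (y 0 k * b k) / b k).
Definition clampv (a : R) (y : 'rV[R]_d) : 'rV[R]_d := \row_k (sclamp a (y 0 k * b k) / b k).
(* Where [b k = 0] the two divisions give [0], and [X k] vanishes almost surely. *)
Definition nullv (y : 'rV[R]_d) : 'rV[R]_d := \row_k (if b k == 0 then y 0 k else 0).

Lemma soft_clamp_null a y : y = softv a y + clampv a y + nullv y.
Proof.
apply/rowP => k; rewrite !mxE; case: eqVneq => [->|bk]; first by rewrite invr0 !mulr0 !add0r.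
by rewrite addr0 -mulrDl /soft subrK mulfK.
Qed.

Lemma mean_abs_cases k : b k = 0 \/ 0 < b k.
Proof.
have := mean_abs_ge0 bE k; rewrite le_eqVlt => /orP[/eqP <-|]; by [left|right].
Qed.

Lemma softv_mul a y k : 0 <= a -> softv a y 0 k * b k = soft a (y 0 k * b k).
Proof.
move=> a0; rewrite mxE; case: (mean_abs_cases k) => [->|bk]; last by rewrite divfK // gt_eqF.
by rewrite !mulr0 soft_eq0 // normr0.
Qed.

Lemma softv_lip a y z k : 0 <= a -> `|softv a y 0 k - softv a z 0 k| <= `|y 0 k - z 0 k|.
Proof.
move=> a0; case: (mean_abs_cases k) => [bk|bk]; first by rewrite !mxE bk invr0 !mulr0 subrr normr0.
rewrite -(ler_pM2r bk) -{1 2}(gtr0_norm bk) -!normrM !mulrBl !softv_mul //; exact: soft_lip.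
Qed.

Lemma softv0 a : 0 <= a -> softv a 0 = 0.
Proof.
move=> a0; apply/rowP => k; rewrite !mxE mul0r soft_eq0 ?mul0r // normr0 //.
Qed.

(** The level splits as [2 ^+ 23 + 2 ^+ 22 + 2 ^+ 22]. The two clamped parts cost
    [12 * expR (- (8 * p))] together, less than half of [expR (- p)]. *)
Lemma pr_tail_softvB (m p : R) (y z : 'rV[R]_d) : 0 < m -> 1 <= p ->
  \sum_k Num.min ((y 0 k * b k) ^+ 2) ((m / p) ^+ 2) <= 64 * m ^+ 2 / p ->
  \sum_k Num.min ((z 0 k * b k) ^+ 2) ((m / p) ^+ 2) <= 64 * m ^+ 2 / p ->
  expR (- p) <= pr P (tail X (y - z) (2 ^+ 24 * m)) ->
  expR (- p) / 2 <= pr P (tail X (softv (m / p) y - softv (m / p) z) (2 ^+ 23 * m)).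
Proof.
move=> m0 p1 hy hz; set a := m / p.
have a0 : 0 < a by rewrite divr_gt0 //; lra.
have small (x : 'rV[R]_d) : \sum_k Num.min ((x 0 k * b k) ^+ 2) (a ^+ 2) <= 64 * m ^+ 2 / p ->
    pr P (tail X (clampv a x) (2 ^+ 22 * m)) <= 6 * expR (- (8 * p)).
  move=> hx; apply: (pr_tail_spread HU HL bE) => // [k|k|].
  - by case: (mean_abs_cases k) => bk; [left; rewrite mxE bk invr0 mulr0|right].
  - rewrite mxE; case: (mean_abs_cases k) => [->|bk]; first by rewrite mulr0 ltW.
    by rewrite -[X in _ * X <= _](gtr0_norm bk) -normrM divfK ?gt_eqF // norm_clamp_le // ltW.
  apply: le_trans hx; apply: ler_sum => k _; rewrite mxE -sqr_clamp ?(ltW a0) //.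
  case: (mean_abs_cases k) => [->|bk]; last by rewrite divfK ?gt_eqF.
  by rewrite !mulr0 expr0n /= sqr_ge0.
have -> : y - z = (softv a y - softv a z) + (clampv a y + - clampv a z) + (nullv y - nullv z).
  rewrite {1}(soft_clamp_null a y) {1}(soft_clamp_null a z).
  by apply/rowP => k; rewrite !mxE; ring.
have -> : 2 ^+ 24 * m = 2 ^+ 23 * m + (2 ^+ 22 * m + 2 ^+ 22 * m).
  by rewrite !exprS; ring.
move=> h; have := le_trans h (pr_tail_add_null HU HL bE _ _ _).
have nk k : (nullv y - nullv z) 0 k = 0 \/ b k = 0.
  by rewrite !mxE; case: eqVneq => bk; [right|left; rewrite subrr].
move=> /(_ nk) h1; have h2 := le_trans h1 (pr_tailD X _ _ _ _).
have h3 := le_trans h2 (lerD (lexx _) (pr_tailD X _ _ _ _)); rewrite tailN in h3.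
have := small y hy; have := small z hz; move: h3.
have : 24 * expR (- (8 * p)) <= expR (- p).
  have -> : expR (- p) = expR (7 * p) * expR (- (8 * p)) by rewrite -expRD; congr expR; ring.
  rewrite ler_wpM2r ?expR_ge0 //; apply: le_trans (@natr_le_expR R 7 _ _); last by lra.
  by rewrite -natrX ler_nat.
lra.
Qed.

Definition off (J : {set 'I_d}) (y : 'rV[R]_d) : 'rV[R]_d := \row_k (if k \in J then 0 else y 0 k).

(** The kernel part costs [expR (- p) / 4] at level [2 * m]; what remains is shared by the two outer
    parts, and [2 + 160 + 160 <= 2 ^+ 23]. *)
Lemma pr_tail_off (J : {set 'I_d}) (m p : R) (y z : 'rV[R]_d) : 0 < m -> 1 <= p ->
  #|J|%:R <= 64 * p ->
  (forall k, y 0 k = z 0 k \/ 0 < b k) ->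
  (forall k, k \in J -> `|y 0 k - z 0 k| * b k <= m / (2 ^+ 15 * p ^+ 2)) ->
  expR (- p) / 2 <= pr P (tail X (y - z) (2 ^+ 23 * m)) ->
  2 * (expR (- p) / 8) <= pr P (tail X (off J y) (160 * m)) + pr P (tail X (off J z) (160 * m)).
Proof.
move=> m0 p1 Jp yz yzJ.
pose ka : 'rV[R]_d := \row_k (if k \in J then y 0 k - z 0 k else 0).
have hka : pr P (tail X ka (2 * m)) <= expR (- p) / 4.
  apply: (pr_tail_kernel HU HL bE m0 p1 Jp) => k; rewrite mxE.
    case: ifP => kJ; last by left.
    by case: (yz k) => [->|bk]; [left; rewrite subrr|right].
  case: ifP => [/yzJ//|_]; rewrite normr0 mul0r; apply: divr_ge0; first exact: ltW.
  by rewrite mulr_ge0 ?exprn_ge0 ?ler0n //; lra.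
have -> : y - z = ka + (off J y + - off J z).
  by apply/rowP => k; rewrite !mxE; case: ifP => _; ring.
have m23 : 2 * m + (160 * m + 160 * m) <= 2 ^+ 23 * m.
  have : 322 <= 2 ^+ 23 :> R by rewrite -natrX ler_nat.
  move=> /(ler_wpM2r (ltW m0)); lra.
move=> h; have h1 := le_trans h (le_pr_tail X _ m23).
have h2 := le_trans h1 (pr_tailD X _ _ _ _).
have := le_trans h2 (lerD (lexx _) (pr_tailD X _ _ _ _)); rewrite tailN; lra.
Qed.

End Splitting.

(** * Bound on the size of a separated family *)

Section SeparatedFamily.
Context {R : realType} {d0 : measure_display} {Omega : measurableType d0}.
Context (P : probability Omega R) (d : nat) (X : 'I_d -> {RV P >-> R}).
Hypothesis HU : unconditional_vec X.
Hypothesis HL : log_concave_vec X.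

Lemma natr_truncn_le (x : R) : 0 <= x -> (Num.truncn x)%:R <= x.
Proof. by move=> /truncn_itv/andP[]. Qed.

Lemma le_truncn_nat (x : R) (n : nat) : n%:R <= x -> (n <= Num.truncn x)%N.
Proof.
move=> nx; have x0 : 0 <= x by apply: le_trans nx; rewrite ler0n.
have /andP[_ h] := truncn_itv x0; rewrite -ltnS -(ltr_nat R).
exact: le_lt_trans h.
Qed.

Lemma quantize (de L : R) : 0 < de -> 0 <= L ->
  exists col : R -> 'I_(Num.truncn (2 * L / de)).+1, forall x y, `|x| <= L -> `|y| <= L -> col x = col y -> `|x - y| <= de.
Proof.
move=> de0 L0; set c := Num.truncn (2 * L / de); exists (fun x => inord (Num.truncn ((x + L) / de))) => x y.
have h z : `|z| <= L -> 0 <= (z + L) / de /\ (Num.truncn ((z + L) / de) < c.+1)%N.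
  rewrite ler_norml => /andP[z1 z2]; have zL : 0 <= (z + L) / de.
    by rewrite divr_ge0 ?(ltW de0) //; lra.
  split => //; rewrite ltnS; apply: le_truncn_nat; apply: le_trans (natr_truncn_le zL) _.
  by rewrite ler_pM2r ?invr_gt0 //; lra.
move=> /h[x0 xc] /h[y0 yc] /(congr1 val) /=; rewrite !inordK // => E.
have /andP[x1 x2] := truncn_itv x0; have /andP[y1 y2] := truncn_itv y0.
move: x1 x2 y1 y2; rewrite E -natr1; move: (Num.truncn _)%:R => T.
rewrite ler_pdivlMr // ler_pdivlMr // ltr_pdivrMr // ltr_pdivrMr // mulrDl mul1r.
by move: (T * de) => S x1 x2 y1 y2; rewrite ler_norml; apply/andP; split; lra.
Qed.

Lemma card_separated_family_lt (I : finType) (t : I -> 'rV[R]_d) (m p : R) : 0 < m -> 1 <= p ->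
  (forall s, Emax X s (fun i => t i - t s) <= m) ->
  (forall i j, i != j -> expR (- p) <= pr P (tail X (t i - t j) (2 ^+ 24 * m))) ->
  #|I|%:R < expR (4096 * p ^+ 2).
Proof.
move=> m0 p1 H1 H2; rewrite ltNge; apply/negP => cI.
have p0 : 0 < p by lra.
pose b k := Ex P (fun w => `|X k w|); have bE k : b k = Ex P (fun w => `|X k w|) by [].
move: bE; move: b => b bE.
pose a := m / p; have a0 : 0 < a by exact: divr_gt0.
have /card_gt0P[i0 _] : (0 < #|I|)%N.
  by rewrite -(ltr_nat R); apply: lt_le_trans cI; exact: expR_gt0.
pose x i := ext (fun k => t i 0 k * b k).
have Hx i1 s : ravg d (fun e => mx i1 (fun i => rdot e (x i) - rdot e (x s))) <= m.
  apply: le_trans (H1 s).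
  apply: le_trans (rademacher_le_Emax HU HL bE (x := fun i => t i - t s) (subrr _)).
  apply: le_ravg => e _; apply: le_mx_mx => i; rewrite -rdotB le_eqVlt; apply/orP; left; apply/eqP.
  apply: eq_rdot => k; rewrite /x /ext; case: insub => [k'|] /=; rewrite ?subr0 // !mxE; ring.
have [s hs] := exists_dense_ball m0 p0 (erefl a) (Hx i0).
pose y i := t i - t s.
have xy i (k : 'I_d) : x i k - x s k = y i 0 k * b k by rewrite /x !ext_ord /y !mxE; ring.
set T1 := [set i | _ <= _]%SET in hs.
have yT i : i \in T1 -> \sum_k Num.min ((y i 0 k * b k) ^+ 2) (a ^+ 2) <= 64 * m ^+ 2 / p.
  rewrite finset.inE /trunc_dist => h; under eq_bigr do rewrite -xy.
  by apply: (le_trans h); rewrite /a le_eqVlt; apply/orP; left; apply/eqP; field; lra.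
(* From the l2 bound [12 * m ^+ 2]; a bounded range is needed for finitely many colours. *)
have y4 i k : `|y i 0 k * b k| <= 4 * m.
  have := sum_sqr_le_rademacher i m0 (Hx s s); rewrite (bigD1 k) //= xy => h.
  have : (y i 0 k * b k) ^+ 2 <= (4 * m) ^+ 2.
    have S0 : 0 <= \sum_(i1 < d | i1 != k) (x i i1 - x s i1) ^+ 2 by apply: sumr_ge0 => ? _; exact: sqr_ge0.
    have m2 : 0 <= m ^+ 2 := sqr_ge0 _.
    by move: h S0; move: (\sum_(_ | _) _) => Z h S0; rewrite exprMn; lra.
  by rewrite -[X in X <= _](real_normK (num_real _)) ler_pXn2r ?nnegrE // mulr_ge0 ?(ltW m0).
pose u i := softv b a (y i).
have us : u s = 0 by rewrite /u /y subrr softv0 // ltW.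
have ulip i j k : `|u i 0 k - u j 0 k| <= `|y i 0 k - y j 0 k| by apply: (softv_lip bE); exact: ltW.
(* Each coordinate in [S i] adds [a ^+ 2 = m ^+ 2 / p ^+ 2] to a truncated distance of at most
   [64 * m ^+ 2 / p], so there are at most [64 * p] of them. *)
pose S i := [set k | a < `|y i 0 k * b k|]%SET.
pose q := Num.truncn (64 * p).
have p64 : 0 <= 64 * p by lra.
have Sq i : i \in T1 -> (#|S i| <= q)%N.
  move=> /yT h; apply: le_truncn_nat; have a2 : 0 < a ^+ 2 by rewrite exprn_gt0.
  rewrite -(ler_pM2r a2).
  apply: le_trans (le_trans _ h) _; last by rewrite le_eqVlt; apply/orP; left; apply/eqP; rewrite /a; field; lra.
  rewrite mulr_natl -sumr_const [X in X <= _]big_mkcond; apply: ler_sum => k _.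
  rewrite finset.inE; case: ifP => [h1|_]; last by rewrite le_min !sqr_ge0.
  rewrite le_min lexx andbT -[X in _ <= X](real_normK (num_real _)) ler_pXn2r ?nnegrE //; exact: ltW.
have uS i k : k \notin S i -> u i 0 k = 0.
  by rewrite finset.inE -leNgt => h; rewrite /u mxE soft_eq0 ?mul0r // ltW.
(* The discrepancy tolerated on the kernel by [pr_tail_kernel]; the range [8 * m] then needs about
   [2 ^+ 18 * p ^+ 2] colours. *)
pose de := m / (2 ^+ 15 * p ^+ 2).
have de0 : 0 < de by rewrite /de divr_gt0 // mulr_gt0 ?exprn_gt0.
have m4 : 0 <= 4 * m by lra.
have [qz qzP] := quantize de0 m4; set c := (Num.truncn _).+1 in qz qzP.
have cE : c%:R <= 2 ^+ 18 * p ^+ 2 + 1 :> R.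
  have E : 2 * (4 * m) / de = 2 ^+ 18 * p ^+ 2 by rewrite /de; field; lra.
  rewrite /c E -natr1 lerD2r; apply: natr_truncn_le; apply: mulr_ge0; apply: exprn_ge0 => //.
  exact: ltW.
pose col i k := qz (u i 0 k * b k).
have ub i k : `|u i 0 k * b k| <= 4 * m.
  by rewrite /u (softv_mul bE) ?(ltW a0) // (le_trans (norm_soft_le (ltW a0) _)).
(* The integer part plus 2, so that even [N0 - 1] is at least [41 * expR p]. *)
pose N0 := (Num.truncn (41 * expR p)).+2.
have e41 : 0 <= 41 * expR p by rewrite mulr_ge0 ?expR_ge0.
have cardT1 : ((N0 * q * c + 1) ^ q * N0 <= #|T1|)%N.
  rewrite leqNgt; apply/negP; rewrite -(ltr_nat R) => lt.
  have hN : N0%:R <= 41 * expR p + 2.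
    by rewrite /N0 -addn2 natrD lerD2r natr_truncn_le.
  have := sunflower_size_bound p1 hN (natr_truncn_le p64) cE; rewrite ltNge => /negP; apply.
  apply: (le_trans cI); apply: (le_trans hs).
  by rewrite ler_wpM2l ?mulr_ge0 ?expR_ge0 // ltW.
have MN : (N0 * q * c < N0 * q * c + 1)%N by rewrite addn1.
have [J [T' [T'T1 N0T' Jq disj colJ]]] := Sunflower.sunflower col MN Sq cardT1.
have Jp : #|J|%:R <= 64 * p by apply: le_trans (natr_truncn_le p64); rewrite ler_nat.
have T1T i : i \in T' -> i \in T1 by move/fintype.subsetP: T'T1 => /(_ i).
pose w i := off J (u i).
have wlip i j k : `|w i 0 k - w j 0 k| <= `|u i 0 k - u j 0 k|.
  by rewrite !mxE; case: ifP => // _; rewrite subrr normr0.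
have ws : w s = 0 by apply/rowP => k; rewrite mxE us !mxE; case: ifP.
(* Thresholding and erasing coordinates are 1-Lipschitz in each coordinate, so contraction carries
   the bound [m] from the original points to the disjoint parts. *)
have Ew (g : I -> 'rV[R]_d) : g s = 0 ->
    (forall i j k, `|g i 0 k - g j 0 k| <= `|u i 0 k - u j 0 k|) -> Emax X s g <= m.
  move=> gs gl; apply: le_trans (H1 s); apply: (Emax_contraction HU HL) => // [|k i j].
    by rewrite subrr.
  exact: le_trans (gl i j k) (ulip i j k).
have wN i j k : `|(- w i) 0 k - (- w j) 0 k| <= `|u i 0 k - u j 0 k|.
  by rewrite [(- w i) 0 k]mxE [(- w j) 0 k]mxE -opprD normrN; exact: wlip.
have wNs : - w s = 0 by rewrite ws oppr0.
have hb := pr_all_small_of_Emax HU HL m0 ws (Ew w ws wlip) (Ew (fun i => - w i) wNs wN).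
have hp i j : i \in T' -> j \in T' -> i != j ->
    2 * (expR (- p) / 8) <= pr P (tail X (w i) (160 * m)) + pr P (tail X (w j) (160 * m)).
  move=> iT jT ij; apply: (pr_tail_off HU HL bE m0 p1 Jp) => [k|k kJ|].
  - by case: (mean_abs_cases bE k) => bk; [left; rewrite !mxE bk invr0 !mulr0|right].
  - have bk0 := mean_abs_ge0 bE k; rewrite -[X in _ * X <= _](ger0_norm bk0) -normrM mulrBl.
    by apply: (qzP _ _ (ub i k) (ub j k)); exact: (colJ i j k iT jT kJ).
  apply: (pr_tail_softvB HU HL bE m0 p1 (yT i (T1T i iT)) (yT j (T1T j jT))).
  by rewrite (_ : y i - y j = t i - t j) ?H2 // /y opprB addrA subrK.
pose v (k : 'I_#|T'|) := w (enum_val k).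
have vi (i j : 'I_#|T'|) : i != j -> enum_val i != enum_val j.
  by apply: contraNN => /eqP/enum_val_inj ->.
have vd i j k : i != j -> v i 0 k = 0 \/ v j 0 k = 0.
  move=> /vi ij; have wE l : w l 0 k = if k \in J then 0 else u l 0 k by rewrite mxE.
  rewrite /v !wE.
  have := disj _ _ (enum_valP i) (enum_valP j) ij.
  case: ifP => kJ dj; first by left.
  have [iS|/uS] := boolP (k \in S (enum_val i)); last by left.
  right; apply: uS; apply/negP => jS.
  have /(_ k) := fintype.disjointFr dj; rewrite !finset.in_setD kJ iS jS => /(_ isT).
  by [].
have e0 : 0 <= expR (- p) / 8 by rewrite divr_ge0 ?expR_ge0.
have hbv : 1 / 2 <= pr P [set o | forall k, `|dotv (v k) (rvec X o)| <= 4 * m].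
  apply: (le_trans hb); apply: le_pr => [||o h k]; last exact: h.
  - apply: measurable_forall => i; apply: measurable_set_le => //; apply: itg_meas; apply: itg_norm.
    exact: (itg_dotv HU HL).
  - apply: measurable_forall => i; apply: measurable_set_le => //; apply: itg_meas; apply: itg_norm.
    exact: (itg_dotv HU HL).
have hpv (i j : 'I_#|T'|) : i != j ->
    2 * (expR (- p) / 8) <= pr P (tail X (v i) (160 * m)) + pr P (tail X (v j) (160 * m)).
  by move=> /vi ij; apply: hp => //; exact: enum_valP.
have := card_disjoint_large HU HL m0 e0 vd hbv hpv.
have : (41 * expR p) * (expR (- p) / 8) <= (#|T'|%:R - 1) * (expR (- p) / 8).
  rewrite ler_wpM2r // lerBrDr; apply: (@le_trans _ _ N0%:R); last by rewrite ler_nat.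
  by have /andP[_ /ltW h] := truncn_itv e41; rewrite /N0 -[leRHS]natr1 lerD2r.
have -> : 41 * expR p * (expR (- p) / 8) = 41 / 8 * (expR p * expR (- p)) by field.
rewrite expRxMexpNx_1; lra.
Qed.

End SeparatedFamily.

(** * Suprema over finite subfamilies and symmetry of the mean *)

Section Suprema.
Context {R : realType} {d0 : measure_display} {Omega : measurableType d0}.
Context (P : probability Omega R).

Lemma finite_set_range (K : choiceType) (F : set K) : finite_set F -> F !=set0 ->
  exists (I : finType) (i0 : I) (f : I -> K), F = range f.
Proof.
move=> /finite_seqP[s ->] [k ks]; exists (seq_sub s : finType), (SeqSub ks), (@ssval _ s).
apply/seteqP; split => [x /= xs|x [y _ <-]]; last exact: ssvalP.
by exists (SeqSub xs).
Qed.

Lemma ereal_sup_range (I : finType) (i0 : I) (g : I -> R) :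
  ereal_sup [set (g i)%:E | i in [set: I]] = (mx i0 g)%:E.
Proof.
apply/le_anti/andP; split.
  by apply: ge_ereal_sup => _ [i _ <-]; rewrite lee_fin; exact: le_mx.
by have [i ->] := mx_attained i0 g; apply: ereal_sup_ubound; exists i.
Qed.

Lemma integral_sup_range (K : Type) (Y : K -> Omega -> R) (I : finType) (i0 : I) (f : I -> K) :
  (forall k, itg P (Y k)) ->
  (\int[P]_w ereal_sup [set (Y k w)%:E | k in range f] =
   (Ex P (fun w => mx i0 (fun i => Y (f i) w)))%:E)%E.
Proof.
move=> iY; have im : itg P (fun w => mx i0 (fun i => Y (f i) w)) by apply: itg_mx.
rewrite /Ex /Rintegral (fineK (integrable_fin_num measurableT im)).
apply: eq_integral => w _; rewrite /= -ereal_sup_range; congr ereal_sup.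
apply/seteqP; split => [_ [_ [i _ <-] <-]|_ [i _ <-]]; first by exists i.
by exists (f i) => //; exists i.
Qed.

(** The empty set is among the finite subsets in [Esup]; it contributes the bottom element, harmless
    in a supremum. *)
Lemma integral_sup0 (K : Type) (Y : K -> Omega -> R) :
  (\int[P]_w ereal_sup [set (Y k w)%:E | k in set0] = -oo)%E.
Proof.
under eq_integral do rewrite image_set0 ereal_sup0.
rewrite integral_cst //=.
by rewrite probability_setT mule1.
Qed.

Lemma Esup_range_ge (K : Type) (T : set K) (Y : K -> Omega -> R) (I : finType) (i0 : I) (f : I -> K) :
  (forall k, itg P (Y k)) -> range f `<=` T ->
  ((Ex P (fun w => mx i0 (fun i => Y (f i) w)))%:E <= Esup P T Y)%E.
Proof.
move=> iY fT; rewrite -integral_sup_range //; apply: ereal_sup_ubound; exists (range f) => //.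
by split => //; apply: finite_image; exact: finite_finset.
Qed.

Lemma Esup_le (K : choiceType) (T : set K) (Y : K -> Omega -> R) (M : \bar R) :
  (forall k, itg P (Y k)) ->
  (forall (I : finType) (i0 : I) (f : I -> K), range f `<=` T ->
    ((Ex P (fun w => mx i0 (fun i => Y (f i) w)))%:E <= M)%E) ->
  (Esup P T Y <= M)%E.
Proof.
move=> iY h; apply: ge_ereal_sup => _ [F [FT finF] <-].
have [->|/set0P F0] := eqVneq F set0; first by rewrite integral_sup0 leNye.
have [I [i0 [f fE]]] := finite_set_range finF F0.
by rewrite fE (integral_sup_range i0) //; apply: h; rewrite -fE.
Qed.

Context (d : nat) (X : 'I_d -> {RV P >-> R}).
Hypothesis HU : unconditional_vec X.
Hypothesis HL : log_concave_vec X.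

Lemma flip_opp (z : 'rV[R]_d) : flip (fun=> -1) z = - z.
Proof. by apply/rowP => k; rewrite !mxE mulN1r. Qed.

Lemma mx_bool (g : bool -> R) : mx false g = Num.max (g false) (g true).
Proof.
apply/le_anti/andP; split; last by rewrite ge_max !le_mx.
by apply/mx_leP => -[]; rewrite le_max lexx ?orbT.
Qed.

(** [Emax_flip] on the pair [0, z] equates the means of the positive and negative parts. *)
Lemma Ex_dotv z : Ex P (fun w => dotv z (rvec X w)) = 0.
Proof.
pose x (c : bool) := if c then z else 0.
have E := Emax_flip HU (i0 := false) (x := x) (eta := fun=> -1) erefl (fun=> or_intror erefl).
have i1 : itg P (fun w => mx false (fun c => dotv (x c) (rvec X w))).
  by apply: itg_mx => c; exact: (itg_dotv HU HL).
have i2 : itg P (fun w => mx false (fun c => dotv (flip (fun=> -1) (x c)) (rvec X w))).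
  by apply: itg_mx => c; exact: (itg_dotv HU HL).
have -> : (fun w => dotv z (rvec X w)) = fun w => mx false (fun c => dotv (x c) (rvec X w)) +
    -1 * mx false (fun c => dotv (flip (fun=> -1) (x c)) (rvec X w)).
  apply: funext => w; rewrite !mx_bool /x /= !flip_opp oppr0 dotv0 dotvNl.
  by case: (lerP 0 (dotv z _)) => h; [rewrite max_l|rewrite max_r]; lra.
rewrite ExD ?ExZ //; last exact: itgZ.
by move: E; rewrite /Emax => ->; rewrite mulN1r subrr.
Qed.

Lemma Emax_translate (I : finType) (i0 : I) (x : I -> 'rV[R]_d) z :
  Emax X i0 (fun i => x i - z) = Emax X i0 x.
Proof.
have ix (y : I -> 'rV[R]_d) : itg P (fun w => mx i0 (fun i => dotv (y i) (rvec X w))).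
  by apply: itg_mx => i; exact: (itg_dotv HU HL).
have iz : itg P (fun w => -1 * dotv z (rvec X w)) by apply: itgZ; exact: (itg_dotv HU HL).
have -> : Emax X i0 (fun i => x i - z) =
    Ex P (fun w => mx i0 (fun i => dotv (x i) (rvec X w)) + -1 * dotv z (rvec X w)).
  apply: eq_Ex => w; apply/le_anti/andP; split.
    apply/mx_leP => i; rewrite dotvBl mulN1r lerB //.
    exact: (le_mx i0 (fun i => dotv (x i) (rvec X w))).
  have [i ->] := mx_attained i0 (fun i => dotv (x i) (rvec X w)).
  by rewrite mulN1r -dotvBl; exact: (le_mx i0 (fun i => dotv (x i - z) (rvec X w))).
rewrite ExD // ExZ ?Ex_dotv ?mulr0 ?addr0 //; exact: (itg_dotv HU HL).
Qed.

Lemma Emax_opp (I : finType) (i0 : I) (x : I -> 'rV[R]_d) :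
  Emax X i0 (fun i => - x i) = Emax X i0 x.
Proof.
rewrite -(Emax_translate i0 (fun i => - x i) (- x i0)) -[RHS](Emax_translate i0 x (x i0)).
rewrite -[RHS](Emax_flip HU (eta := fun=> -1)) ?subrr // => [|i]; last by right.
by congr Emax; apply: funext => i; rewrite flip_opp opprB opprK addrC.
Qed.

(** A maximum of differences is at most [max f1 + max (- f2)], and negation does not change the mean
    by [Emax_opp]. Conversely, over all pairs of a finite family the maximal difference equals this
    sum. *)
Lemma Esup_diff (T : set 'rV[R]_d) :
  Esup P (T `*` T) (fun ts w => dotv (ts.1 - ts.2) (rvec X w)) =
  (2%:E * Esup P T (fun t w => dotv t (rvec X w)))%E.
Proof.
have iY t : itg P (fun w => dotv t (rvec X w)) by exact: (itg_dotv HU HL).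
have iZ (ts : 'rV[R]_d * 'rV[R]_d) : itg P (fun w => dotv (ts.1 - ts.2) (rvec X w)) by exact: iY.
have ix (I : finType) (i0 : I) (y : I -> 'rV[R]_d) : itg P (fun w => mx i0 (fun i => dotv (y i) (rvec X w))).
  exact: itg_mx.
apply/le_anti/andP; split.
  apply: Esup_le => // I i0 f fT.
  have f1T : range (fun i => (f i).1) `<=` T by move=> _ [i _ <-]; have [] := fT (f i) (ex_intro2 _ _ i Logic.I erefl).
  have f2T : range (fun i => (f i).2) `<=` T by move=> _ [i _ <-]; have [] := fT (f i) (ex_intro2 _ _ i Logic.I erefl).
  have h1 := Esup_range_ge i0 iY f1T; have h2 := Esup_range_ge i0 iY f2T.
  have -> : (2%:E * Esup P T (fun t w => dotv t (rvec X w)) =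
    Esup P T (fun t w => dotv t (rvec X w)) + Esup P T (fun t w => dotv t (rvec X w)))%E.
    by rewrite mule_natl mule2n.
  apply: le_trans (leeD h1 h2); rewrite -EFinD lee_fin.
  rewrite -[X in _ <= _ + X](Emax_opp i0 (fun i => (f i).2)) /Emax -ExD //.
  apply: le_Ex => [||w]; [exact: itg_mx|exact: itgD|].
  apply/mx_leP => i; rewrite dotvDl; apply: lerD.
    exact: (le_mx i0 (fun i => dotv (f i).1 (rvec X w))).
  exact: (le_mx i0 (fun i => dotv (- (f i).2) (rvec X w))).
rewrite -lee_pdivlMl //; apply: Esup_le => // I i0 f fT; rewrite lee_pdivlMl // -EFinM.
pose g (ij : I * I) := (f ij.1, f ij.2).
have gT : range g `<=` T `*` T.
  by move=> _ [[i j] _ <-]; split; apply: fT; [exists i|exists j].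
apply: le_trans (Esup_range_ge (i0, i0) iZ gT); rewrite lee_fin mulrDl mul1r.
rewrite -[X in _ + X](Emax_opp i0 f) /Emax -ExD //.
apply: le_Ex => [||w]; [exact: itgD|exact: itg_mx|].
have [i ->] := mx_attained i0 (fun i => dotv (f i) (rvec X w)).
have [j ->] := mx_attained i0 (fun i => dotv (- f i) (rvec X w)).
rewrite -dotvDl.
exact: (le_mx (i0, i0) (fun ij : I * I => dotv ((g ij).1 - (g ij).2) (rvec X w)) (i, j)).
Qed.

End Suprema.

(** * The lower bound and the theorem *)

Section LowerBound.
Context {R : realType} {d0 : measure_display} {Omega : measurableType d0}.
Context (P : probability Omega R) (d : nat) (X : 'I_d -> {RV P >-> R}).
Hypothesis HU : unconditional_vec X.
Hypothesis HL : log_concave_vec X.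

Let Z (ts : 'rV[R]_d * 'rV[R]_d) w := dotv (ts.1 - ts.2) (rvec X w).

Let itg_diff ts : itg P (Z ts).
Proof. exact: (itg_dotv HU HL). Qed.

Lemma pr_tail_of_separated (p A : R) (z : 'rV[R]_d) : 1 <= p -> 0 < A ->
  (A%:E <= 'N[P]_(p%:E)[(fun w => (dotv z (rvec X w))%:E)])%E ->
  expR (- (p / 64)) <= pr P (tail X z (A / 1024)).
Proof.
move=> p1 A0 h; apply: (pr_tail_ge_of_moment HU HL p1); first by apply: divr_gt0 A0 _; rewrite ltr0n.
(* The moment lemma wants a strict inequality; [512 * (A / 1024)] is half of [A]. *)
by apply: lt_le_trans h; rewrite lte_fin; lra.
Qed.

(** The pairs [(t, s)] and [(s, t)] together have maximum [|<t - s, X>|], and Markov bounds its mean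
    from below. *)
Lemma Esup_ge_of_tail (T : set 'rV[R]_d) (t s : 'rV[R]_d) (u c : R) : T t -> T s -> 0 < u ->
  c <= pr P (tail X (t - s) u) -> ((u * c)%:E <= Esup P (T `*` T) Z)%E.
Proof.
move=> Tt Ts u0 hc; pose f (a : bool) := if a then (t, s) else (s, t).
have fT : range f `<=` T `*` T by move=> _ [[] _ <-].
apply: le_trans (Esup_range_ge true itg_diff fT); rewrite lee_fin.
have iY : itg P (fun w => `|dotv (t - s) (rvec X w)|) by apply: itg_norm; exact: (itg_dotv HU HL).
apply: (@le_trans _ _ (Ex P (fun w => `|dotv (t - s) (rvec X w)|))).
  have := markov_pr iY (fun w => normr_ge0 _) u0; rewrite ler_pdivlMr // mulrC.
  by apply: le_trans; rewrite ler_pM2l.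
apply: le_Ex => // [|w]; first exact: itg_mx.
have [h|h] := lerP 0 (dotv (t - s) (rvec X w)).
  rewrite ger0_norm //; exact: (le_mx true (fun a => Z (f a) w) true).
rewrite ltr0_norm // -dotvNl opprB.
exact: (le_mx true (fun a => Z (f a) w) false).
Qed.

Lemma Esup_lower_bound (T : set 'rV[R]_d) (I : finType) (x : I -> 'rV[R]_d) (p A : R) :
  1 <= p -> 0 < A -> injective x -> (forall i, T (x i)) -> expR (p ^+ 2) <= #|I|%:R ->
  (forall t s, T t -> T s -> t <> s ->
     (A%:E <= 'N[P]_(p%:E)[(fun w => (dotv (t - s) (rvec X w))%:E)])%E) ->
  ((A / 2 ^+ 34)%:E <= Esup P (T `*` T) Z)%E.
Proof.
move=> p1 A0 xinj tT cB sep.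
have hs (i j : I) : i != j -> expR (- (p / 64)) <= pr P (tail X (x i - x j) (A / 1024)).
  move=> ij; apply: (pr_tail_of_separated p1 A0 (sep _ _ (tT i) (tT j) _)) => /xinj E.
  by rewrite E eqxx in ij.
have [p64|p64] := leP 64 p.
  rewrite leNgt; apply/negP => small.
  have p' : 1 <= p / 64 by rewrite ler_pdivlMr //; lra.
  have m0 : 0 < A / 2 ^+ 34 by apply: divr_gt0 A0 _; rewrite exprn_gt0 // ltr0n.
  have H1 (s : I) : Emax X s (fun i => x i - x s) <= A / 2 ^+ 34.
    pose g i := (x i, x s).
    have gT : range g `<=` T `*` T by move=> _ [i _ <-]; split; exact: tT.
    rewrite -lee_fin; apply: le_trans (ltW small); exact: (Esup_range_ge s itg_diff gT).
  have H2 (i j : I) : i != j -> expR (- (p / 64)) <= pr P (tail X (x i - x j) (2 ^+ 24 * (A / 2 ^+ 34))).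
    have -> : 2 ^+ 24 * (A / 2 ^+ 34) = A / 1024 by field.
    exact: hs.
  have := card_separated_family_lt HU HL m0 p' H1 H2.
  rewrite (_ : 4096 * (p / 64) ^+ 2 = p ^+ 2); last by field.
  by rewrite ltNge cB.
(* Here [p < 64], so the tail probability of one difference is at least [expR (- 1) >= 1 / 4], and
   any two points suffice. *)
have /card_gt1P[i [j [_ _ ij]]] : (1 < #|I|)%N.
  rewrite -(ltr_nat R); apply: lt_le_trans cB.
  have := expR_ge1Dx (p ^+ 2); have : 1 <= p ^+ 2 by rewrite exprn_ege1.
  lra.
have e4 : 1 / 4 <= expR (- (p / 64)).
  apply: (@le_trans _ _ (expR (- 1))); last by rewrite ler_expR; lra.
  have h := @exp_half_le2 R (1 / 2) (lexx _); have h0 := expR_gt0 (1 / 2 : R).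
  have E : expR (- 1) * (expR (1 / 2) * expR (1 / 2)) = 1 :> R.
    by rewrite -!expRD (_ : -1 + (1 / 2 + 1 / 2) = 0) ?expR0 //; field.
  have h4 : expR (1 / 2) * expR (1 / 2) <= 4 :> R by have := ler_pM (ltW h0) (ltW h0) h h; lra.
  by have := ler_wpM2l (expR_ge0 (-1)) h4; rewrite E; lra.
have A1 : 0 < A / 1024 by apply: divr_gt0 A0 _; rewrite ltr0n.
apply: le_trans (Esup_ge_of_tail (tT i) (tT j) A1 (le_trans e4 (hs i j ij))).
rewrite lee_fin -mulrA ler_wpM2l ?(ltW A0) //.
have -> : 1024^-1 * (1 / 4) = (2 ^+ 12)^-1 :> R by field.
by rewrite lef_pV2 ?posrE ?exprn_gt0 // ler_eXn2l // ltr1n.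
Qed.

End LowerBound.

Lemma exists_finite_family (K : choiceType) (T : set K) (R : realType) (r : R) :
  infinite_set T \/ (exists n : nat, (T #= `I_n)%card /\ r <= n%:R) ->
  exists (I : finType) (x : I -> K), [/\ injective x, forall i, T (x i) & r <= #|I|%:R].
Proof.
move=> h; have [s [us sT rs]] : exists s : seq K,
    [/\ uniq s, forall y, y \in s -> T y & r <= (size s)%:R].
  case: h => [infT|[n [Tn rn]]].
    have [n rn] : exists n : nat, r <= n%:R.
      have [r0|/ltW r0] := lerP 0 r; last by exists 0%N.
      by exists (Num.truncn r).+1; have /andP[_ /ltW] := truncn_itv r0.
    have [B BT nB] := infinite_set_fset n infT; exists (finmap.enum_fset B).
    split; [exact: finmap.fset_uniq|exact: BT|].
    by apply: (le_trans rn); rewrite ler_nat.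
  have /finite_fsetP[B TB] : finite_set T by apply/finite_setP; exists n.
  exists (finmap.enum_fset B); split; first exact: finmap.fset_uniq.
    by rewrite TB.
  by rewrite TB in Tn; move/card_eq_fsetP: Tn => ->.
exists (seq_sub s : finType), (@ssval _ s).
by split => [|i|]; [exact: val_inj|apply: sT; exact: ssvalP|rewrite card_seq_sub].
Qed.
Theorem theorem4p3 :
  exists C : nat, (0 < C)%N /\
  forall (R : realType) (d0 : measure_display) (Omega : measurableType d0)
    (P : probability Omega R) (d : nat) (X : 'I_d -> {RV P >-> R})
    (p A : R) (T : set 'rV[R]_d),
    unconditional_vec X -> log_concave_vec X ->
    1 <= p -> 0 < A ->
    (infinite_set T \/ exists n : nat, (T #= `I_n)%card /\ expR (p ^+ 2) <= n%:R) ->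
    (forall t s, T t -> T s -> t <> s ->
       (A%:E <= 'N[P]_(p%:E)[(fun w => (dotv (t - s) (rvec X w))%:E)])%E) ->
    Esup P (T `*` T) (fun ts w => dotv (ts.1 - ts.2) (rvec X w))
      = (2%:E * Esup P T (fun t w => dotv t (rvec X w)))%E /\
    ((A / C%:R)%:E <= Esup P (T `*` T) (fun ts w => dotv (ts.1 - ts.2) (rvec X w)))%E.
Proof.
(* [1024 = 2 ^ 10] is lost between moment and tail, [2 ^ 24] between the tail level and [m]. *)
exists (2 ^ 34)%N; split; first by rewrite expn_gt0.
move=> R d0 Omega P d X p A T HU HL p1 A0 cT sep; split; first exact: Esup_diff.
have [I [x [xinj xT cI]]] := exists_finite_family cT.
rewrite natrX; exact: (Esup_lower_bound HU HL p1 A0 xinj xT cI sep).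
Qed.
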